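(* Let $\nu$ be a measure on $\mathfrak{P}$ (the class of finite posets) valued in a field $k$ of characteristic $0$. Then any nilpotent endomorphism in the category $\underline{\mathrm{Perm}}(\mathfrak{P},\nu)$ has trace $0$.
   Context: All posets are finite; the empty poset is allowed. An embedding of posets is an injective map $\alpha\colon P\to Q$ with $x\le y\iff\alpha(x)\le\alpha(y)$. Given embeddings $\alpha\colon P\to Q$ and $\beta\colon P\to P'$, an amalgamation of $Q$ and $P'$ over $P$ is a triple $(Q',\alpha',\beta')$ where $Q'$ is a poset and $\alpha'\colon P'\to Q'$, $\beta'\colon Q\to Q'$ are embeddings with $\beta'\circ\alpha=\alpha'\circ\beta$ and $Q'=\mathrm{im}(\alpha')\cup\mathrm{im}(\beta')$; amalgamations are considered up to the evident notion of isomorphism. A measure for $\mathfrak{P}$ valued in $k$ is a rule $\nu$ assigning to each embedding $\alpha\colon P\to Q$ of finite posets a value $\nu(\alpha)\in k$ such that: (a) $\nu(\alpha)=1$ if $\alpha$ is an isomorphism; (b) $\nu(\beta\circ\alpha)=\nu(\beta)\nu(\alpha)$ when the composition is defined; (c) given embeddings $\alpha\colon P\to Q$ and $\beta\colon P\to P'$, with $(Q'_i,\alpha'_i,\beta'_i)$, $1\le i\le r$, the various amalgamations up to isomorphism, $\nu(\alpha)=\sum_{i=1}^r\nu(\alpha'_i)$. Put $\nu(P)=\nu(\emptyset\to P)$. The category $\underline{\mathrm{Perm}}(\mathfrak{P},\nu)$ (with the structure relevant here) is the $k$-linear additive category defined as follows. Its objects are finite formal direct sums of basic objects $[P]$, one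 for each finite poset $P$; morphisms between direct sums are matrices of morphisms between basic objects. $\mathrm{Hom}([P],[Q])$ is the $k$-vector space with basis the isomorphism classes of amalgamations $R=(R,\,P\to R,\,Q\to R)$ of $P$ and $Q$ over $\emptyset$. If $R$ is an amalgamation of $P$ and $Q$, and $S$ is an amalgamation of $Q$ and $T$, the composite $S\circ R\in\mathrm{Hom}([P],[T])$ is $\sum_W\nu(U_W\to W)\,U_W$, the sum over isomorphism classes of amalgamations $W$ of $R$ and $S$ over $Q$, where $U_W\subset W$ is the union of the images of $P$ and $T$ with induced order, regarded as an amalgamation of $P$ and $T$; composition is extended bilinearly. The identity of $[P]$ is the amalgamation $(P,\mathrm{id},\mathrm{id})$. The trace of an endomorphism $f=(f_{ij})$ of $\bigoplus_i[P_i]$ is $\sum_i c_i\,\nu(P_i)\in k$, where $c_i$ is the coefficient of the basis element $(P_i,\mathrm{id},\mathrm{id})$ in $f_{ii}$. (This is the categorical trace for the tensor structure, in which $[P]\otimes[Q]$ is the direct sum of the $[R]$ over amalgamations $R$ of $P$ and $Q$ over $\emptyset$ and every $[P]$ is self-dual.) An endomorphism $f$ is nilpotent if $f^n=0$ for some $n\ge1$. *)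

(* Defs.v *)
From HB Require Import structures.
From mathcomp Require Import all_boot all_order all_algebra.

Set Implicit Arguments.
Unset Strict Implicit.
Unset Printing Implicit Defensive.

Import Order.TTheory GRing.Theory.
Local Open Scope order_scope.

(* A display only controls the printing of order relations, so fixing one     *)
(* loses no finite poset.                                                     *)
Fact poset_display : Order.disp_t.
Proof. exact: Order.Disp tt tt. Qed.

Notation fposet := (finPOrderType poset_display).

Definition empty_poset : Type := void.
HB.instance Definition _ := Finite.on empty_poset.

Definition empty_le (x y : empty_poset) : bool := true.
Lemma empty_le_refl : reflexive empty_le. Proof. by case. Qed.
Lemma empty_le_anti : antisymmetric empty_le. Proof. by case. Qed.
Lemma empty_le_trans : transitive empty_le. Proof. by case. Qed.
HB.instance Definition _ := Order.Le_isPOrder.Build poset_display empty_poset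
  empty_le_refl empty_le_anti empty_le_trans.

Definition subposet (P : fposet) (A : {pred P}) : Type := {x : P | x \in A}.
HB.instance Definition _ (P : fposet) (A : {pred P}) :=
  Finite.on (subposet A).

Section SubposetOrder.
Variables (P : fposet) (A : {pred P}).
Definition subposet_le (x y : subposet A) : bool := val x <= val y.
Lemma subposet_le_refl : reflexive subposet_le.
Proof. by move=> x; apply: lexx. Qed.
Lemma subposet_le_anti : antisymmetric subposet_le.
Proof. by move=> x y /le_anti /val_inj. Qed.
Lemma subposet_le_trans : transitive subposet_le.
Proof. by move=> y x z; apply: le_trans. Qed.
HB.instance Definition _ := Order.Le_isPOrder.Build poset_display (subposet A)
  subposet_le_refl subposet_le_anti subposet_le_trans.
End SubposetOrder.

(* Embeddings are stored as finite functions, so that pointwise equal         *)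
(* embeddings are equal.                                                      *)
Section Embedding.
Variables P Q : fposet.

Definition is_embedding (f : {ffun P -> Q}) : bool :=
  injectiveb f && [forall x, forall y, (x <= y) == (f x <= f y)].

Record embedding := Embedding {
  emb_ffun : {ffun P -> Q};
  emb_ffunP : is_embedding emb_ffun }.

HB.instance Definition _ := [isSub for emb_ffun].
HB.instance Definition _ := [Finite of embedding by <:].

Definition emb_fun (f : embedding) : P -> Q := fun x => emb_ffun f x.
Coercion emb_fun : embedding >-> Funclass.

Lemma emb_inj (f : embedding) : injective f.
Proof. by case/andP: (emb_ffunP f) => /injectiveP. Qed.

Lemma emb_mono (f : embedding) : {mono f : x y / x <= y}.
Proof.
by move=> x y; case/andP: (emb_ffunP f) => _ /'forall_'forall_eqP ->.
Qed.

Lemma mk_embedding_subproof (f : P -> Q) :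
  injective f -> {mono f : x y / x <= y} -> is_embedding (finfun f).
Proof.
move=> fI fM; apply/andP; split.
  by apply/injectiveP => x y; rewrite !ffunE => /fI.
by apply/'forall_'forall_eqP => x y; rewrite !ffunE fM.
Qed.

Definition mk_embedding (f : P -> Q) (fI : injective f)
    (fM : {mono f : x y / x <= y}) : embedding :=
  Embedding (mk_embedding_subproof fI fM).

Lemma mk_embeddingE f fI fM x : @mk_embedding f fI fM x = f x.
Proof. by rewrite /emb_fun ffunE. Qed.

Lemma embP (f g : embedding) : f =1 g -> f = g.
Proof. by move=> fg; apply/val_inj/ffunP. Qed.

End Embedding.

Definition emb_id (P : fposet) : embedding P P :=
  @mk_embedding P P id (fun _ _ => id) (fun _ _ => erefl).

Lemma emb_comp_inj (P Q R : fposet) (g : embedding Q R) (f : embedding P Q) :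
  injective (g \o f).
Proof. by move=> x y /emb_inj /emb_inj. Qed.

Lemma emb_comp_mono (P Q R : fposet) (g : embedding Q R) (f : embedding P Q) :
  {mono g \o f : x y / x <= y}.
Proof. by move=> x y /=; rewrite !emb_mono. Qed.

Definition emb_comp (P Q R : fposet) (g : embedding Q R) (f : embedding P Q) :
    embedding P R :=
  mk_embedding (@emb_comp_inj _ _ _ g f) (@emb_comp_mono _ _ _ g f).

Lemma emb0_inj (P : fposet) :
  injective (fun x : empty_poset => match x with end : P).
Proof. by case. Qed.

Lemma emb0_mono (P : fposet) :
  {mono (fun x : empty_poset => match x with end : P) : x y / x <= y}.
Proof. by case. Qed.

Definition emb0 (P : fposet) : embedding empty_poset P :=
  mk_embedding (@emb0_inj P) (@emb0_mono P).

Lemma sub_emb_inj (P : fposet) (A : {pred P}) :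
  injective (val : subposet A -> P).
Proof. exact: val_inj. Qed.

Lemma sub_emb_mono (P : fposet) (A : {pred P}) :
  {mono (val : subposet A -> P) : x y / x <= y}.
Proof. by []. Qed.

Definition sub_emb (P : fposet) (A : {pred P}) : embedding (subposet A) P :=
  mk_embedding (@sub_emb_inj P A) (@sub_emb_mono P A).

Section EmbCorestrict.
Variables (P Q : fposet) (A : {pred Q}) (f : embedding P Q).
Hypothesis fA : forall x, f x \in A.

Let g (x : P) : subposet A := exist _ (f x) (fA x).

Lemma emb_cores_inj : injective g.
Proof. by move=> x y /(congr1 val) /= /emb_inj. Qed.

Lemma emb_cores_mono : {mono g : x y / x <= y}.
Proof. by move=> x y; apply: (emb_mono f). Qed.

Definition emb_cores : embedding P (subposet A) :=
  mk_embedding emb_cores_inj emb_cores_mono.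

Lemma emb_coresE x : val (emb_cores x) = f x.
Proof. by rewrite /emb_cores mk_embeddingE. Qed.
End EmbCorestrict.

Section Amalgamation.
Variables (P Q P' : fposet) (alpha : embedding P Q) (beta : embedding P P').

Record amalgamation := Amalgamation {
  am_poset :> fposet;
  am_r : embedding P' am_poset;
  am_l : embedding Q am_poset;
  am_comm : emb_comp am_l alpha = emb_comp am_r beta;
  am_cover : forall z, (z \in codom am_r) || (z \in codom am_l) }.

Definition amalg_iso (A B : amalgamation) : Prop :=
  exists f : embedding A B,
    [/\ bijective f, emb_comp f (am_r A) = am_r B
      & emb_comp f (am_l A) = am_l B].

(* The preorder on the disjoint union of Q and P' pulled back from an         *)
(* amalgamation determines it up to isomorphism (amalg_class_eqP), and the    *)
(* preorders that arise in this way are exactly those satisfying              *)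
(* is_amalg_rel (amalg_reprK).  Hence amalg_class, the finite type of these   *)
(* preorders, is the set of isomorphism classes of amalgamations.             *)
Definition is_amalg_rel (r : {ffun (Q + P') * (Q + P') -> bool}) : bool :=
  [&& [forall u, r (u, u)],
      [forall u, forall v, forall w, r (u, v) ==> r (v, w) ==> r (u, w)],
      [forall x, forall y, r (inl x, inl y) == (x <= y)],
      [forall x, forall y, r (inr x, inr y) == (x <= y)]
    & [forall p, r (inl (alpha p), inr (beta p))
              && r (inr (beta p), inl (alpha p))]].

Record amalg_class := AmalgClass {
  amalg_rel : {ffun (Q + P') * (Q + P') -> bool};
  amalg_relP : is_amalg_rel amalg_rel }.

HB.instance Definition _ := [isSub for amalg_rel].
HB.instance Definition _ := [Finite of amalg_class by <:].

Definition am_map (A : amalgamation) (u : Q + P') : A :=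
  match u with inl x => am_l A x | inr y => am_r A y end.

Definition am_rel (A : amalgamation) : {ffun (Q + P') * (Q + P') -> bool} :=
  [ffun uv => am_map A uv.1 <= am_map A uv.2].

Lemma am_relP (A : amalgamation) : is_amalg_rel (am_rel A).
Proof.
apply/and5P; split.
- by apply/forallP => u; rewrite ffunE /= lexx.
- apply/forallP => u; apply/forallP => v; apply/forallP => w.
  rewrite !ffunE /=.
  by apply/implyP => uv; apply/implyP; apply: le_trans.
- by apply/'forall_'forall_eqP => x y; rewrite ffunE /= emb_mono.
- by apply/'forall_'forall_eqP => x y; rewrite ffunE /= emb_mono.
apply/forallP => p; rewrite !ffunE /=.
have /(congr1 (fun f : embedding _ _ => f p)) := am_comm A.
by rewrite !mk_embeddingE /= => ->; rewrite lexx.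
Qed.

Definition class_of_amalg (A : amalgamation) : amalg_class :=
  AmalgClass (am_relP A).

Section Realize.
Variable c : amalg_class.
Let r u v := amalg_rel c (u, v).

Lemma amalg_rel_refl u : r u u.
Proof. by case/and5P: (amalg_relP c) => /forallP /(_ u). Qed.
Lemma amalg_rel_trans u v w : r u v -> r v w -> r u w.
Proof.
case/and5P: (amalg_relP c) => _ /forallP /(_ u) /forallP /(_ v).
by move=> /forallP /(_ w) /implyP h _ _ _ uv; apply/implyP/h.
Qed.
Lemma amalg_rel_l x y : r (inl x) (inl y) = (x <= y).
Proof. by case/and5P: (amalg_relP c) => _ _ /'forall_'forall_eqP /(_ x y). Qed.
Lemma amalg_rel_r x y : r (inr x) (inr y) = (x <= y).
Proof. by case/and5P: (amalg_relP c) => _ _ _ /'forall_'forall_eqP /(_ x y). Qed.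
Lemma amalg_rel_lr p :
  r (inl (alpha p)) (inr (beta p)) && r (inr (beta p)) (inl (alpha p)).
Proof. by case/and5P: (amalg_relP c) => _ _ _ _ /forallP /(_ p). Qed.

(* The quotient poset of the preorder, realized as its set of principal       *)
(* down-sets ordered by inclusion.                                            *)
Definition downset (u : Q + P') : {set Q + P'} := [set v | r v u].

Definition amalg_carrier : Type :=
  {D : {set Q + P'} | D \in codom downset}.
HB.instance Definition _ := Finite.on amalg_carrier.

Definition carrier_le (D E : amalg_carrier) : bool := val D \subset val E.
Lemma carrier_le_refl : reflexive carrier_le.
Proof. by move=> D; apply: subxx. Qed.
Lemma carrier_le_anti : antisymmetric carrier_le.
Proof. by move=> D E; rewrite /carrier_le -eqEsubset => /eqP/val_inj. Qed.
Lemma carrier_le_trans : transitive carrier_le.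
Proof. by move=> E D F; apply: subset_trans. Qed.
HB.instance Definition _ := Order.Le_isPOrder.Build poset_display amalg_carrier
  carrier_le_refl carrier_le_anti carrier_le_trans.

Definition to_carrier (u : Q + P') : amalg_carrier :=
  exist _ (downset u) (codom_f downset u).

Lemma to_carrier_le u v : (to_carrier u <= to_carrier v) = r u v.
Proof.
apply/subsetP/idP => [/(_ u)|uv w]; rewrite !inE.
  by apply; apply: amalg_rel_refl.
by move=> wu; apply: amalg_rel_trans uv.
Qed.

Lemma carrier_r_mono : {mono (fun y => to_carrier (inr y)) : x y / x <= y}.
Proof. by move=> x y; rewrite to_carrier_le amalg_rel_r. Qed.
Lemma carrier_l_mono : {mono (fun x => to_carrier (inl x)) : x y / x <= y}.
Proof. by move=> x y; rewrite to_carrier_le amalg_rel_l. Qed.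

Definition carrier_r : embedding P' amalg_carrier :=
  mk_embedding (inc_inj carrier_r_mono) carrier_r_mono.
Definition carrier_l : embedding Q amalg_carrier :=
  mk_embedding (inc_inj carrier_l_mono) carrier_l_mono.

Lemma carrier_comm : emb_comp carrier_l alpha = emb_comp carrier_r beta.
Proof.
apply: embP => p; rewrite !mk_embeddingE /= !mk_embeddingE.
by apply: le_anti; rewrite !to_carrier_le; apply: amalg_rel_lr.
Qed.

Lemma carrier_cover z : (z \in codom carrier_r) || (z \in codom carrier_l).
Proof.
case: z => D DP; have /codomP [[x|y] Du] := DP; apply/orP; [right|left].
  apply/codomP; exists x; apply: val_inj.
  by rewrite mk_embeddingE.
by apply/codomP; exists y; apply: val_inj; rewrite mk_embeddingE.
Qed.

Definition amalg_repr : amalgamation :=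
  Amalgamation carrier_comm carrier_cover.

Lemma amalg_reprK : class_of_amalg amalg_repr = c.
Proof.
apply: val_inj; apply/ffunP => -[u v]; rewrite ffunE /=.
have E w : am_map amalg_repr w = to_carrier w.
  by case: w => x; rewrite /= mk_embeddingE.
by rewrite !E to_carrier_le.
Qed.

End Realize.

Lemma am_map_surj (A : amalgamation) (z : A) : exists u, am_map A u = z.
Proof.
by case/orP: (am_cover z) => /codomP [x ->]; [exists (inr x) | exists (inl x)].
Qed.

Lemma amalg_class_eqP (A B : amalgamation) :
  amalg_iso A B <-> class_of_amalg A = class_of_amalg B.
Proof.
split=> [[f [_ fr fl]]|/(congr1 amalg_rel) /= /ffunP eAB].
  apply: val_inj; apply/ffunP => -[u v]; rewrite !ffunE /=.
  have E w : am_map B w = f (am_map A w).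
    by case: w => x /=; rewrite -?fl -?fr mk_embeddingE.
  by rewrite !E emb_mono.
have {}eAB u v : (am_map A u <= am_map A v) = (am_map B u <= am_map B v).
  by have := eAB (u, v); rewrite !ffunE.
have eqAB u v : am_map A u = am_map A v <-> am_map B u = am_map B v.
  by split=> E; apply: le_anti; [rewrite -!eAB | rewrite !eAB];
     rewrite E lexx.
have surjA (z : A) : exists u, am_map A u == z.
  by have [u <-] := am_map_surj z; exists u.
have surjB (z : B) : exists u, am_map B u == z.
  by have [u <-] := am_map_surj z; exists u.
pose f z := am_map B (xchoose (surjA z)).
pose g z := am_map A (xchoose (surjB z)).
have fE u : f (am_map A u) = am_map B u.
  by apply/eqAB/eqP; apply: (xchooseP (surjA (am_map A u))).
have gE u : g (am_map B u) = am_map A u.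
  by apply/eqAB/eqP; apply: (xchooseP (surjB (am_map B u))).
have fK : cancel f g.
  by move=> z; have [u <-] := am_map_surj z; rewrite fE gE.
have gK : cancel g f.
  by move=> z; have [u <-] := am_map_surj z; rewrite gE fE.
have fM : {mono f : x y / x <= y}.
  move=> x y; have [u <-] := am_map_surj x; have [v <-] := am_map_surj y.
  by rewrite !fE eAB.
exists (mk_embedding (can_inj fK) fM); split.
- by exists g => z; rewrite mk_embeddingE.
- by apply: embP => y; rewrite !mk_embeddingE /= mk_embeddingE (fE (inr y)).
- by apply: embP => x; rewrite !mk_embeddingE /= mk_embeddingE (fE (inl x)).
Qed.

End Amalgamation.

Local Open Scope ring_scope.

Record measure (k : fieldType) := Measure {
  mu_val : forall P Q : fposet, embedding P Q -> k;
  mu_iso : forall (P Q : fposet) (alpha : embedding P Q),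
    bijective alpha -> mu_val alpha = 1;
  mu_comp : forall (P Q R : fposet) (beta : embedding Q R)
      (alpha : embedding P Q),
    mu_val (emb_comp beta alpha) = mu_val beta * mu_val alpha;
  mu_amalg : forall (P Q P' : fposet) (alpha : embedding P Q)
      (beta : embedding P P'),
    mu_val alpha =
      \sum_(c : amalg_class alpha beta) mu_val (am_r (amalg_repr c)) }.

Definition mu_poset (k : fieldType) (nu : measure k) (P : fposet) : k :=
  mu_val nu (emb0 P).

Notation amalgamation0 P Q := (amalgamation (emb0 P) (emb0 Q)).
Notation amalg_class0 P Q := (amalg_class (emb0 P) (emb0 Q)).

Lemma emb0_eq (R : fposet) (f g : embedding empty_poset R) : f = g.
Proof. by apply: embP; case. Qed.

Lemma id_cover (P : fposet) (z : P) :
  (z \in codom (emb_id P)) || (z \in codom (emb_id P)).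
Proof.
by rewrite orbb; apply/codomP; exists z; rewrite mk_embeddingE.
Qed.

Definition id_amalg (P : fposet) : amalgamation0 P P :=
  Amalgamation (emb0_eq _ _) (@id_cover P).

Section OuterAmalgamation.
Variables (P Q T : fposet) (R : amalgamation0 P Q) (S : amalgamation0 Q T).
Variable W : amalgamation (am_r R) (am_l S).

Definition outer_l : embedding P W := emb_comp (am_l W) (am_l R).
Definition outer_r : embedding T W := emb_comp (am_r W) (am_r S).

Definition outer_set : {pred W} :=
  [predU (codom outer_l) & (codom outer_r)].

Lemma outer_l_in x : outer_l x \in outer_set.
Proof. by rewrite inE codom_f. Qed.
Lemma outer_r_in y : outer_r y \in outer_set.
Proof. by rewrite inE codom_f orbT. Qed.

Lemma outer_cover z :
  (z \in codom (emb_cores outer_r_in)) || (z \in codom (emb_cores outer_l_in)).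
Proof.
case: z => z zW; apply/orP; have := zW; rewrite inE.
by case/orP=> /codomP [x zx]; [right | left]; apply/codomP; exists x;
   apply: val_inj; rewrite emb_coresE.
Qed.

Definition outer_amalg : amalgamation0 P T :=
  Amalgamation (emb0_eq (emb_comp (emb_cores outer_l_in) _) _) outer_cover.

Definition outer_emb : embedding outer_amalg W := sub_emb outer_set.
End OuterAmalgamation.

Section Perm.
Variables (k : fieldType) (nu : measure k).

(* The k-vector space with basis amalg_class0 P Q; k^o is k as a vector space *)
(* over itself.                                                               *)
Definition hom (P Q : fposet) : Type := {ffun amalg_class0 P Q -> k^o}.
HB.instance Definition _ P Q := GRing.Lmodule.on (hom P Q).

Definition hom_basis (P Q : fposet) (c : amalg_class0 P Q) : hom P Q :=
  [ffun c' => (c' == c)%:R].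

Definition hom_id (P : fposet) : hom P P :=
  hom_basis (class_of_amalg (id_amalg P)).

Definition comp_basis (P Q T : fposet)
    (S : amalg_class0 Q T) (R : amalg_class0 P Q) : hom P T :=
  \sum_(W : amalg_class (am_r (amalg_repr R)) (am_l (amalg_repr S)))
     mu_val nu (outer_emb (amalg_repr W))
       *: hom_basis (class_of_amalg (outer_amalg (amalg_repr W))).

Definition hom_comp (P Q T : fposet) (g : hom Q T) (f : hom P Q) : hom P T :=
  \sum_(S : amalg_class0 Q T) \sum_(R : amalg_class0 P Q)
     (g S * f R) *: comp_basis S R.

(* The formal direct sum of the [summand i]. *)
Record perm_obj := PermObj {
  num_summands : nat;
  summand : 'I_num_summands -> fposet }.

Definition perm_hom (X Y : perm_obj) : Type :=
  forall (i : 'I_(num_summands Y)) (j : 'I_(num_summands X)),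
    hom (summand j) (summand i).

Definition perm_comp (X Y Z : perm_obj) (g : perm_hom Y Z) (f : perm_hom X Y) :
    perm_hom X Z :=
  fun i j => \sum_l hom_comp (g i l) (f l j).

(* [perm_exp f n] is the power f^(n+1). *)
Fixpoint perm_exp (X : perm_obj) (f : perm_hom X X) (n : nat) : perm_hom X X :=
  if n is m.+1 then perm_comp f (perm_exp f m) else f.

Definition perm_nilpotent (X : perm_obj) (f : perm_hom X X) : Prop :=
  exists n : nat, forall i j, perm_exp f n i j = 0.

Definition perm_trace (X : perm_obj) (f : perm_hom X X) : k :=
  \sum_i f i i (class_of_amalg (id_amalg (summand i)))
           * mu_poset nu (summand i).

End Perm.

(* Main.v *)
Require Import Defs.
From HB Require Import structures.
From mathcomp Require Import all_boot all_order all_algebra.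
From mathcomp Require Import all_fingroup all_solvable all_field.
From mathcomp Require Import ring zify.
From Stdlib Require Import Classical ClassicalEpsilon.
Require Import Defs.

Set Implicit Arguments.
Unset Strict Implicit.
Unset Printing Implicit Defensive.

Import Order.TTheory GRing.Theory Num.Theory.
Local Open Scope ring_scope.

(** The proof compares the trace of [f ^ p] with the [p]-th power of the trace
    of [f], for a large prime [p].

    Write [w P] for the measure of the embedding of the empty poset into [P].
    Axioms (b) and (c) give [w Q * w P' = w P * \sum_W w W], the sum being over
    the amalgamations [W] of [Q] and [P'] over [P], and [w] vanishes on every
    poset that contains a poset of weight zero.  Multiplying a coefficient of a
    composite morphism by the weight of its basis element removes all relative
    measures: composition becomes a sum over the possible positions of the
    middle object, weighted by [w] ([comp_formula], [coef_comp]).  Iterating,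
    the trace of [f ^ p] is the sum, over all configurations of [p] summands
    placed on a cycle, of the product of the coefficients of [f] along the cycle
    times the weight of the configuration ([trace_power]).

    The weights are integer polynomials in the weight [t] of the point
    ([weight_poly]).  Indeed, relations between posets with at most four
    elements leave only three possibilities when [t] is not zero
    ([trichotomy]): the posets of nonzero weight are antichains, or weak orders,
    or disjoint unions of chains.  In each case amalgamation determines all
    weights, and the weight of a poset that contains an antichain with [m]
    elements is divisible by the product of the [t + eps * j] for [j < m], where
    [eps] is a sign that depends on the measure only.

    Suppose that [f] is nilpotent of nonzero trace.  The subring of [k] that is
    generated by [t] and the coefficients of [f] has, for arbitrarily large
    primes [p], a homomorphism [phi] to a field of characteristic [p] that sends
    [t] into the prime field and does not kill the trace of [f] ([residue_point],
    [specialize]).  Apply [phi] to the formula for the trace of [f ^ p], which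
    is zero.  The cyclic group of order [p] rotates the configurations, so only
    the configurations that are fixed by rotation count modulo [p]
    ([sum_fixed]).  Such a configuration either is constant, or contains an
    antichain with [p] elements ([rotate_fixed]); in the second case its weight
    is divisible by [p] consecutive integers modulo [p], hence killed by [phi].
    The constant configurations add up to [phi (trace f) ^ p], because the
    weights are sent to the prime field, where the Frobenius map is the
    identity.  Hence [phi (trace f) = 0], a contradiction. *)

(** * Partial preorders, their quotient posets and their weights *)

Notation brel T := {ffun T * T -> bool}.

Section PartialPreorders.
Variable T : finType.
Implicit Types e : brel T.

(** A preorder on a subset of [T]: the subset consists of the [u] with
    [e (u, u)].  Keeping all amalgamations inside one ambient type [T] turns
    isomorphism classes into equalities of relations. *)
Definition ppo e : bool :=
  [forall u, forall v, forall w, e (u, v) ==> e (v, w) ==> e (u, w)]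
  && [forall u, forall v, e (u, v) ==> e (u, u) && e (v, v)].

Lemma ppoP e :
  reflect ((forall v u w, e (u, v) -> e (v, w) -> e (u, w))
           /\ (forall u v, e (u, v) -> e (u, u) /\ e (v, v))) (ppo e).
Proof.
apply: (iffP andP) => -[h1 h2]; split.
- move=> v u w uv vw.
  by move/forallP/(_ u)/forallP/(_ v)/forallP/(_ w): h1; rewrite uv vw.
- move=> u v uv; apply/andP.
  by move/forallP/(_ u)/forallP/(_ v): h2; rewrite uv.
- apply/forallP => u; apply/forallP => v; apply/forallP => w.
  by apply/implyP => uv; apply/implyP; apply: h1 uv.
- apply/forallP => u; apply/forallP => v; apply/implyP => uv.
  exact/andP/h2.
Qed.

(** A poset whose points carry labels in [T], possibly several per point, is
    encoded by a partial function [h] from labels to points. *)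
Definition pull (Q : fposet) (h : T -> option Q) : brel T :=
  [ffun uv => if h uv.1 is Some a
              then if h uv.2 is Some b then (a <= b)%O else false else false].

Definition onto (Q : fposet) (h : T -> option Q) : Prop :=
  forall a, exists u, h u = Some a.

Lemma pull_refl (Q : fposet) (h : T -> option Q) u :
  pull h (u, u) = isSome (h u).
Proof. by rewrite ffunE /=; case: (h u) => //= a; rewrite lexx. Qed.

Lemma pullE (Q : fposet) (h : T -> option Q) u v a b :
  h u = Some a -> h v = Some b -> pull h (u, v) = (a <= b)%O.
Proof. by move=> hu hv; rewrite ffunE /= hu hv. Qed.

Lemma ppo_pull (Q : fposet) (h : T -> option Q) : ppo (pull h).
Proof.
apply/ppoP; split=> [v u w | u v]; rewrite !ffunE /=.
  by case: (h u) => // a; case: (h v) => // b; case: (h w) => // c; apply: le_trans.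
by case: (h u) => // a; case: (h v) => // b; rewrite !lexx.
Qed.

Definition dnset e (u : T) : {set T} := [set v | e (v, u)].

(** As for amalgamation classes, the quotient poset consists of principal
    down-sets, ordered by inclusion. *)
Definition quot_pred e : pred {set T} :=
  fun D => [exists u, e (u, u) && (D == dnset e u)].

Definition quot e : Type := {D : {set T} | quot_pred e D}.
HB.instance Definition _ e := Finite.on (quot e).

Section QuotOrder.
Variable e : brel T.
Definition quot_le (x y : quot e) : bool := val x \subset val y.
Lemma quot_le_refl : reflexive quot_le.
Proof. by move=> x; apply: subxx. Qed.
Lemma quot_le_anti : antisymmetric quot_le.
Proof. by move=> x y; rewrite /quot_le -eqEsubset => /eqP/val_inj. Qed.
Lemma quot_le_trans : transitive quot_le.
Proof. by move=> y x z; apply: subset_trans. Qed.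
HB.instance Definition _ := Order.Le_isPOrder.Build poset_display (quot e)
  quot_le_refl quot_le_anti quot_le_trans.
End QuotOrder.

Definition lab e (u : T) : option (quot e) :=
  if e (u, u) then (insub (dnset e u) : option {D | quot_pred e D}) else None.

Lemma labP e u : e (u, u) -> exists2 a, lab e u = Some a & val a = dnset e u.
Proof.
move=> uu; rewrite /lab uu.
have h : quot_pred e (dnset e u) by apply/existsP; exists u; rewrite uu eqxx.
by rewrite (insubT _ h); eexists.
Qed.

Lemma onto_lab e : onto (@lab e).
Proof.
move=> a; have /existsP [u /andP [uu /eqP au]] := valP a.
exists u; have [b -> bu] := labP uu; congr Some.
by apply: val_inj; rewrite bu au.
Qed.

Lemma pull_lab e : ppo e -> pull (@lab e) = e.
Proof.
case/ppoP=> tr rf; apply/ffunP => -[u v]; rewrite ffunE /=.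
case uu: (e (u, u)); last first.
  by rewrite /lab uu; apply/esym/negbTE/negP => /rf []; rewrite uu.
have [a -> au] := labP uu.
case vv: (e (v, v)); last first.
  by rewrite /lab vv; apply/esym/negbTE/negP => /rf []; rewrite vv.
have [b -> bv] := labP vv.
apply/subsetP/idP => [/(_ u)|uv w]; rewrite au bv !inE; first exact.
by move=> wu; apply: tr uv.
Qed.

End PartialPreorders.

Lemma emb_compE (P Q R : fposet) (g : embedding Q R) (f : embedding P Q) x :
  emb_comp g f x = g (f x).
Proof. by rewrite mk_embeddingE. Qed.

(** Labelled posets are determined by their pulled-back preorder: a map of labels
    that respects the preorders induces an embedding of posets. *)
Lemma factor_emb (T T' : finType) (P Q : fposet) (hP : T -> option P)
    (hQ : T' -> option Q) (g : T -> T') :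
  onto hP ->
  (forall u v, hP u -> hP v -> pull hQ (g u, g v) = pull hP (u, v)) ->
  exists alpha : embedding P Q,
    forall u p, hP u = Some p -> hQ (g u) = Some (alpha p).
Proof.
move=> oP eq.
have /fin_all_exists [f fP] : forall p, exists q,
    exists2 u, hP u = Some p & hQ (g u) = Some q.
  move=> p; have [u hu] := oP p.
  have := eq u u; rewrite hu !pull_refl hu => /(_ isT isT).
  by case hq: (hQ (g u)) => [q|] // _; exists q; exists u.
have fM : {mono f : x y / (x <= y)%O}.
  move=> x y; have [u hu qu] := fP x; have [v hv qv] := fP y.
  by rewrite -(pullE qu qv) eq ?hu ?hv // (pullE hu hv).
exists (mk_embedding (inc_inj fM) fM) => u p hu; rewrite mk_embeddingE.
have := eq u u; rewrite hu !pull_refl hu => /(_ isT isT).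
case hq: (hQ (g u)) => [q|] // _; congr Some.
have [v' hv' qv'] := fP p.
have e1 := eq u v'; have e2 := eq v' u.
rewrite hu hv' in e1 e2.
move: (e1 isT isT) (e2 isT isT).
rewrite (pullE hq qv') (pullE qv' hq) (pullE hu hv') (pullE hv' hu) lexx => l1 l2.
by apply: le_anti; rewrite l1 l2.
Qed.

Section Weights.
Variables (k : fieldType) (nu : measure k).
Notation w := (mu_poset nu).

Lemma w_emb (P Q : fposet) (alpha : embedding P Q) :
  w Q = mu_val nu alpha * w P.
Proof. by rewrite /mu_poset -mu_comp; congr mu_val; apply: emb0_eq. Qed.

Lemma w_iso (P Q : fposet) (alpha : embedding P Q) :
  bijective alpha -> w P = w Q.
Proof. by move=> /(mu_iso nu) h; rewrite (w_emb alpha) h mul1r. Qed.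

Lemma surj_bij (P Q : fposet) (alpha : embedding P Q) :
  (forall q, exists p, alpha p = q) -> bijective alpha.
Proof.
move=> /fin_all_exists [g gK]; exists g => // x.
exact/(@emb_inj _ _ alpha).
Qed.

Lemma w_amalg (P Q P' : fposet) (alpha : embedding P Q) (beta : embedding P P') :
  w Q * w P' = w P * \sum_(c : amalg_class alpha beta) w (amalg_repr c).
Proof.
rewrite (w_emb alpha) (mu_amalg nu alpha beta) mulrAC mulrC; congr (_ * _).
by rewrite mulr_suml; apply: eq_bigr => c _; rewrite -w_emb.
Qed.

(** The value zero outside partial preorders makes it possible to sum weights
    over candidate relations, valid or not. *)
Definition weight (T : finType) (e : brel T) : k := if ppo e then w (quot e) else 0.

Lemma wr_pull (T : finType) (Q : fposet) (h : T -> option Q) :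
  onto h -> weight (pull h) = w Q.
Proof.
move=> oh; rewrite /weight ppo_pull.
have [|alpha aP] := @factor_emb _ _ _ _ (@lab _ (pull h)) h id (@onto_lab _ _).
  by move=> u v _ _; rewrite pull_lab // ppo_pull.
apply: (w_iso (alpha := alpha)); apply: surj_bij => q; have [u hu] := oh q.
have [|a la _] := @labP _ (pull h) u; first by rewrite pull_refl hu.
by exists a; have := aP _ _ la; rewrite hu => -[].
Qed.

(** By axiom (b) the weight of a poset is a multiple of the weight of each poset
    that embeds into it. *)
Lemma wr_sub (T' T : finType) (e' : brel T') (e : brel T) (g : T' -> T) :
  ppo e' ->
  (forall u v, e' (u, u) -> e' (v, v) -> e (g u, g v) = e' (u, v)) ->
  weight e' = 0 -> weight e = 0.
Proof.
rewrite /weight => pe' eg; rewrite pe'; case: ifP => // pe w0.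
have [|alpha _] := @factor_emb _ _ _ _ (@lab _ e') (@lab _ e) g (@onto_lab _ _).
  move=> u v; rewrite -!pull_refl !pull_lab // => uu vv; exact: eg.
by rewrite (w_emb alpha) w0 mulr0.
Qed.

Lemma wr_eq (T' T : finType) (e' : brel T') (e : brel T) (g : T' -> T) :
  ppo e' -> ppo e ->
  (forall u v, e' (u, u) -> e' (v, v) -> e (g u, g v) = e' (u, v)) ->
  (forall v, e (v, v) -> exists u, [/\ e' (u, u), e (v, g u) & e (g u, v)]) ->
  weight e' = weight e.
Proof.
rewrite /weight => pe' pe eg es; rewrite pe' pe.
have [|alpha aP] := @factor_emb _ _ _ _ (@lab _ e') (@lab _ e) g (@onto_lab _ _).
  move=> u v; rewrite -!pull_refl !pull_lab // => uu vv; exact: eg.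
apply: (w_iso (alpha := alpha)); apply: surj_bij => q.
have [v hv] := onto_lab q.
have /es [u [uu l1 l2]] : e (v, v) by rewrite -(pull_lab pe) pull_refl hv.
have [a la _] := labP uu; exists a; have ha := aP _ _ la.
have labE x y : e (x, y) = pull (@lab _ e) (x, y) by rewrite pull_lab.
move: l1 l2; rewrite !labE (pullE hv ha) (pullE ha hv) => l1 l2.
by apply: le_anti; rewrite l1 l2.
Qed.

Section Glue.
Variable T : finType.
Implicit Types e : brel T.

(** [e] is a common extension of [e1] and [e2] with the smallest possible domain:
    an amalgamation, seen in the ambient type. *)
Definition glue (e1 e2 e : brel T) : bool :=
  [&& ppo e,
      [forall u, forall v, e1 (u, u) ==> e1 (v, v) ==> (e (u, v) == e1 (u, v))],
      [forall u, forall v, e2 (u, u) ==> e2 (v, v) ==> (e (u, v) == e2 (u, v))]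
    & [forall u, e (u, u) ==> e1 (u, u) || e2 (u, u)]].

Lemma glueP e1 e2 e :
  reflect [/\ ppo e,
     forall u v, e1 (u, u) -> e1 (v, v) -> e (u, v) = e1 (u, v),
     forall u v, e2 (u, u) -> e2 (v, v) -> e (u, v) = e2 (u, v)
   & forall u, e (u, u) -> e1 (u, u) || e2 (u, u)] (glue e1 e2 e).
Proof.
apply: (iffP and4P) => -[h0 h1 h2 h3]; split => //.
- by move=> u v uu vv; move/forallP/(_ u)/forallP/(_ v): h1; rewrite uu vv => /eqP.
- by move=> u v uu vv; move/forallP/(_ u)/forallP/(_ v): h2; rewrite uu vv => /eqP.
- by move=> u uu; move/forallP/(_ u): h3; rewrite uu.
- apply/forallP => u; apply/forallP => v; apply/implyP => uu; apply/implyP => vv.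
  by rewrite h1.
- apply/forallP => u; apply/forallP => v; apply/implyP => uu; apply/implyP => vv.
  by rewrite h2.
- by apply/forallP => u; apply/implyP/h3.
Qed.

Definition amalg_lab (P Q P' : fposet) (alpha : embedding P Q) (beta : embedding P P')
    (hQ : T -> option Q) (hP' : T -> option P') (A : amalgamation alpha beta)
    (u : T) : option A :=
  if hQ u is Some a then Some (am_l A a) else omap (am_r A) (hP' u).

Section Conv.
Variables (P Q P' : fposet) (alpha : embedding P Q) (beta : embedding P P').
Variables (hP : T -> option P) (hQ : T -> option Q) (hP' : T -> option P').
Hypotheses (oP : onto hP) (oQ : onto hQ) (oP' : onto hP').
Hypothesis hPc : forall u p, hP u = Some p ->
  hQ u = Some (alpha p) /\ hP' u = Some (beta p).
Hypothesis hPi : forall u, hQ u -> hP' u -> hP u.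

Lemma amalg_lab_l (A : amalgamation alpha beta) u a :
  hQ u = Some a -> amalg_lab hQ hP' A u = Some (am_l A a).
Proof. by rewrite /amalg_lab => ->. Qed.

Lemma amalg_lab_r (A : amalgamation alpha beta) u b :
  hP' u = Some b -> amalg_lab hQ hP' A u = Some (am_r A b).
Proof.
rewrite /amalg_lab; case hq: (hQ u) => [a|] hp'; last by rewrite hp'.
have := @hPi u; rewrite hq hp' => /(_ isT isT).
case hp: (hP u) => [p|] // _; have [] := hPc hp.
rewrite hq hp' => -[->] [->].
have /(congr1 (fun f : embedding _ _ => f p)) := am_comm A.
by rewrite !mk_embeddingE /= => ->.
Qed.

Lemma amalg_lab_onto (A : amalgamation alpha beta) : onto (@amalg_lab _ _ _ alpha beta hQ hP' A).
Proof.
move=> z; have /orP [] := am_cover z => /codomP [x ->].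
  by have [u hu] := oP' x; exists u; rewrite (amalg_lab_r _ hu).
by have [u hu] := oQ x; exists u; rewrite (amalg_lab_l _ hu).
Qed.

Lemma glue_amalg_lab (A : amalgamation alpha beta) :
  glue (pull hQ) (pull hP') (pull (@amalg_lab _ _ _ alpha beta hQ hP' A)).
Proof.
apply/glueP; split.
- exact: ppo_pull.
- move=> u v; rewrite !pull_refl.
  case hu: (hQ u) => [a|] // _; case hv: (hQ v) => [b|] // _.
  by rewrite (pullE (amalg_lab_l _ hu) (amalg_lab_l _ hv)) (pullE hu hv) emb_mono.
- move=> u v; rewrite !pull_refl.
  case hu: (hP' u) => [a|] // _; case hv: (hP' v) => [b|] // _.
  by rewrite (pullE (amalg_lab_r _ hu) (amalg_lab_r _ hv)) (pullE hu hv) emb_mono.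
- move=> u; rewrite !pull_refl /amalg_lab.
  by case: (hQ u) => //; case: (hP' u).
Qed.

Lemma pull_amalg_lab_inj :
  injective (fun c : amalg_class alpha beta => pull (amalg_lab hQ hP' (amalg_repr c))).
Proof.
move=> c d /= /ffunP ecd.
rewrite -(amalg_reprK c) -(amalg_reprK d); apply: val_inj; apply/ffunP => -[u v].
rewrite !ffunE /=.
have Lc (x : Q + P') : exists t,
    forall A : amalgamation alpha beta, amalg_lab hQ hP' A t = Some (am_map A x).
  case: x => x; first by have [t ht] := oQ x; exists t => A; rewrite (amalg_lab_l _ ht).
  by have [t ht] := oP' x; exists t => A; rewrite (amalg_lab_r _ ht).
have [tu hu] := Lc u; have [tv hv] := Lc v.
by have := ecd (tu, tv); rewrite (pullE (hu _) (hv _)) (pullE (hu _) (hv _)).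
Qed.

Lemma glue_pull_ex e :
  glue (pull hQ) (pull hP') e ->
  exists c : amalg_class alpha beta, pull (amalg_lab hQ hP' (amalg_repr c)) = e.
Proof.
case/glueP => pe e1 e2 e3; have /ppoP [tr rf] := pe.
have [al alP] : exists al : embedding Q (quot e),
    forall u q, hQ u = Some q -> lab e (id u) = Some (al q).
  apply: (factor_emb (hQ := @lab _ e) (g := id)) => // u v.
  by rewrite -!pull_refl pull_lab // => uu vv; rewrite -e1.
have [ar arP] : exists ar : embedding P' (quot e),
    forall u q, hP' u = Some q -> lab e (id u) = Some (ar q).
  apply: (factor_emb (hQ := @lab _ e) (g := id)) => // u v.
  by rewrite -!pull_refl pull_lab // => uu vv; rewrite -e2.
have cm : emb_comp al alpha = emb_comp ar beta.
  apply: embP => p; rewrite !mk_embeddingE /=.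
  have [u hu] := oP p; have [hq hp'] := hPc hu.
  by have := alP _ _ hq; rewrite (arP _ _ hp') => -[].
have cv z : (z \in codom ar) || (z \in codom al).
  have [u hu] := onto_lab z.
  have uu : e (u, u) by rewrite -(pull_lab pe) pull_refl hu.
  have := e3 _ uu; rewrite !pull_refl.
  case hq: (hQ u) => [a|] /=.
    move=> _; apply/orP; right; apply/codomP; exists a.
    by have := alP _ _ hq; rewrite /= hu => -[].
  case hp: (hP' u) => [a|] //= _; apply/orP; left; apply/codomP; exists a.
  by have := arP _ _ hp; rewrite /= hu => -[].
pose A := Amalgamation cm cv.
exists (class_of_amalg A).
have /amalg_class_eqP [f [_ fr fl]] := amalg_reprK (class_of_amalg A).
have fL q : f (am_l _ q) = al q.
  by have := congr1 (fun g : embedding _ _ => g q) fl; rewrite mk_embeddingE.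
have fR q : f (am_r _ q) = ar q.
  by have := congr1 (fun g : embedding _ _ => g q) fr; rewrite mk_embeddingE.
rewrite -[RHS](pull_lab pe); apply/ffunP => -[u v].
have key x : omap f (amalg_lab hQ hP' (amalg_repr (class_of_amalg A)) x) = lab e x.
  case hq: (hQ x) => [a|].
    by rewrite (amalg_lab_l _ hq) /= fL -(alP _ _ hq).
  case hp: (hP' x) => [a|].
    by rewrite (amalg_lab_r _ hp) /= fR -(arP _ _ hp).
  rewrite /amalg_lab hq hp /= /lab; case: ifP => // xx.
  by have := e3 _ xx; rewrite !pull_refl hq hp.
rewrite !ffunE /= -!key.
case: (amalg_lab _ _ _ u) => [a|] //=; case: (amalg_lab _ _ _ v) => [b|] //=.
by rewrite emb_mono.
Qed.

(** The preorder on labels determines an amalgamation up to isomorphism, and each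
    common extension of the two preorders arises in this way; so a sum over
    isomorphism classes of amalgamations is a sum over relations. *)
Lemma sum_amalg_glue (R : nmodType) (F : brel T -> R) :
  \sum_(c : amalg_class alpha beta) F (pull (amalg_lab hQ hP' (amalg_repr c)))
  = \sum_(e | glue (pull hQ) (pull hP') e) F e.
Proof.
pose Phi (c : amalg_class alpha beta) := pull (amalg_lab hQ hP' (amalg_repr c)).
rewrite -[LHS]/(\sum_c F (Phi c)).
transitivity (\sum_(e in [set Phi c | c in [set: amalg_class alpha beta]]) F e).
  rewrite big_imset /=; last by move=> c d _ _; apply: pull_amalg_lab_inj.
  by apply: eq_bigl => c; rewrite inE.
apply: eq_bigl => e; apply/imsetP/idP => [[c _ ->]|/glue_pull_ex [c ec]].
  exact: glue_amalg_lab.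
by exists c; rewrite ?inE.
Qed.

End Conv.

(** For preorders that agree on the intersection of their domains, this is their
    common restriction to that intersection. *)
Definition meet (e1 e2 : brel T) : brel T := [ffun uv => e1 uv && e2 uv].

(** Axiom (c), multiplied by weights so that only absolute measures occur. *)
Lemma wr_glue (e1 e2 : brel T) : ppo e1 -> ppo e2 ->
  (forall u v, e1 (u, u) -> e1 (v, v) -> e2 (u, u) -> e2 (v, v) ->
     e1 (u, v) = e2 (u, v)) ->
  weight e1 * weight e2 = weight (meet e1 e2) * \sum_(e | glue e1 e2 e) weight e.
Proof.
move=> p1 p2 e12; have /ppoP [t1 r1] := p1; have /ppoP [t2 r2] := p2.
have pm : ppo (meet e1 e2).
  apply/ppoP; split=> [v u x|u v]; rewrite !ffunE.
    case/andP=> a b /andP [c d]; apply/andP; split.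
      exact: t1 a c.
    exact: t2 b d.
  by case/andP=> /r1 [-> ->] /r2 [-> ->].
have [al alP] : exists al : embedding (quot (meet e1 e2)) (quot e1),
    forall u q, lab (meet e1 e2) u = Some q -> lab e1 (id u) = Some (al q).
  apply: factor_emb; first exact: onto_lab.
  move=> u v; rewrite -!pull_refl !pull_lab // !ffunE => /andP [a b] /andP [c d].
  by rewrite -e12 ?andbb.
have [be beP] : exists be : embedding (quot (meet e1 e2)) (quot e2),
    forall u q, lab (meet e1 e2) u = Some q -> lab e2 (id u) = Some (be q).
  apply: factor_emb; first exact: onto_lab.
  move=> u v; rewrite -!pull_refl !pull_lab // !ffunE => /andP [a b] /andP [c d].
  by rewrite e12 ?andbb.
have hc u p : lab (meet e1 e2) u = Some p ->
    lab e1 u = Some (al p) /\ lab e2 u = Some (be p).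
  by move=> hu; split; [apply: alP | apply: beP].
have hi u : lab e1 u -> lab e2 u -> lab (meet e1 e2) u.
  by rewrite -!pull_refl !pull_lab // ffunE => -> ->.
rewrite {1 2 3}/weight p1 p2 pm (w_amalg al be); congr (_ * _).
have oA := amalg_lab_onto (@onto_lab _ e1) (@onto_lab _ e2) hc hi.
rewrite -[e1 in RHS](pull_lab p1) -[e2 in RHS](pull_lab p2).
rewrite -(sum_amalg_glue (@onto_lab _ _) (@onto_lab _ _) (@onto_lab _ _) hc hi).
by apply: eq_bigr => c _; rewrite wr_pull.
Qed.

End Glue.
End Weights.

(** * Composition as a sum over amalgamations *)

Section PairClass.
Variables (P Q Z : fposet) (p : embedding P Z) (q : embedding Q Z).

Definition pair_map (x : P + Q) : Z :=
  match x with inl a => p a | inr b => q b end.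

Definition pair_rel : brel (P + Q)%type :=
  [ffun uv => (pair_map uv.1 <= pair_map uv.2)%O].

Lemma pair_relP : is_amalg_rel (emb0 P) (emb0 Q) pair_rel.
Proof.
apply/and5P; split.
- by apply/forallP => u; rewrite ffunE /= lexx.
- apply/forallP => u; apply/forallP => v; apply/forallP => x.
  rewrite !ffunE /=.
  by apply/implyP => uv; apply/implyP; apply: le_trans.
- by apply/'forall_'forall_eqP => x y; rewrite ffunE /= emb_mono.
- by apply/'forall_'forall_eqP => x y; rewrite ffunE /= emb_mono.
by apply/forallP; case.
Qed.

Definition pair_class : amalg_class0 P Q := AmalgClass pair_relP.
End PairClass.

Section Composition.
Variables (k : fieldType) (nu : measure k).
Notation w := (mu_poset nu).
Notation wr := (weight nu).

Lemma hom_compE (P Q R : fposet) (g : hom k Q R) (f : hom k P Q) c :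
  hom_comp nu g f c =
  \sum_(S : amalg_class0 Q R) \sum_(V : amalg_class0 P Q) g S * f V *
    \sum_(W : amalg_class (am_r (amalg_repr V)) (am_l (amalg_repr S)))
      mu_val nu (outer_emb (amalg_repr W))
       * (c == class_of_amalg (outer_amalg (amalg_repr W)))%:R.
Proof.
rewrite /hom_comp sum_ffunE; apply: eq_bigr => S _.
rewrite sum_ffunE; apply: eq_bigr => V _.
rewrite ffunE /comp_basis sum_ffunE; congr (_ * _).
by apply: eq_bigr => W _; rewrite !ffunE.
Qed.

(** Total in [rho], so that it can be summed over relations without carrying
    proofs that they are amalgamations. *)
Definition coef_at (P Q : fposet) (f : hom k P Q) (rho : brel (P + Q)%type) : k :=
  if (insub rho : option (amalg_class0 P Q)) is Some c then f c else 0.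

Lemma coef_atE (P Q : fposet) (f : hom k P Q) (c : amalg_class0 P Q) :
  coef_at f (amalg_rel c) = f c.
Proof. by rewrite /coef_at valK. Qed.

Section Formula.
Variables (P Q R U : fposet) (e0 : embedding P U) (e2 : embedding R U).
Variables (g : hom k Q R) (f : hom k P Q).

Notation T := ((P + Q) + (R + U))%type.
Let t0 (p : P) : T := inl (inl p).
Let t1 (q : Q) : T := inl (inr q).
Let t2 (r : R) : T := inr (inl r).
Let tU (u : U) : T := inr (inr u).

Let t02 (x : P + R) : T := match x with inl p => t0 p | inr r => t2 r end.
Let t12 (x : Q + R) : T := match x with inl q => t1 q | inr r => t2 r end.

Let rel01 (e : brel T) : brel (P + Q)%type :=
  [ffun xy => e (inl xy.1, inl xy.2)].
Let rel12 (e : brel T) : brel (Q + R)%type :=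
  [ffun xy => e (t12 xy.1, t12 xy.2)].
Let rel02 (e : brel T) : brel (P + R)%type :=
  [ffun xy => e (t02 xy.1, t02 xy.2)].

Let hU (x : T) : option U := match x with
  | inl (inl p) => Some (e0 p) | inl (inr _) => None
  | inr (inl r) => Some (e2 r) | inr (inr u) => Some u end.
Let hU0 (x : T) : option U := match x with
  | inl (inl p) => Some (e0 p) | inr (inl r) => Some (e2 r) | _ => None end.
Let h1 (x : T) : option Q := if x is inl (inr q) then Some q else None.

Let c0 : amalg_class0 P R := pair_class e0 e2.

Let hL (V : amalg_class0 P Q) (x : T) : option (amalg_repr V) :=
  if x is inl y then Some (am_map (amalg_repr V) y) else None.
Let hR (S : amalg_class0 Q R) (x : T) : option (amalg_repr S) := match x with
  | inl (inr q) => Some (am_l (amalg_repr S) q)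
  | inr (inl r) => Some (am_r (amalg_repr S) r) | _ => None end.

Let am_relE (A B : fposet) (c : amalg_class0 A B) x y :
  (am_map (amalg_repr c) x <= am_map (amalg_repr c) y)%O = amalg_rel c (x, y).
Proof. by have /(congr1 (fun d => amalg_rel d (x, y))) <- := amalg_reprK c; rewrite ffunE. Qed.

Let hL_rel V x y : pull (hL V) (inl x, inl y) = amalg_rel V (x, y).
Proof. by rewrite ffunE /= am_relE. Qed.

Let hR_rel S x y : pull (hR S) (t12 x, t12 y) = amalg_rel S (x, y).
Proof. by rewrite ffunE -am_relE; case: x; case: y. Qed.

Let hU0_rel x y : pull hU0 (t02 x, t02 y) = amalg_rel c0 (x, y).
Proof. by rewrite !ffunE /=; case: x; case: y. Qed.

Let glue_iff V S e :
  (glue (pull (hL V)) (pull (hR S)) e && (rel02 e == amalg_rel c0))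
  = [&& glue (pull hU0) (pull h1) e, rel01 e == amalg_rel V
      & rel12 e == amalg_rel S].
Proof.
apply/andP/and3P => [[/glueP [pe g1 g2 g3] /eqP e02]|].
  have e01 x y : e (inl x, inl y) = amalg_rel V (x, y).
    by rewrite g1 ?pull_refl // hL_rel.
  have e12 x y : e (t12 x, t12 y) = amalg_rel S (x, y).
    by rewrite g2 ?pull_refl ?hR_rel //; [case: x|case: y].
  split; [|by apply/eqP/ffunP => -[x y]; rewrite ffunE e01
          |by apply/eqP/ffunP => -[x y]; rewrite ffunE e12].
  apply/glueP; split=> // [u v|u v|u]; rewrite !pull_refl.
  - move=> hu hv.
    have key x y : e (t02 x, t02 y) = pull hU0 (t02 x, t02 y).
      by rewrite hU0_rel -e02 ffunE.
    case: u hu => [[p|q]|[r|z]] // _; case: v hv => [[p'|q']|[r'|z']] // _.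
    + exact: (key (inl p) (inl p')).
    + exact: (key (inl p) (inr r')).
    + exact: (key (inr r) (inl p')).
    + exact: (key (inr r) (inr r')).
  - case: u => [[p|q]|[r|z]] // _; case: v => [[p'|q']|[r'|z']] // _.
    by rewrite e01 amalg_rel_r ffunE.
  - by move=> /g3; rewrite !pull_refl; case: u => [[p|q]|[r|z]].
case=> /glueP [pe g1 g2 g3] /eqP e01 /eqP e12.
have e01' x y : e (inl x, inl y) = amalg_rel V (x, y) by rewrite -e01 ffunE.
have e12' x y : e (t12 x, t12 y) = amalg_rel S (x, y) by rewrite -e12 ffunE.
split; last first.
  apply/eqP/ffunP => -[x y]; rewrite ffunE -hU0_rel g1 // pull_refl.
    by case: x.
  by case: y.
apply/glueP; split=> // [u v|u v|u]; rewrite !pull_refl.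
- by case: u => // x _; case: v => // y _; rewrite hL_rel e01'.
- move=> hu hv.
  have key x y : e (t12 x, t12 y) = pull (hR S) (t12 x, t12 y).
    by rewrite hR_rel e12'.
  case: u hu => [[p|q]|[r|z]] // _; case: v hv => [[p'|q']|[r'|z']] // _.
  + exact: (key (inl q) (inl q')).
  + exact: (key (inl q) (inr r')).
  + exact: (key (inr r) (inl q')).
  + exact: (key (inr r) (inr r')).
- by move=> /g3; rewrite !pull_refl; case: u => [[p|q]|[r|z]].
Qed.

Let rel01P e : glue (pull hU0) (pull h1) e ->
  is_amalg_rel (emb0 P) (emb0 Q) (rel01 e).
Proof.
case/glueP=> pe g1 g2 g3; have /ppoP [tr rf] := pe.
have rr (x : P + Q) : e (inl x, inl x).
  by case: x => x; [rewrite g1|rewrite g2]; rewrite ?pull_refl.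
apply/and5P; split.
- by apply/forallP => u; rewrite ffunE /=.
- apply/forallP => u; apply/forallP => v; apply/forallP => x.
  by rewrite !ffunE /=; apply/implyP => uv; apply/implyP; apply: tr.
- apply/'forall_'forall_eqP => x y; rewrite ffunE /= g1 ?pull_refl //.
  by rewrite ffunE /= emb_mono.
- apply/'forall_'forall_eqP => x y; rewrite ffunE /= g2 ?pull_refl //.
  by rewrite ffunE.
by apply/forallP; case.
Qed.

Let rel12P e : glue (pull hU0) (pull h1) e ->
  is_amalg_rel (emb0 Q) (emb0 R) (rel12 e).
Proof.
case/glueP=> pe g1 g2 g3; have /ppoP [tr rf] := pe.
have rr (x : Q + R) : e (t12 x, t12 x).
  by case: x => x; [rewrite g2|rewrite g1]; rewrite ?pull_refl.
apply/and5P; split.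
- by apply/forallP => u; rewrite ffunE /=.
- apply/forallP => u; apply/forallP => v; apply/forallP => x.
  by rewrite !ffunE /=; apply/implyP => uv; apply/implyP; apply: tr.
- apply/'forall_'forall_eqP => x y; rewrite ffunE /= g2 ?pull_refl //.
  by rewrite ffunE.
- apply/'forall_'forall_eqP => x y; rewrite ffunE /= g1 ?pull_refl //.
  by rewrite ffunE /= emb_mono.
by apply/forallP; case.
Qed.

Let h1_onto : onto h1. Proof. by move=> q; exists (t1 q). Qed.
Let hL_onto V : onto (hL V).
Proof. by move=> z; have [u <-] := am_map_surj z; exists (inl u). Qed.
Let hR_onto S : onto (hR S).
Proof. by move=> z; have [[q|r] <-] := am_map_surj z; [exists (t1 q)|exists (t2 r)]. Qed.
Let hLR_c V S x q : h1 x = Some q ->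
  hL V x = Some (am_r (amalg_repr V) q) /\ hR S x = Some (am_l (amalg_repr S) q).
Proof. by case: x => [[p|q']|[r|z]] //= [->]. Qed.
Let hLR_i V S x : hL V x -> hR S x -> h1 x.
Proof. by case: x => [[p|q']|[r|z]]. Qed.

Let phi (e : brel T) : k := coef_at f (rel01 e) * coef_at g (rel12 e).

Let stepW V S :
  wr (pull hU0) * (\sum_(W : amalg_class (am_r (amalg_repr V)) (am_l (amalg_repr S)))
      mu_val nu (outer_emb (amalg_repr W))
       * (c0 == class_of_amalg (outer_amalg (amalg_repr W)))%:R)
  = \sum_(e | glue (pull (hL V)) (pull (hR S)) e) (rel02 e == amalg_rel c0)%:R * wr e.
Proof.
rewrite -(sum_amalg_glue h1_onto (@hL_onto V) (@hR_onto S) (@hLR_c V S) (@hLR_i V S)).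
rewrite mulr_sumr; apply: eq_bigr => W _.
set A := amalg_repr W.
have onA : onto (amalg_lab (hL V) (hR S) A).
  exact: (amalg_lab_onto (@hL_onto V) (@hR_onto S) (@hLR_c V S) (@hLR_i V S)).
rewrite (wr_pull nu onA).
have AM x : amalg_lab (hL V) (hR S) A (t02 x) = Some (val (am_map (outer_amalg A) x)).
  case: x => x /=; rewrite emb_coresE mk_embeddingE //=.
have r02 : rel02 (pull (amalg_lab (hL V) (hR S) A)) = am_rel (outer_amalg A).
  by apply/ffunP => -[x y]; rewrite [LHS]ffunE (pullE (AM x) (AM y)) ffunE.
have -> : (c0 == class_of_amalg (outer_amalg A))
          = (rel02 (pull (amalg_lab (hL V) (hR S) A)) == amalg_rel c0).
  by rewrite r02 eq_sym.
case: eqP => [e02|_]; last by rewrite !mulr0 mul0r.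
rewrite mulr1 mul1r (w_emb nu (outer_emb A)) mulrC; congr (_ * _).
pose ho (x : T) : option (outer_amalg A) := match x with
  | inl (inl p) => Some (am_map (outer_amalg A) (inl p))
  | inr (inl r) => Some (am_map (outer_amalg A) (inr r)) | _ => None end.
have oo : onto ho.
  by move=> z; have [[p|r] <-] := am_map_surj z; [exists (t0 p)|exists (t2 r)].
rewrite -(wr_pull nu oo); congr wr.
apply/ffunP => -[x y].
have key a b : pull ho (t02 a, t02 b) = pull hU0 (t02 a, t02 b).
  rewrite hU0_rel -e02 r02 !ffunE; case: a => a; case: b => b //=.
case: x => [[p|q]|[r|z]]; case: y => [[p'|q']|[r'|z']]; try by rewrite !ffunE.
+ by rewrite -(key (inl p) (inl p')).
+ by rewrite -(key (inl p) (inr r')).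
+ by rewrite -(key (inr r) (inl p')).
+ by rewrite -(key (inr r) (inr r')).
Qed.

Let stepA : wr (pull hU0) * hom_comp nu g f c0
  = \sum_(e | glue (pull hU0) (pull h1) e) phi e * wr e.
Proof.
rewrite hom_compE mulr_sumr.
transitivity (\sum_(S : amalg_class0 Q R) \sum_(V : amalg_class0 P Q) \sum_e
   (glue (pull hU0) (pull h1) e && ((rel01 e == amalg_rel V)
      && (rel12 e == amalg_rel S)))%:R * (g S * f V * wr e)).
  apply: eq_bigr => S _; rewrite mulr_sumr; apply: eq_bigr => V _.
  rewrite mulrCA stepW mulr_sumr big_mkcond /=; apply: eq_bigr => e _.
  rewrite -glue_iff; case: (glue _ _ e); rewrite /= ?mul0r //.
  by rewrite mulrCA !mulrA.
rewrite exchange_big /=; under eq_bigr do rewrite exchange_big /=.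
rewrite exchange_big /= [RHS]big_mkcond /=; apply: eq_bigr => e _.
case: ifP => ge; last by rewrite big1 // => V _; rewrite big1 // => S _; rewrite mul0r.
pose V0 := AmalgClass (rel01P ge); pose S0 := AmalgClass (rel12P ge).
rewrite (bigD1 V0) //= (bigD1 S0) //= !eqxx mul1r.
rewrite [X in _ + X + _]big1 ?addr0 => [|S nS]; last first.
  case: eqP => [E|]; last by rewrite mul0r.
  by case/eqP: nS; apply: val_inj.
rewrite big1 ?addr0 => [|V nV]; last first.
  rewrite big1 // => S _; case: eqP => [E|]; last by rewrite mul0r.
  by case/eqP: nV; apply: val_inj.
by rewrite /phi -[rel01 e]/(amalg_rel V0) -[rel12 e]/(amalg_rel S0) !coef_atE (mulrC (g _)).
Qed.

Let stepB : w U * hom_comp nu g f c0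
  = \sum_(e | glue (pull hU) (pull h1) e) phi e * wr e.
Proof.
have oU : onto hU by move=> u; exists (tU u).
rewrite -(wr_pull nu oU).
have U0U x : hU0 x -> hU x = hU0 x by case: x => [[p|q]|[r|z]].
have U0r u v : pull hU0 (u, u) -> pull hU0 (v, v) -> pull hU (u, v) = pull hU0 (u, v).
  by rewrite !pull_refl => hu hv; rewrite !ffunE /= !U0U.
have [w0|w0] := eqVneq (wr (pull hU0)) 0.
  have wU : wr (pull hU) = 0.
    apply: (wr_sub (g := id) (ppo_pull hU0) _ w0) => u v uu vv; exact: U0r.
  rewrite wU mul0r big1 // => e /glueP [_ g1 _ _].
  rewrite (_ : wr e = 0) ?mulr0 //.
  by apply: (wr_sub (g := id) (ppo_pull hU) _ wU) => u v uu vv; apply: g1.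
apply: (mulfI w0); rewrite mulrCA stepA mulr_sumr.
pose no_U (x : T) := if x is inr (inr _) then false else true.
pose res (e : brel T) : brel T := [ffun uv => [&& no_U uv.1, no_U uv.2 & e uv]].
rewrite [X in _ = _ * X](partition_big res (glue (pull hU0) (pull h1))); last first.
  move=> e /glueP [pe g1 g2 g3]; have /ppoP [tr rf] := pe.
  apply/glueP; split.
  - apply/ppoP; split=> [v u x|u v]; rewrite !ffunE /=.
      by case/and3P=> -> _ a /and3P [_ -> b]; rewrite (tr v).
    by case/and3P=> -> -> /rf [-> ->].
  - move=> u v hu hv; rewrite -U0r // ffunE /= g1; last 2 first.
    + by move: hu; rewrite !pull_refl => hu; rewrite U0U.
    + by move: hv; rewrite !pull_refl => hv; rewrite U0U.
    by move: hu hv; rewrite !pull_refl; case: u => [[?|?]|[?|?]]; case: v => [[?|?]|[?|?]].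
  - move=> u v hu hv; rewrite ffunE /= g2 //.
    by move: hu hv; rewrite !pull_refl; case: u => [[?|?]|[?|?]]; case: v => [[?|?]|[?|?]].
  - move=> u; rewrite ffunE /= => /and3P [nu' _ /g3].
    by rewrite !pull_refl; case: u nu' => [[?|?]|[?|?]].
rewrite mulr_sumr; apply: eq_bigr => e' ge'; have /glueP [pe' g1 g2 g3] := ge'.
have de' x : e' (x, x) = no_U x.
  case: x => [[x|x]|[x|x]]; rewrite /=.
  - by rewrite g1 ?pull_refl.
  - by rewrite g2 ?pull_refl.
  - by rewrite g1 ?pull_refl.
  - by apply/negP => /g3; rewrite !pull_refl.
have agree u v : pull hU (u, u) -> pull hU (v, v) -> e' (u, u) -> e' (v, v) ->
    pull hU (u, v) = e' (u, v).
  rewrite !de' => hu hv nu' nv.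
  have [hu0 hv0] : pull hU0 (u, u) /\ pull hU0 (v, v).
    move: hu hv; rewrite !pull_refl.
    by case: u nu' => [[?|?]|[?|?]]; case: v nv => [[?|?]|[?|?]].
  by rewrite U0r // g1.
have mt : meet (pull hU) e' = pull hU0.
  apply/ffunP => -[u v]; rewrite ffunE.
  case hu: (pull hU0 (u, u)); last first.
    have -> : pull hU0 (u, v) = false.
      by apply/negP => uv; have /ppoP [_ rf] := ppo_pull hU0; move: (rf _ _ uv); rewrite hu => -[].
    apply/negP => /andP [uv euv].
    have /ppoP [_ rf] := ppo_pull hU; have [uu _] := rf _ _ uv.
    have /ppoP [_ rf'] := pe'; have [uu' _] := rf' _ _ euv.
    by move: uu uu' hu; rewrite de' !pull_refl; case: u uv euv => [[?|?]|[?|?]].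
  case hv: (pull hU0 (v, v)); last first.
    have -> : pull hU0 (u, v) = false.
      by apply/negP => uv; have /ppoP [_ rf] := ppo_pull hU0; move: (rf _ _ uv); rewrite hv => -[].
    apply/negP => /andP [uv euv].
    have /ppoP [_ rf] := ppo_pull hU; have [_ vv] := rf _ _ uv.
    have /ppoP [_ rf'] := pe'; have [_ vv'] := rf' _ _ euv.
    by move: vv vv' hv; rewrite de' !pull_refl; case: v uv euv => [[?|?]|[?|?]].
  by rewrite g1 // U0r // andbb.
have -> : \sum_(e | glue (pull hU) (pull h1) e && (res e == e')) phi e * wr e
   = phi e' * \sum_(e | glue (pull hU) e' e) wr e.
  rewrite mulr_sumr; apply: eq_big => e; last first.
    case/andP=> _ /eqP re; congr (_ * _).
    have rE u v : no_U u -> no_U v -> e (u, v) = e' (u, v).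
      by move=> hu hv; rewrite -re ffunE /= hu hv.
    rewrite /phi; congr (coef_at f _ * coef_at g _); apply/ffunP => -[x y]; rewrite !ffunE /=.
      by rewrite rE.
    by rewrite rE //; [case: x | case: y].
  apply/andP/idP => [[/glueP [pe k1 k2 k3] /eqP re]|/glueP [pe k1 k2 k3]].
    apply/glueP; split => //.
      by move=> u v; rewrite !de' -re ffunE /= => -> ->.
    by move=> u /k3; rewrite !pull_refl de'; case: u => [[?|?]|[?|?]].
  have rE u v : no_U u -> no_U v -> e (u, v) = e' (u, v).
    by rewrite -!de' => hu hv; rewrite k2.
  split.
    apply/glueP; split => //.
      move=> u v hu hv; rewrite rE ?g2 //.
        by move: hu; rewrite pull_refl; case: u => [[?|?]|[?|?]].
      by move: hv; rewrite pull_refl; case: v => [[?|?]|[?|?]].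
    by move=> u _; rewrite !pull_refl; case: u => [[?|?]|[?|?]].
  apply/eqP/ffunP => -[u v]; rewrite ffunE /=.
  case hu: (no_U u); last first.
    apply/esym/negP => uv; have /ppoP [_ rf'] := pe'.
    by have [] := rf' _ _ uv; rewrite !de' hu.
  case hv: (no_U v); last first.
    apply/esym/negP => uv; have /ppoP [_ rf'] := pe'.
    by have [] := rf' _ _ uv; rewrite !de' hv.
  exact: rE.
have := wr_glue nu (ppo_pull hU) pe' agree; rewrite mt => E.
by rewrite mulrCA E mulrCA.
Qed.

(** Composition is integration over the position of the middle object: after
    multiplication by the weight of [U], the coefficient of a composite at a pair
    of embeddings into [U] is a sum over all amalgamations of [U] with the middle
    object.  The definition of composition is the case where [P] and [R] cover
    [U] (stepA); axiom (c) extends it to all [U] (stepB), which makes the formula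
    iterable.  All relations live on the disjoint union of [P], [Q], [R], [U]. *)
Lemma comp_formula :
  w U * hom_comp nu g f (pair_class e0 e2)
  = \sum_(c : amalg_class0 U Q) let Z := amalg_repr c in
      f (pair_class (emb_comp (am_l Z) e0) (am_r Z))
      * g (pair_class (am_r Z) (emb_comp (am_l Z) e2)) * w Z.
Proof.
have oU : onto hU by move=> u; exists (tU u).
have o0 : onto (fun _ : T => None : option empty_poset) by case.
rewrite stepB -(sum_amalg_glue (alpha := emb0 U) (beta := emb0 Q) o0 oU h1_onto) //;
  last by case=> [[?|?]|[?|?]].
apply: eq_bigr => c _ /=; set Z := amalg_repr c.
have hc (x : T) (p : empty_poset) : None = Some p ->
    hU x = Some (emb0 U p) /\ h1 x = Some (emb0 Q p) by [].
have hi (x : T) : hU x -> h1 x -> (None : option empty_poset) by case: x => [[?|?]|[?|?]].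
have onZ : onto (amalg_lab hU h1 Z) by exact: (amalg_lab_onto oU h1_onto hc hi).
rewrite (wr_pull nu onZ).
congr (_ * _); rewrite /phi -!coef_atE; congr (coef_at f _ * coef_at g _).
  by apply/ffunP => -[x y]; rewrite !ffunE /=; case: x => x; case: y => y /=;
    rewrite ?emb_compE.
by apply/ffunP => -[x y]; rewrite !ffunE /=; case: x => x; case: y => y /=;
    rewrite ?emb_compE.
Qed.

End Formula.
End Composition.

(** * Configurations of summands *)

Section Configurations.
Variables (k : fieldType) (nu : measure k) (X : perm_obj).
Notation w := (mu_poset nu).
Notation wr := (weight nu).
Notation I := ('I_(num_summands X)).

Definition point : finType := {i : I & (summand i : finType)}.
Definition mkpoint (i : I) (p : summand i) : point :=
  existT (fun i : I => (summand i : finType) : Type) i p.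

Definition le_point (u v : point) : bool :=
  (tag u == tag v) && (tagged u <= tagged_as u v :> summand (tag u))%O.

Lemma le_pointE (i : I) (p q : summand i) : le_point (mkpoint p) (mkpoint q) = (p <= q)%O.
Proof. by rewrite /le_point /= eqxx tagged_asE. Qed.

Variable J : finType.
Notation T := (J * point)%type.
(** A configuration places at some positions [s : J] a summand (first component)
    and records how the points of these summands compare or coincide (second
    component).  The summand is recorded separately because it may be the empty
    poset, which leaves no trace in the relation. *)
Definition config : finType := ({ffun J -> option I} * brel T)%type.
Implicit Types (om ka : config) (K : {set J}) (s : J).

Definition conf om : bool :=
  [&& ppo om.2, [forall x, om.2 (x, x) == (om.1 x.1 == Some (tag x.2))]
    & [forall s, forall u, forall v, (om.1 s == Some (tag u)) ==>
         (om.1 s == Some (tag v)) ==> (om.2 ((s, u), (s, v)) == le_point u v)]].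

Lemma confP om :
  reflect [/\ ppo om.2, forall x, om.2 (x, x) = (om.1 x.1 == Some (tag x.2))
    & forall s u v, om.1 s = Some (tag u) -> om.1 s = Some (tag v) ->
        om.2 ((s, u), (s, v)) = le_point u v] (conf om).
Proof.
apply: (iffP and3P) => -[h1 h2 h3]; split=> //.
- by move=> x; apply/eqP; move/forallP: h2.
- move=> s u v su sv; move/forallP/(_ s)/forallP/(_ u)/forallP/(_ v): h3.
  by rewrite su eqxx -su sv eqxx => /eqP.
- by apply/forallP => x; rewrite h2.
- apply/forallP => s; apply/forallP => u; apply/forallP => v.
  by apply/implyP => /eqP su; apply/implyP => /eqP sv; rewrite h3.
Qed.

Definition supp om : {set J} := [set s | om.1 s != None].

Definition ext ka om : bool :=
  [forall s, (ka.1 s != None) ==> (om.1 s == ka.1 s)]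
  && [forall x, forall y, ka.2 (x, x) ==> ka.2 (y, y) ==> (om.2 (x, y) == ka.2 (x, y))].

Lemma extP ka om :
  reflect ((forall s, s \in supp ka -> om.1 s = ka.1 s) /\
     (forall x y, ka.2 (x, x) -> ka.2 (y, y) -> om.2 (x, y) = ka.2 (x, y)))
  (ext ka om).
Proof.
apply: (iffP andP) => -[h1 h2]; split.
- by move=> s; rewrite inE => sk; move/forallP/(_ s): h1; rewrite sk => /eqP.
- by move=> x y xx yy; move/forallP/(_ x)/forallP/(_ y): h2; rewrite xx yy => /eqP.
- by apply/forallP => s; apply/implyP => sk; rewrite h1 // inE.
- apply/forallP => x; apply/forallP => y; apply/implyP => xx; apply/implyP => yy.
  by rewrite h2.
Qed.

(** Forgets the positions outside [K]. *)
Definition restr K om : config :=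
  ([ffun s => if s \in K then om.1 s else None],
   [ffun xy => [&& xy.1.1 \in K, xy.2.1 \in K & om.2 xy]]).

Lemma conf_restr K om : conf om -> conf (restr K om).
Proof.
case/confP=> /ppoP [tr rf] dm fb; apply/confP; split => /=.
- apply/ppoP; split=> [v u x|u v]; rewrite !ffunE /=.
    by case/and3P=> -> _ a /and3P [_ -> b]; apply: tr a b.
  by case/and3P=> -> -> /rf [-> ->].
- by move=> x; rewrite !ffunE /= dm; case: ifP.
- by move=> s u v; rewrite !ffunE /=; case: ifP => // _ su sv; rewrite fb.
Qed.

Lemma supp_restr K om : supp (restr K om) = K :&: supp om.
Proof. by apply/setP => s; rewrite !inE ffunE; case: ifP. Qed.

Lemma ext_restr K om : ext (restr K om) om.
Proof.
apply/extP; split=> [s|x y]; first by rewrite inE ffunE; case: ifP.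
by rewrite !ffunE /= => /andP [-> _] /andP [-> _].
Qed.

Lemma restr_ext ka om : conf ka -> conf om -> ext ka om -> restr (supp ka) om = ka.
Proof.
move=> /confP [/ppoP [_ rk] dk _] /confP [/ppoP [_ rf] dm _] /extP [e1 e2].
case: ka e1 e2 rk dk => [q e] /= e1 e2 rk dk; congr (_, _).
  apply/ffunP => s; rewrite ffunE; case: ifP => [/e1 //|].
  by rewrite inE /=; case: (q s).
apply/ffunP => -[x y]; rewrite ffunE /=.
have kk z : om.2 (z, z) -> z.1 \in supp (q, e) -> e (z, z).
  by rewrite dm dk => h hz; rewrite -e1.
apply/and3P/idP => [[hx hy om_xy]|exy].
  by have [ox oy] := rf _ _ om_xy; rewrite -e2 ?kk.
have [ex ey] := rk _ _ exy.
rewrite e2 //; split => //; rewrite inE /=.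
  by move: ex; rewrite dk => /eqP ->.
by move: ey; rewrite dk => /eqP ->.
Qed.

Definition confon K om : bool := conf om && (supp om == K).

(** Extending a configuration in two stages or in one stage is the same, because
    the intermediate configuration is a restriction of the final one. *)
Lemma sum_nested (R : nmodType) K1 K2 K3 ka (F : config -> R) :
  K1 \subset K2 -> K2 \subset K3 -> confon K1 ka ->
  \sum_(om | confon K2 om && ext ka om) \sum_(om' | confon K3 om' && ext om om') F om'
  = \sum_(om' | confon K3 om' && ext ka om') F om'.
Proof.
move=> s12 s23 /andP [ck /eqP sk].
rewrite [RHS](partition_big (restr K2) (fun om => confon K2 om && ext ka om)) /=.
  apply: eq_bigr => om /andP [/andP [co /eqP so] /extP [eo1 eo2]].
  apply: eq_bigl => om'; apply/andP/andP => [[/andP [co' so'] e']|].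
    have /extP [e1 e2] := e'.
    split; last by rewrite -so restr_ext.
    rewrite /confon co' so' /=; apply/extP; split=> [s hs|x y hx hy].
      by rewrite e1 ?eo1 // so (subsetP s12) // -sk.
    by rewrite e2 eo2.
  case=> /andP [/andP [co' so'] _] /eqP <-.
  by rewrite /confon co' so' ext_restr.
move=> om' /andP [/andP [co' /eqP so'] /extP [e1 e2]].
rewrite /confon conf_restr //= supp_restr so' (setIidPl s23) eqxx /=.
apply/extP; split=> [s hs|x y hx hy].
  by rewrite ffunE (subsetP s12) ?e1 // -sk.
have /confP [_ dk _] := ck.
have hK z : ka.2 (z, z) -> z.1 \in K2.
  by rewrite dk => h; apply: (subsetP s12); rewrite -sk inE (eqP h).
by rewrite ffunE /= !hK //= e2.
Qed.

Definition place2 s s' (i j : I) (x : summand i + summand j) : T :=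
  match x with inl p => (s, mkpoint p) | inr p => (s', mkpoint p) end.

Definition rel2 (e : brel T) s s' i j : brel (summand i + summand j)%type :=
  [ffun xy => e (@place2 s s' i j xy.1, @place2 s s' i j xy.2)].

(** The coefficient that a matrix of morphisms attaches to the summands at the
    positions [s] and [s'] of a configuration. *)
Definition coef (f : perm_hom k X X) om s s' : k :=
  if om.1 s is Some i then
    if om.1 s' is Some j then coef_at (f j i) (rel2 om.2 s s' i j) else 0
  else 0.

Lemma coef_ext f ka om s s' : conf ka -> ext ka om ->
  s \in supp ka -> s' \in supp ka -> coef f om s s' = coef f ka s s'.
Proof.
move=> /confP [_ dk _] /extP [e1 e2] hs hs'; rewrite /coef !e1 //.
case ks: (ka.1 s) => [i|] //; case ks': (ka.1 s') => [j|] //.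
congr (coef_at _ _); apply/ffunP => -[x y]; rewrite !ffunE /= e2 // dk.
  by case: x => p; rewrite ?ks ?ks'.
by case: y => p; rewrite ?ks ?ks'.
Qed.

Section OnePosition.
Variables (s1 : J) (l : I).

Definition stdlab (x : T) : option (summand l) :=
  if x.1 == s1 then [pick p : summand l | x.2 == mkpoint p] else None.

Lemma mkpoint_inj (i : I) : injective (@mkpoint i).
Proof. by move=> p q /eqP; rewrite -tag_eqE /tag_eq eqxx /= tagged_asE => /eqP. Qed.

Lemma stdlabE (p : summand l) : stdlab (s1, mkpoint p) = Some p.
Proof.
rewrite /stdlab eqxx; case: pickP => [q /eqP /mkpoint_inj -> //|/(_ p)].
by rewrite eqxx.
Qed.

Lemma stdlabP x : stdlab x = (x.1 == s1) && (tag x.2 == l) :> bool.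
Proof.
case: x => s [i p] /=; case: eqP => [->|/eqP /negbTE ns] /=; last by rewrite /stdlab ns.
case: eqP => [il|nl]; last first.
  rewrite /stdlab eqxx /=; case: pickP => // q /eqP /(congr1 tag) /= il.
  by case: nl.
by subst i; rewrite (stdlabE p).
Qed.

Lemma onto_stdlab : onto stdlab.
Proof. by move=> p; exists (s1, mkpoint p); rewrite stdlabE. Qed.

Lemma pull_stdlab u v : tag u = l -> tag v = l ->
  pull stdlab ((s1, u), (s1, v)) = le_point u v.
Proof.
case: u => i p /= il; subst i; case: v => i q /= il; subst i.
by rewrite (pullE (stdlabE p) (stdlabE q)) (le_pointE p q).
Qed.

Definition upd (q : {ffun J -> option I}) : {ffun J -> option I} :=
  [ffun s => if s == s1 then Some l else q s].

(** Adding the summand [l] at the free position [s1] amounts to gluing the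
    standard copy of [l] at that position. *)
Lemma conf_upd ka e : conf ka -> s1 \notin supp ka ->
  conf (upd ka.1, e) && ext ka (upd ka.1, e) = glue ka.2 (pull stdlab) e.
Proof.
move=> /confP [pk dk fk]; rewrite inE negbK => /eqP ks1.
apply/andP/glueP => [[/confP [/= pe de fe] /extP [/= _ e2]]|[pe g1 g2 g3]].
  split=> //.
  - move=> [s u] [s' v]; rewrite !pull_refl !stdlabP /=.
    case/andP=> /eqP -> /eqP ul /andP [/eqP -> /eqP vl].
    by rewrite pull_stdlab // fe // ffunE eqxx ?ul ?vl.
  - move=> x; rewrite de dk pull_refl stdlabP ffunE; case: ifP => [_|_ ->] //.
    by case/eqP=> <-; rewrite eqxx orbT.
split; last first.
  apply/extP; split=> //= s; rewrite inE ffunE; case: (s =P s1) => // ->.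
  by rewrite ks1.
apply/confP; split => //= [x|s u v].
  rewrite ffunE; case: (x.1 =P s1) => [x1|/eqP nx].
    case sx: (stdlab x : bool).
      rewrite g2 ?pull_refl // sx; move: sx; rewrite stdlabP => /andP [_ /eqP ->].
      by rewrite eqxx.
    have := sx; rewrite stdlabP x1 eqxx /= eq_sym => nl.
    rewrite (_ : (Some l == Some (tag x.2)) = false); last exact: nl.
    by apply/negP => /g3; rewrite dk x1 ks1 pull_refl sx.
  case kx: (ka.2 (x, x)); first by rewrite g1 // kx -dk kx.
  rewrite -dk kx; apply/negP => /g3; rewrite kx pull_refl stdlabP.
  by rewrite (negbTE nx).
rewrite ffunE; case: (s =P s1) => [-> [ul] [vl]|ns su sv].
  rewrite g2 ?pull_refl ?stdlabP /= -?ul -?vl ?eqxx //.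
  by rewrite pull_stdlab -?ul -?vl.
by rewrite g1; [apply: fk | rewrite dk /= su | rewrite dk /= sv].
Qed.

Lemma supp_upd ka e : supp (upd ka.1, e) = s1 |: supp ka.
Proof. by apply/setP => s; rewrite !inE /= ffunE; case: (s =P s1). Qed.

End OnePosition.

Section CompositionFormula.
Variables (f g : perm_hom k X X) (K : {set J}) (ka : config) (s0 s1 s2 : J).
Hypotheses (cK : confon K ka) (s0K : s0 \in K) (s2K : s2 \in K) (s1K : s1 \notin K).

(** The positions [s0] and [s2] may coincide; that case computes traces. *)
Lemma coef_comp :
  wr ka.2 * coef (perm_comp nu g f) ka s0 s2
  = \sum_(om | confon (s1 |: K) om && ext ka om)
      coef f om s0 s1 * coef g om s1 s2 * wr om.2.
Proof.
have /andP [ck /eqP sk] := cK; have /confP [pk dk fk] := ck.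
have [i0 k0] : exists i, ka.1 s0 = Some i.
  by move: s0K; rewrite -sk inE; case: (ka.1 s0) => // i; exists i.
have [i2 k2] : exists i, ka.1 s2 = Some i.
  by move: s2K; rewrite -sk inE; case: (ka.1 s2) => // i; exists i.
have k1 : ka.1 s1 = None by move: s1K; rewrite -sk inE negbK => /eqP.
have emb s i : ka.1 s = Some i -> exists al : embedding (summand i) (quot ka.2),
    forall p, lab ka.2 (s, mkpoint p) = Some (al p).
  move=> ksi.
  have [||al alP] := @factor_emb (summand i : finType) _ (summand i) (quot ka.2)
    Some (@lab _ ka.2) (fun p => (s, mkpoint p)).
  - by move=> p; exists p.
  - move=> p q _ _; rewrite pull_lab // fk // le_pointE.
    by rewrite (pullE (a := p) (b := q)).
  by exists al => p; apply: alP.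
have [e0 e0P] := emb _ _ k0; have [e2 e2P] := emb _ _ k2.
have onl := onto_lab (e := ka.2).
pose Z (l : I) c := amalg_repr (c : amalg_class0 (quot ka.2) (summand l)).
transitivity (\sum_l \sum_(c : amalg_class0 (quot ka.2) (summand l))
   f l i0 (pair_class (emb_comp (am_l (Z l c)) e0) (am_r (Z l c)))
   * g i2 l (pair_class (am_r (Z l c)) (emb_comp (am_l (Z l c)) e2)) * w (Z l c)).
  rewrite /coef k0 k2.
  have -> : rel2 ka.2 s0 s2 i0 i2 = amalg_rel (pair_class e0 e2).
    apply/ffunP => -[x y]; rewrite !ffunE /=.
    have key z : lab ka.2 (place2 s0 s2 z) = Some (pair_map e0 e2 z) by case: z.
    by have := pullE (key x) (key y); rewrite pull_lab.
  rewrite coef_atE /perm_comp sum_ffunE mulr_sumr; apply: eq_bigr => l _.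
  by rewrite /weight pk comp_formula.
transitivity (\sum_l \sum_(e | glue ka.2 (pull (stdlab s1 l)) e)
   let om := (upd s1 l ka.1, e) in coef f om s0 s1 * coef g om s1 s2 * wr e).
  apply: eq_bigr => l _.
  have o0 : onto (fun _ : T => None : option empty_poset) by case.
  have ol := @onto_stdlab s1 l.
  have hc (x : T) (p : empty_poset) : (None : option empty_poset) = Some p ->
    lab ka.2 x = Some (emb0 (quot ka.2) p) /\ stdlab s1 l x = Some (emb0 (summand l) p).
    by [].
  have hi (x : T) : lab ka.2 x -> stdlab s1 l x -> (None : option empty_poset).
    by rewrite stdlabP -pull_refl pull_lab // dk => /eqP h /andP [/eqP h' _];
      rewrite h' k1 in h.
  rewrite -[ka.2 in RHS](pull_lab pk) -(sum_amalg_glue o0 onl ol hc hi).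
  apply: eq_bigr => c _; rewrite -/(Z l c) /=.
  have onZ : onto (amalg_lab (lab ka.2) (stdlab s1 l) (Z l c)) by exact: (amalg_lab_onto onl ol hc hi).
  rewrite (wr_pull nu onZ); congr (_ * _).
  have gl0 p : amalg_lab (lab ka.2) (stdlab s1 l) (Z l c) (s0, mkpoint p)
             = Some (emb_comp (am_l (Z l c)) e0 p).
    by rewrite (amalg_lab_l _ _ (e0P p)) emb_compE.
  have gl2 p : amalg_lab (lab ka.2) (stdlab s1 l) (Z l c) (s2, mkpoint p)
             = Some (emb_comp (am_l (Z l c)) e2 p).
    by rewrite (amalg_lab_l _ _ (e2P p)) emb_compE.
  have gl1 p : amalg_lab (lab ka.2) (stdlab s1 l) (Z l c) (s1, mkpoint p)
             = Some (am_r (Z l c) p).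
    exact: (amalg_lab_r hc hi _ (stdlabE s1 p)).
  have n0 : (s0 == s1) = false by apply: contraNF s1K => /eqP <-.
  have n2 : (s2 == s1) = false by apply: contraNF s1K => /eqP <-.
  rewrite /coef /= !ffunE eqxx n0 n2 k0 k2 -!coef_atE; congr (coef_at (f l i0) _ * coef_at (g i2 l) _).
    apply/ffunP => -[x y]; rewrite !ffunE /=.
    have key z : amalg_lab (lab ka.2) (stdlab s1 l) (Z l c) (place2 s0 s1 z)
        = Some (pair_map (emb_comp (am_l (Z l c)) e0) (am_r (Z l c)) z).
      by case: z => p /=.
    by rewrite !key.
  apply/ffunP => -[x y]; rewrite !ffunE /=.
  have key z : amalg_lab (lab ka.2) (stdlab s1 l) (Z l c) (place2 s1 s2 z)
      = Some (pair_map (am_r (Z l c)) (emb_comp (am_l (Z l c)) e2) z).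
    by case: z => p /=.
  by rewrite !key.
rewrite (pair_big_dep xpredT) /=.
rewrite (reindex_onto (fun le : I * brel T => (upd s1 le.1 ka.1, le.2))
   (fun om : config => (odflt i0 (om.1 s1), om.2))) /=; last first.
  move=> [q e] /andP [/andP [co /eqP so] /extP [/= e1 _]]; congr (_, _).
  apply/ffunP => s; rewrite ffunE.
  have qN x : (q x != None) = (x \in s1 |: K) by rewrite -so inE.
  case: eqP => [->|/eqP ns].
    by have := qN s1; rewrite !inE eqxx; case: (q s1).
  have [sK|sK] := boolP (s \in K); first by rewrite e1 ?sk.
  have := qN s; rewrite !inE (negbTE ns) (negbTE sK).
  by move: sK; rewrite -sk inE negbK => /eqP ->; case: (q s).
apply: eq_bigl => -[l e] /=.
rewrite ffunE eqxx /= eqxx andbT /confon supp_upd sk eqxx andbT.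
by rewrite conf_upd // sk.
Qed.

End CompositionFormula.

End Configurations.

(** * The trace of a power *)

Section TracePower.
Variables (k : fieldType) (nu : measure k) (X : perm_obj).
Notation w := (mu_poset nu).
Notation wr := (weight nu).
Notation I := ('I_(num_summands X)).
Variable f : perm_hom k X X.
Variable N : nat.
Notation J := 'I_N.+2.
Notation T := (J * point X)%type.
Implicit Types (om ka : config X J) (K : {set J}).
Let pos (n : nat) : J := inord n.

(** The positions strictly between the first position and position [m.+1]. *)
Definition inner m : {set J} := [set s : J | 0 < s <= m]%N.

(** The power [f ^ m.+1] is obtained by summing over all ways to fill the
    intermediate positions.  The statement allows further occupied positions in
    [K] so that the induction can first add the last intermediate position and
    then all the others. *)
Lemma coef_exp m K ka : (m <= N)%N -> confon K ka -> pos 0 \in K ->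
  pos m.+1 \in K -> [disjoint K & inner m] ->
  wr ka.2 * coef (perm_exp nu f m) ka (pos 0) (pos m.+1)
  = \sum_(om | confon (K :|: inner m) om && ext ka om)
      (\prod_(i < m.+1) coef f om (pos i) (pos i.+1)) * wr om.2.
Proof.
elim: m K ka => [|m IHm] K ka mN cK K0 Km dK.
  have -> : inner 0 = set0.
    by apply/setP => s; rewrite !inE; case: (nat_of_ord s).
  rewrite setU0 (big_pred1 ka) => [|om].
    by rewrite big_ord1 mulrC.
  have /andP [ck /eqP sk] := cK.
  apply/andP/eqP => [[/andP [co /eqP so] e]|->].
    rewrite -[ka](restr_ext ck co e) sk -so restr_ext //.
    by apply/extP; split.
  by split=> //; apply/extP; split.
have pm : val (pos m.+1) = m.+1.
  by rewrite /pos /= inordK //; exact: leqW.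
have s1K : pos m.+1 \notin K.
  apply/negP => h; move/pred0P/(_ (pos m.+1)): dK.
  by rewrite /= h inE pm ltnS leqnn.
have sub : inner m.+1 = pos m.+1 |: inner m.
  apply/setP => s; rewrite !inE -val_eqE /= -/(pos m.+1) pm [(s <= m.+1)%N]leq_eqVlt ltnS.
  by case: (val s =P m.+1) => [->|].
rewrite [LHS](coef_comp nu _ f cK K0 Km s1K).
transitivity (\sum_(om | confon (pos m.+1 |: K) om && ext ka om)
  \sum_(om' | confon (K :|: inner m.+1) om' && ext om om')
    (\prod_(i < m.+2) coef f om' (pos i) (pos i.+1)) * wr om'.2); last first.
  apply: sum_nested cK; first exact: subsetUr.
  by rewrite sub setUCA setUA subsetUl.
apply: eq_bigr => om /andP [co eo].
have /andP [co1 /eqP so] := co.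
rewrite [X in X * _]mulrC -mulrA [X in _ * X]mulrC.
rewrite -/(perm_exp nu f m) (IHm (pos m.+1 |: K)) //; first last.
- rewrite -setI_eq0 setIUl setU_eq0; apply/andP; split.
    apply/eqP/setP => s; rewrite !inE; apply/negP => /andP [/eqP ->].
    by rewrite pm ltnn andbF.
  rewrite setI_eq0; apply: disjointWr dK.
  by rewrite sub subsetUr.
- by rewrite !inE eqxx.
- by rewrite !inE K0 orbT.
- exact: ltnW.
rewrite mulr_sumr; apply: eq_big => om'.
  by rewrite sub setUCA setUA.
case/andP=> /andP [co' _] e'; rewrite mulrA [in RHS]big_ord_recr /= [X in X * _]mulrC; congr (_ * _ * _).
rewrite -(coef_ext f co1 e') // so !inE ?eqxx // Km orbT //.
Qed.

Lemma trace_power : 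
  perm_trace nu (perm_comp nu f (perm_exp nu f N))
  = \sum_(om | confon [set: J] om)
      (\prod_(s : J) coef f om s (ordS s)) * wr om.2.
Proof.
pose s0 := pos 0; pose s1 := pos N.+1.
have s0E : val s0 = 0%N by rewrite /s0 /pos /= inordK.
have s1E : val s1 = N.+1 by rewrite /s1 /pos /= inordK.
have n01 : s0 != s1 by rewrite -val_eqE s0E s1E.
pose ki (i : I) : config X J :=
  (upd s0 i [ffun => None], pull (@stdlab X J s0 i)).
pose ve : config X J := ([ffun => None], [ffun => false]).
have sve : supp ve = set0 by apply/setP => s; rewrite !inE ffunE.
have cve : conf ve.
  apply/confP; split => /=.
  - by apply/ppoP; split => [v u x|u v]; rewrite ffunE.
  - by move=> x; rewrite !ffunE.
  - by move=> s u v; rewrite ffunE.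
have cki i : confon [set s0] (ki i).
  apply/andP; split; last by rewrite (supp_upd s0 i ve) sve setU0.
  have := @conf_upd X J s0 i ve (pull (@stdlab X J s0 i)) cve.
  rewrite sve inE => /(_ isT) h; have : conf (ki i) && ext ve (ki i); last by case/andP.
  rewrite h; apply/glueP; split=> //.
  - exact: ppo_pull.
  - by move=> u v; rewrite ffunE.
  - by move=> u ->; rewrite orbT.
have extki i om : confon [set: J] om -> ext (ki i) om = (om.1 s0 == Some i).
  case/andP=> /confP [po d fb] _; apply/extP/eqP => [[h _]|h].
    by rewrite h /= ?ffunE ?eqxx // inE /= !ffunE eqxx.
  split=> [s|[s u] [s' v]].
    by rewrite inE /= !ffunE; case: (s =P s0) => // ->.
  rewrite /= !pull_refl !stdlabP /=.
  case/andP=> /eqP -> /eqP ui /andP [/eqP -> /eqP vi].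
  by rewrite pull_stdlab // fb // h ?ui ?vi.
transitivity (\sum_(i : I) \sum_(om | confon [set: J] om && ext (ki i) om)
   (\prod_(s : J) coef f om s (ordS s)) * wr om.2); last first.
  under [LHS]eq_bigr => i _ do rewrite big_mkcondr /=.
  rewrite exchange_big /=; apply: eq_bigr => om com.
  under [LHS]eq_bigr => i _ do rewrite extki //.
  have [j oj] : exists j, om.1 s0 = Some j.
    case/andP: com => _ /eqP /setP /(_ s0); rewrite !inE.
    by case: (om.1 s0) => // j _; exists j.
  by rewrite oj -big_mkcond /= (big_pred1 j).
rewrite /perm_trace; apply: eq_bigr => i _.
have wi : wr (ki i).2 = w (summand i) by apply: wr_pull; apply: onto_stdlab.
have -> : perm_comp nu f (perm_exp nu f N) i i (class_of_amalg (id_amalg (summand i)))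
    = coef (perm_comp nu f (perm_exp nu f N)) (ki i) s0 s0.
  rewrite /coef /= !ffunE eqxx -coef_atE; congr (coef_at _ _).
  apply/ffunP => -[x y]; rewrite [RHS]ffunE [LHS]ffunE.
  have key z : stdlab s0 i (place2 s0 s0 z) = Some (am_map (id_amalg (summand i)) z).
    by case: z => p; rewrite /= stdlabE mk_embeddingE.
  by rewrite (pullE (key _) (key _)).
rewrite mulrC -wi (coef_comp nu _ f (cki i) _ _ (s1 := s1)) ?inE //; last by rewrite eq_sym.
rewrite -(sum_nested (K2 := s1 |: [set s0]) _ (subsetUr _ _) (subsetT _) (cki i)).
apply: eq_bigr => om /andP [co _].
have /andP [co1 /eqP so] := co.
rewrite [X in X * _]mulrC -mulrA [X in _ * X]mulrC.
rewrite (coef_exp (leqnn N) co); first last.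
- rewrite -setI_eq0; apply/eqP/setP => s; rewrite !inE -!val_eqE.
  rewrite -/s0 -/s1 s0E s1E.
  by apply/negP => /andP [/orP [] /eqP -> //]; rewrite ltnn andbF.
- by rewrite !inE eqxx.
- by rewrite !inE eqxx orbT.
have -> : s1 |: [set s0] :|: inner N = [set: J].
  apply/setP => s; rewrite !inE -!val_eqE -/s0 -/s1 s0E s1E.
  have := ltn_ord s; rewrite ltnS leq_eqVlt ltnS => /orP [->|->] //.
  by rewrite /=; case: (nat_of_ord s) => [|n]; rewrite /= ?orbT.
rewrite mulr_sumr; apply: eq_bigr => om' /andP [/andP [co' _] e'].
rewrite [in RHS]big_ord_recr /= mulrA [X in X * _]mulrC; congr (_ * _ * _).
  apply: eq_bigr => j _; congr coef; apply: val_inj; rewrite /= inordK //.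
  - by apply: leqW; apply: ltn_ord.
  - by rewrite modn_small // ltnS ltn_ord.
  - by rewrite ltnS ltn_ord.
rewrite -(coef_ext f co1 e') ?so ?inE ?eqxx ?orbT //.
by congr coef; apply: val_inj; rewrite /= ?s0E ?s1E ?modnn.
Qed.

End TracePower.

(** * Relations between the weights of small posets *)

Section Classification.
Variables (k : fieldType) (nu : measure k).
Notation w := (mu_poset nu).
Notation wr := (weight nu).

Lemma wr_nppo (T : finType) (e : brel T) : ~~ ppo e -> wr e = 0.
Proof. by rewrite /weight => /negbTE ->. Qed.

(** Weights factor as soon as all but one of the common extensions have weight
    zero; this is how the vanishing of a few weights determines all others. *)
Lemma wr_glue_uniq (T : finType) (e1 e2 e0 : brel T) : ppo e1 -> ppo e2 ->
  glue e1 e2 e0 -> (forall e, glue e1 e2 e -> wr e != 0 -> e = e0) ->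
  wr e1 * wr e2 = wr (meet e1 e2) * wr e0.
Proof.
move=> p1 p2 g0 uniq; rewrite wr_glue //; last first.
  by move=> u v a b c d; have /glueP [_ <- // <-] := g0.
congr (_ * _); rewrite (bigD1 e0) //= big1 ?addr0 // => e /andP [ge ne].
by apply: contraNeq ne => /(uniq _ ge) ->.
Qed.

Section TwoPoints.
Variables (T : finType) (e1 e2 : brel T) (x y : T).
Hypotheses (p1 : ppo e1) (p2 : ppo e2) (nxy : x != y).
Hypotheses (e1x : e1 (x, x)) (e1y : ~~ e1 (y, y)) (e2y : e2 (y, y)) (e2x : ~~ e2 (x, x)).
Hypothesis e12d : forall u, u != x -> u != y -> e1 (u, u) = e2 (u, u).
Hypothesis e12 : forall u v, u != x -> u != y -> v != x -> v != y -> e1 (u, v) = e2 (u, v).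

Definition join2 (a b : bool) : brel T :=
  [ffun uv => [|| e1 uv, e2 uv, a && (uv == (x, y)) | b && (uv == (y, x))]].

Lemma join2_1 a b u v : e1 (u, u) -> e1 (v, v) -> join2 a b (u, v) = e1 (u, v).
Proof.
move=> uu vv.
have uy : u != y by apply: contraNneq e1y => <-.
have vy : v != y by apply: contraNneq e1y => <-.
rewrite ffunE !xpair_eqE (negbTE uy) (negbTE vy) !andbF !orbF.
case e: (e2 (u, v)); last by rewrite orbF.
have /ppoP [_ rf] := p2; have [uu2 vv2] := rf _ _ e.
have ux : u != x by apply: contraNneq e2x => <-.
have vx : v != x by apply: contraNneq e2x => <-.
by rewrite e12 // e.
Qed.

Lemma join2_2 a b u v : e2 (u, u) -> e2 (v, v) -> join2 a b (u, v) = e2 (u, v).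
Proof.
move=> uu vv.
have ux : u != x by apply: contraNneq e2x => <-.
have vx : v != x by apply: contraNneq e2x => <-.
rewrite ffunE !xpair_eqE (negbTE ux) (negbTE vx) !andbF !orbF.
case e: (e1 (u, v)); last by [].
have /ppoP [_ rf] := p1; have [uu2 vv2] := rf _ _ e.
have uy : u != y by apply: contraNneq e1y => <-.
have vy : v != y by apply: contraNneq e1y => <-.
by rewrite -e12 // e.
Qed.

Lemma glue_join2 a b : glue e1 e2 (join2 a b) = ppo (join2 a b).
Proof.
apply/glueP/idP => [[] //|pj]; split => //.
- by move=> u v uu vv; rewrite join2_1.
- by move=> u v uu vv; rewrite join2_2.
- move=> u; rewrite ffunE !xpair_eqE => /or4P [->|->||] //; rewrite ?orbT //.
    by case/and3P=> _ /eqP -> /eqP E; have := nxy; rewrite E eqxx.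
  by case/and3P=> _ /eqP -> /eqP E; have := nxy; rewrite E eqxx.
Qed.

Lemma glue_join2E e : glue e1 e2 e -> e = join2 (e (x, y)) (e (y, x)).
Proof.
case/glueP=> pe g1 g2 g3; have /ppoP [_ rf] := pe.
have /ppoP [_ rf1] := p1; have /ppoP [_ rf2] := p2.
apply/ffunP => -[u v]; rewrite ffunE !xpair_eqE.
apply/idP/or4P => [uv|[uv|uv|/and3P [xy /eqP -> /eqP ->] //|/and3P [xy /eqP -> /eqP ->] //]].
- have [uu vv] := rf _ _ uv.
  have [u1|u1] := boolP (e1 (u, u)); have [v1|v1] := boolP (e1 (v, v)).
  + by apply: Or41; rewrite -g1.
  + have v2 := g3 _ vv; rewrite (negbTE v1) /= in v2.
    have vy : v = y.
      apply/eqP; apply: contraNT v1 => vy; rewrite e12d //.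
      by apply: contraNneq e2x => <-.
    subst v; have [ux|ux] := eqVneq u x.
      by subst u; apply: Or43; rewrite uv !eqxx.
    apply: Or42; rewrite -g2 // -e12d //.
    by apply: contraNneq e1y => <-.
  + have u2 := g3 _ uu; rewrite (negbTE u1) /= in u2.
    have uy : u = y.
      apply/eqP; apply: contraNT u1 => uy; rewrite e12d //.
      by apply: contraNneq e2x => <-.
    subst u; have [vx|vx] := eqVneq v x.
      by subst v; apply: Or44; rewrite uv !eqxx.
    apply: Or42; rewrite -g2 // -e12d //.
    by apply: contraNneq e1y => <-.
  + apply: Or42; rewrite -g2 //.
      by have := g3 _ uu; rewrite (negbTE u1).
    by have := g3 _ vv; rewrite (negbTE v1).
- by have [uu vv] := rf1 _ _ uv; rewrite g1.
- by have [uu vv] := rf2 _ _ uv; rewrite g2.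
Qed.

(** Two one-point extensions of the same partial preorder: in an amalgamation
    only the relations between the two new points are free, which leaves four
    candidates. *)
Lemma wr_two_points :
  wr e1 * wr e2 = wr (meet e1 e2) *
    (wr (join2 true true) + wr (join2 true false)
     + wr (join2 false true) + wr (join2 false false)).
Proof.
rewrite wr_glue //; last first.
  by move=> u v u1 v1 u2 v2; rewrite -(join2_1 true true) // join2_2.
congr (_ * _).
rewrite (partition_big (fun e : brel T => (e (x, y), e (y, x))) xpredT) //=.
have key a b : \sum_(e | glue e1 e2 e && ((e (x, y), e (y, x)) == (a, b))) wr e
   = wr (join2 a b).
  case pj: (ppo (join2 a b)); last first.
    rewrite (wr_nppo (negbT pj)) big1 // => e /andP [ge /eqP [ea eb]].
    by rewrite (glue_join2E ge) ea eb wr_nppo ?pj.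
  rewrite (big_pred1 (join2 a b)) // => e /=; apply/andP/eqP => [[ge /eqP [<- <-]]|->].
    exact: glue_join2E.
  rewrite glue_join2 pj; split=> //.
  have d1 u v : e1 (u, v) -> e1 (u, u) && e1 (v, v).
    by have /ppoP [_ rf] := p1; move/rf=> [-> ->].
  have d2 u v : e2 (u, v) -> e2 (u, u) && e2 (v, v).
    by have /ppoP [_ rf] := p2; move/rf=> [-> ->].
  have e1xy : e1 (x, y) = false by apply/negP => /d1; rewrite (negbTE e1y) andbF.
  have e1yx : e1 (y, x) = false by apply/negP => /d1; rewrite (negbTE e1y).
  have e2xy : e2 (x, y) = false by apply/negP => /d2; rewrite (negbTE e2x).
  have e2yx : e2 (y, x) = false by apply/negP => /d2; rewrite (negbTE e2x) andbF.
  rewrite !ffunE !xpair_eqE e1xy e1yx e2xy e2yx !eqxx [y == x]eq_sym (negbTE nxy).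
  by case: (a); case: (b).
rewrite -(pair_big xpredT xpredT (fun a b => \sum_(e | glue e1 e2 e && ((e (x, y), e (y, x)) == (a, b))) wr e)) /=.
by rewrite !big_bool /= !key !addrA.
Qed.

End TwoPoints.

(** Small posets are given by the list of all pairs in the relation, so that the
    side conditions of the relations between their weights are decided by
    evaluation. *)
Definition list_rel (l : seq (nat * nat)) : brel 'I_4 :=
  [ffun uv : 'I_4 * 'I_4 => (nat_of_ord uv.1, nat_of_ord uv.2) \in l].
Definition list_weight l : k := wr (list_rel l).
Local Notation lw := list_weight.

Definition in_range l := all (fun p : nat * nat => (p.1 < 4) && (p.2 < 4))%N l.
Definition list_ppo (l : seq (nat * nat)) :=
  all (fun p : nat * nat => all (fun q : nat * nat => (p.2 == q.1) ==> ((p.1, q.2) \in l)) l) l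
  && all (fun p : nat * nat => ((p.1, p.1) \in l) && ((p.2, p.2) \in l)) l.

Lemma list_rel_ppo l : in_range l -> ppo (list_rel l) = list_ppo l.
Proof.
move=> /allP sl.
apply/ppoP/andP => [[tr rf]|[/allP tr /allP rf]].
  have ord a b : (a, b) \in l -> exists u v : 'I_4, u = a :> nat /\ v = b :> nat.
    by move=> /sl /= /andP [a4 b4]; exists (Ordinal a4), (Ordinal b4).
  split; apply/allP => -[a b] ab.
    apply/allP => -[c d] cd; apply/implyP => /= /eqP bc; subst c.
    have [u [v [ua vb]]] := ord _ _ ab; have [_ [x [_ xd]]] := ord _ _ cd.
    by have := tr v u x; rewrite !ffunE /= ua vb xd; apply.
  have [u [v [ua vb]]] := ord _ _ ab.
  by have := rf u v; rewrite !ffunE /= ua vb => /(_ ab) [-> ->].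
split=> [v u x|u v]; rewrite !ffunE /=.
  by move=> /tr /allP h /h /=; rewrite eqxx.
by move=> /rf /andP.
Qed.

Lemma lw_eq0 l : in_range l -> ~~ list_ppo l -> lw l = 0.
Proof. by move=> /list_rel_ppo E; rewrite -E => /wr_nppo. Qed.

(** [g] sends the points of [l'] to points of [l], up to equivalence. *)
Definition list_match (l l' : seq (nat * nat)) (g : seq nat) :=
  let pts := iota 0%N 4 in
  [&& in_range l, in_range l', list_ppo l, list_ppo l', all (fun i => nth 0%N g i < 4)%N pts,
    all (fun u => ((u, u) \in l') ==> all (fun v => ((v, v) \in l') ==>
          (((nth 0%N g u, nth 0%N g v) \in l) == ((u, v) \in l'))) pts) pts
   & all (fun v => ((v, v) \in l) ==> has (fun u => [&& (u, u) \in l',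
         (v, nth 0%N g u) \in l & (nth 0%N g u, v) \in l]) pts) pts].

Lemma lw_match l l' g : list_match l l' g -> lw l = lw l'.
Proof.
case/and5P=> sl sl' pl pl' /and3P [/allP g4 /allP ag /allP su].
have in4 (u : 'I_4) : (u : nat) \in iota 0%N 4 by rewrite mem_iota ltn_ord.
have gi (u : 'I_4) : (inord (nth 0%N g u) : 'I_4) = nth 0%N g u :> nat.
  by rewrite inordK //; apply: g4.
apply/esym/(wr_eq nu (g := fun u : 'I_4 => inord (nth 0%N g u) : 'I_4)).
- by rewrite list_rel_ppo.
- by rewrite list_rel_ppo.
- move=> u v; rewrite !ffunE /= !gi => uu vv.
  by move/implyP/(_ uu)/allP/(_ _ (in4 v))/implyP/(_ vv)/eqP: (ag _ (in4 u)).
- move=> v; rewrite !ffunE /= => vv.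
  move/implyP/(_ vv)/hasP: (su _ (in4 v)) => [u u4 /and3P [uu a b]].
  move: u4; rewrite mem_iota => u4; exists (Ordinal u4).
  have /= gu := gi (Ordinal u4).
  by split; rewrite ?ffunE /= ?gu.
Qed.

Definition list_two_points (l1 l2 : seq (nat * nat)) (x y : nat) :=
  let pts := iota 0%N 4 in
  [&& in_range l1, in_range l2, list_ppo l1, list_ppo l2 & [&& (x < 4)%N, (y < 4)%N, x != y,
   (x, x) \in l1, (y, y) \notin l1, (y, y) \in l2, (x, x) \notin l2 &
   all (fun u => all (fun v =>
     [&& u != x, u != y, v != x & v != y] ==> (((u, v) \in l1) == ((u, v) \in l2))) pts) pts]].

Lemma lw_two_points l1 l2 x y : list_two_points l1 l2 x y ->
  lw l1 * lw l2 = lw [seq p <- l1 | p \in l2] *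
    (lw (l1 ++ l2 ++ [:: (x, y); (y, x)]) + lw (l1 ++ l2 ++ [:: (x, y)])
     + lw (l1 ++ l2 ++ [:: (y, x)]) + lw (l1 ++ l2)).
Proof.
case/and5P=> sl1 sl2 pl1 pl2 /and5P [x4 y4 nxy l1x /and4P [l1y l2y l2x /allP ag]].
have in4 (u : 'I_4) : (u : nat) \in iota 0%N 4 by rewrite mem_iota ltn_ord.
pose X := Ordinal x4; pose Y := Ordinal y4.
rewrite /list_weight (@wr_two_points _ (list_rel l1) (list_rel l2) X Y) ?list_rel_ppo ?ffunE //; last 2 first.
- move=> u ux uy; rewrite !ffunE /=; apply/eqP.
  by move/allP/(_ _ (in4 u))/implyP: (ag _ (in4 u)); apply; apply/and4P.
- move=> u v ux uy vx vy; rewrite !ffunE /=; apply/eqP.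
  by move/allP/(_ _ (in4 v))/implyP: (ag _ (in4 u)); apply; apply/and4P.
have -> : meet (list_rel l1) (list_rel l2) = list_rel [seq p <- l1 | p \in l2].
  by apply/ffunP => -[u v]; rewrite !ffunE /= mem_filter andbC.
have J a b : join2 (list_rel l1) (list_rel l2) X Y a b
    = list_rel (l1 ++ l2 ++ nseq a (x, y) ++ nseq b (y, x)).
  apply/ffunP => -[u v]; rewrite !ffunE /= !mem_cat !mem_nseq /=.
  by rewrite !lt0b !xpair_eqE.
by rewrite !J /= cats0.
Qed.

Definition list_same (l l' : seq (nat * nat)) :=
  has (list_match l l') (permutations (iota 0%N 4)) || [&& in_range l, in_range l', ~~ list_ppo l & ~~ list_ppo l'].

Lemma lw_same l l' : list_same l l' -> lw l = lw l'.
Proof.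
case/orP=> [/hasP [g _] /lw_match //|/and4P [? ? ? ?]].
by rewrite !lw_eq0.
Qed.

Lemma lw_relation l1 l2 x y c1 c2 cm ca cb cc cd :
  [&& list_two_points l1 l2 x y, list_same l1 c1, list_same l2 c2,
      list_same [seq p <- l1 | p \in l2] cm
    & [&& list_same (l1 ++ l2 ++ [:: (x, y); (y, x)]) ca, list_same (l1 ++ l2 ++ [:: (x, y)]) cb,
          list_same (l1 ++ l2 ++ [:: (y, x)]) cc & list_same (l1 ++ l2) cd]] ->
  lw c1 * lw c2 = lw cm * (lw ca + lw cb + lw cc + lw cd).
Proof.
case/and5P=> h /lw_same <- /lw_same <- /lw_same <-.
case/and4P=> /lw_same <- /lw_same <- /lw_same <- /lw_same <-.
exact: lw_two_points.
Qed.

Definition lpoint := [:: (0, 0)]%N.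
Definition lchain2 := [:: (0, 0); (1, 1); (0, 1)]%N.
Definition lantichain2 := [:: (0, 0); (1, 1)]%N.
Definition lchain3 := [:: (0, 0); (1, 1); (2, 2); (0, 1); (0, 2); (1, 2)]%N.
Definition lV := [:: (0, 0); (1, 1); (2, 2); (0, 1); (0, 2)]%N.
Definition llambda := [:: (0, 0); (1, 1); (2, 2); (1, 0); (2, 0)]%N.
Definition lchain_point := [:: (0, 0); (1, 1); (2, 2); (0, 1)]%N.
Definition lchain4 := [:: (0, 0); (1, 1); (2, 2); (3, 3);
  (0, 1); (0, 2); (0, 3); (1, 2); (1, 3); (2, 3)]%N.
Definition lfork := [:: (0, 0); (1, 1); (2, 2); (3, 3);
  (0, 1); (0, 2); (0, 3); (1, 2); (1, 3)]%N.
Definition ldiamond := [:: (0, 0); (1, 1); (2, 2); (3, 3);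
  (0, 1); (0, 2); (0, 3); (1, 3); (2, 3)]%N.
(** A relation that is not reflexive, hence of weight zero: it stands for the
    candidates that are excluded by transitivity. *)
Definition linvalid := [:: (0, 1)]%N.

Lemma lw_invalid : lw linvalid = 0.
Proof. by rewrite lw_eq0. Qed.

Lemma lw_nil : lw [::] = 1.
Proof.
have o : onto (fun _ : 'I_4 => None : option empty_poset) by case.
have h : w empty_poset = 1.
  by rewrite /mu_poset (mu_iso nu) //; exists id; case.
by rewrite -h -(wr_pull nu o); congr wr; apply/ffunP => -[u v]; rewrite !ffunE.
Qed.

Local Notation t := (lw lpoint).

Lemma rel_point : t ^+ 2 = t + 2 * lw lchain2 + lw lantichain2.
Proof.
have := @lw_relation [:: (0, 0)]%N [:: (1, 1)]%N 0 1 lpoint lpoint [::] lpoint lchain2 lchain2 lantichain2.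
rewrite lw_nil => E; rewrite expr2 E; last by vm_compute.
ring.
Qed.

Lemma rel_up : lw lchain2 ^+ 2 = t * (lw lchain2 + 2 * lw lchain3 + lw lV).
Proof.
have := @lw_relation [:: (0, 0); (1, 1); (0, 1)]%N [:: (0, 0); (2, 2); (0, 2)]%N 1 2
  lchain2 lchain2 lpoint lchain2 lchain3 lchain3 lV.
move=> E; rewrite expr2 E; last by vm_compute.
ring.
Qed.

Lemma rel_down : lw lchain2 ^+ 2 = t * (lw lchain2 + 2 * lw lchain3 + lw llambda).
Proof.
have := @lw_relation [:: (0, 0); (1, 1); (1, 0)]%N [:: (0, 0); (2, 2); (2, 0)]%N 1 2
  lchain2 lchain2 lpoint lchain2 lchain3 lchain3 llambda.
move=> E; rewrite expr2 E; last by vm_compute.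
ring.
Qed.

Lemma rel_updown : lw lchain2 ^+ 2 = t * lw lchain3.
Proof.
have := @lw_relation [:: (0, 0); (1, 1); (0, 1)]%N [:: (0, 0); (2, 2); (2, 0)]%N 1 2
  lchain2 lchain2 lpoint linvalid linvalid lchain3 linvalid.
move=> E; rewrite expr2 E; last by vm_compute.
rewrite lw_invalid; ring.
Qed.

Lemma rel_side : lw lchain2 * lw lantichain2 = t * (lw llambda + lw lchain_point).
Proof.
have := @lw_relation [:: (0, 0); (1, 1); (0, 1)]%N [:: (0, 0); (2, 2)]%N 1 2
  lchain2 lantichain2 lpoint linvalid linvalid llambda lchain_point.
move=> E; rewrite E; last by vm_compute.
rewrite lw_invalid; ring.
Qed.

Lemma rel_fork : lw lchain3 ^+ 2 = lw lchain2 * (lw lchain3 + 2 * lw lchain4 + lw lfork).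
Proof.
have := @lw_relation [:: (0, 0); (1, 1); (2, 2); (0, 1); (0, 2); (1, 2)]%N
   [:: (0, 0); (1, 1); (3, 3); (0, 1); (0, 3); (1, 3)]%N 2 3
  lchain3 lchain3 lchain2 lchain3 lchain4 lchain4 lfork.
move=> E; rewrite expr2 E; last by vm_compute.
ring.
Qed.

Lemma rel_diamond : lw lchain3 ^+ 2 = lw lchain2 * (lw lchain3 + 2 * lw lchain4 + lw ldiamond).
Proof.
have := @lw_relation [:: (0, 0); (1, 1); (2, 2); (0, 1); (0, 2); (2, 1)]%N
   [:: (0, 0); (1, 1); (3, 3); (0, 1); (0, 3); (3, 1)]%N 2 3
  lchain3 lchain3 lchain2 lchain3 lchain4 lchain4 ldiamond.
move=> E; rewrite expr2 E; last by vm_compute.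
ring.
Qed.

Lemma rel_Y : lw lchain3 * lw lV = lw lchain2 * lw lfork.
Proof.
have := @lw_relation [:: (0, 0); (1, 1); (2, 2); (0, 1); (2, 0); (2, 1)]%N
   [:: (0, 0); (1, 1); (3, 3); (0, 1); (0, 3)]%N 2 3
  lchain3 lV lchain2 linvalid lfork linvalid linvalid.
move=> E; rewrite E; last by vm_compute.
rewrite lw_invalid; ring.
Qed.

Lemma rel_D : lw lV * lw llambda = lw lantichain2 * lw ldiamond.
Proof.
have := @lw_relation [:: (0, 0); (1, 1); (2, 2); (2, 0); (2, 1)]%N
   [:: (0, 0); (1, 1); (3, 3); (0, 3); (1, 3)]%N 2 3
  lV llambda lantichain2 linvalid ldiamond linvalid linvalid.
move=> E; rewrite E; last by vm_compute.
rewrite lw_invalid; ring.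
Qed.

(** If chains with two elements have nonzero weight, the two forks agree, and so
    do their extensions by a bottom element.  If the fork [lV] has nonzero weight,
    comparing the two ways to build the diamond gives the value of the fork, which
    exhausts the amalgamations, along a point, of a chain and an antichain with two
    elements: nothing is left for a chain with an isolated point, so the posets of nonzero
    weight are weak orders.  If the forks have weight zero, comparability is an
    equivalence relation on the posets of nonzero weight. *)
Lemma trichotomy : t != 0 ->
  [\/ lw lchain2 = 0,
      [/\ lw lchain_point = 0, lw lchain2 = t ^+ 2 & lw lantichain2 = - t - t ^+ 2]
    | [/\ lw lV = 0, lw llambda = 0, lw lchain2 = - t & lw lantichain2 = t ^+ 2 + t]].
Proof.
move=> t0.
have [c0|c0] := eqVneq (lw lchain2) 0; [exact: Or31|].
have VL : lw lV = lw llambda.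
  by apply: (addrI (lw lchain2 + 2 * lw lchain3)); apply: (mulfI t0); rewrite -rel_up rel_down.
have YD : lw lfork = lw ldiamond.
  by apply: (addrI (lw lchain3 + 2 * lw lchain4)); apply: (mulfI c0); rewrite -rel_fork rel_diamond.
have tV : t * lw lV = - lw lchain2 * (t + lw lchain2).
  have := rel_up; have := rel_updown => e1 e2.
  have {}e2 : lw lchain2 ^+ 2 = t * lw lchain2 + 2 * lw lchain2 ^+ 2 + t * lw lV.
    rewrite {2}e1 [LHS]e2; ring.
  have -> : t * lw lV = (t * lw lchain2 + 2 * lw lchain2 ^+ 2 + t * lw lV)
     - t * lw lchain2 - 2 * lw lchain2 ^+ 2 by ring.
  rewrite -e2; ring.
have [V0|V0] := eqVneq (lw lV) 0.
  apply: Or33.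
  have c2 : lw lchain2 = - t.
    apply/eqP; rewrite -addr_eq0 addrC; move/eqP: tV.
    by rewrite V0 mulr0 eq_sym mulf_eq0 oppr_eq0 (negbTE c0).
  split; rewrite -?VL //; have := rel_point; rewrite c2 => ->; ring.
apply: Or32.
have tVa : t * lw lV = lw lchain2 * lw lantichain2.
  apply: (mulfI V0); apply: (mulfI c0).
  transitivity (t * (lw lchain2 * (lw lV * lw llambda))); first by rewrite VL; ring.
  rewrite rel_D -YD mulrCA.
  transitivity (lw lantichain2 * (t * (lw lchain2 * lw lfork))); first by ring.
  rewrite -rel_Y.
  transitivity (lw lantichain2 * lw lV * (t * lw lchain3)); first by ring.
  rewrite -rel_updown; ring.
have a2 : lw lantichain2 = - t - lw lchain2.
  apply: (mulfI c0); rewrite -tVa tV; ring.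
have c2 : lw lchain2 = t ^+ 2 by rewrite rel_point a2; ring.
split => //; last by rewrite a2 c2.
apply: (mulfI t0); apply: (addrI (t * lw llambda)); rewrite mulr0 addr0 -mulrDr -rel_side.
by rewrite -tVa VL.
Qed.

End Classification.

(** * The weights of all posets *)

Section WeightPolynomials.
Variables (k : fieldType) (nu : measure k).
Notation w := (mu_poset nu).
Notation wr := (weight nu).
Notation lw := (list_weight nu).
Notation t := (lw lpoint).

Definition sub_le (P : fposet) (A : {set P}) : brel P :=
  [ffun uv => [&& uv.1 \in A, uv.2 \in A & (uv.1 <= uv.2)%O]].

Lemma ppo_sub_le (P : fposet) (A : {set P}) : ppo (sub_le A).
Proof.
apply/ppoP; split=> [v u x|u v]; rewrite !ffunE /=.
  by case/and3P=> -> _ a /and3P [_ -> b]; apply: le_trans a b.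
by case/and3P=> -> ->; rewrite !lexx.
Qed.

Lemma sub_le_refl (P : fposet) (A : {set P}) u : sub_le A (u, u) = (u \in A).
Proof. by rewrite ffunE /= lexx andbT andbb. Qed.

Lemma wr_full (P : fposet) : wr (sub_le [set: P]) = w P.
Proof.
have o : onto (Some : P -> option P) by move=> a; exists a.
by rewrite -(wr_pull nu o); congr wr; apply/ffunP => -[u v]; rewrite !ffunE /= !inE.
Qed.

Lemma meet_sub_le (P : fposet) (A B : {set P}) :
  meet (sub_le A) (sub_le B) = sub_le (A :&: B).
Proof.
apply/ffunP => -[u v]; rewrite !ffunE /= !inE.
by case: (u \in A); case: (v \in A); case: (u \in B); case: (v \in B);
  rewrite /= ?andbF ?andbb.
Qed.

(** If, up to weight zero, the union of two subsets is their only amalgamation,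
    its weight is determined by the weights of the two subsets and of their
    intersection. *)
Lemma w_factor (P : fposet) (A B : {set P}) :
  (forall e, ppo e -> wr e != 0 ->
     (forall u v, u \in A -> v \in A -> e (u, v) = (u <= v)%O) ->
     (forall u v, u \in B -> v \in B -> e (u, v) = (u <= v)%O) ->
     forall u v, u \in A -> u \notin B -> v \in B -> v \notin A ->
       e (u, v) = (u <= v)%O /\ e (v, u) = (v <= u)%O) ->
  wr (sub_le A) * wr (sub_le B) = wr (sub_le (A :&: B)) * wr (sub_le (A :|: B)).
Proof.
move=> uniq; rewrite -meet_sub_le.
apply: wr_glue_uniq; try exact: ppo_sub_le.
  apply/glueP; split; first exact: ppo_sub_le.
  - by move=> u v; rewrite !sub_le_refl => uA vA; rewrite !ffunE /= !inE uA vA.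
  - by move=> u v; rewrite !sub_le_refl => uA vA; rewrite !ffunE /= !inE uA vA !orbT.
  - by move=> u; rewrite !sub_le_refl inE.
move=> e /glueP [pe g1 g2 g3] ne; have /ppoP [_ rf] := pe.
have inAB u : e (u, u) -> (u \in A) || (u \in B) by move/g3; rewrite !sub_le_refl.
have eA u v : u \in A -> v \in A -> e (u, v) = (u <= v)%O.
  by move=> uA vA; rewrite g1 ?sub_le_refl // ffunE /= uA vA.
have eB u v : u \in B -> v \in B -> e (u, v) = (u <= v)%O.
  by move=> uA vA; rewrite g2 ?sub_le_refl // ffunE /= uA vA.
have eu u v : u \in A -> u \notin B -> v \in B -> v \notin A ->
       e (u, v) = (u <= v)%O /\ e (v, u) = (v <= u)%O := uniq e pe ne eA eB u v.
apply/ffunP => -[u v]; rewrite ffunE /= !inE.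
case uAB: ((u \in A) || (u \in B)) => /=; last first.
  by apply/negP => /rf [/inAB]; rewrite uAB.
case vAB: ((v \in A) || (v \in B)) => /=; last first.
  by apply/negP => /rf [_ /inAB]; rewrite vAB.
have [uA|uA] := boolP (u \in A); have [vA|vA] := boolP (v \in A).
- exact: eA.
- have vB : v \in B by move: vAB; rewrite (negbTE vA).
  have [uB|uB] := boolP (u \in B); first exact: eB.
  by have [] := eu u v uA uB vB vA.
- have uB : u \in B by move: uAB; rewrite (negbTE uA).
  have [vB|vB] := boolP (v \in B); first exact: eB.
  by have [] := eu v u vA vB uB uA.
- by apply: eB; [move: uAB; rewrite (negbTE uA) | move: vAB; rewrite (negbTE vA)].
Qed.

(** A copy of a small poset of weight zero kills the weight. *)
Lemma wr_forbid (T : finType) (e : brel T) (l : seq (nat * nat)) (g : nat -> T) :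
  in_range l -> list_ppo l -> lw l = 0 ->
  all (fun u => ((u, u) \in l) ==> all (fun v => ((v, v) \in l) ==>
          (e (g u, g v) == ((u, v) \in l))) (iota 0 4)) (iota 0 4) ->
  wr e = 0.
Proof.
move=> sl pl w0 /allP h; apply: (wr_sub (e' := list_rel l) (g := fun u : 'I_4 => g u)) w0.
  by rewrite list_rel_ppo.
have in4 (u : 'I_4) : (u : nat) \in iota 0 4 by rewrite mem_iota ltn_ord.
move=> u v; rewrite !ffunE /= => uu vv.
by move/implyP/(_ uu)/allP/(_ _ (in4 v))/implyP/(_ vv)/eqP: (h _ (in4 u)).
Qed.

Lemma wr_t0 (T : finType) (e : brel T) (x : T) :
  ppo e -> t = 0 -> e (x, x) -> wr e = 0.
Proof. by move=> pe t0 xx; apply: (@wr_forbid _ e lpoint (fun _ => x)) => //=; rewrite xx. Qed.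

Lemma wr_chain0 (T : finType) (e : brel T) (x y : T) :
  ppo e -> lw lchain2 = 0 -> e (x, y) -> ~~ e (y, x) -> wr e = 0.
Proof.
move=> /ppoP [_ rf] c0 xy yx; have [xx yy] := rf _ _ xy.
apply: (@wr_forbid _ e lchain2 (nth x [:: x; y])) => //=.
by rewrite xx xy yy (negbTE yx).
Qed.

(** Without a copy of a chain with an isolated point, incomparability is
    transitive. *)
Lemma wr_weak (T : finType) (e : brel T) (x y z : T) :
  ppo e -> lw lchain_point = 0 -> wr e != 0 -> e (x, y) -> ~~ e (y, x) -> e (z, z) ->
  (e (x, z) && ~~ e (z, x)) || (e (z, y) && ~~ e (y, z)).
Proof.
move=> /ppoP [tr rf] n0 ne xy yx zz; have [xx yy] := rf _ _ xy.
apply: contraNT ne; rewrite negb_or !negb_and !negbK => /andP [a b].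
apply/eqP.
have xz : e (x, z) = false.
  apply/negP => xz; case/orP: a => [|zx]; first by rewrite xz.
  have zy := tr _ _ _ zx xy; case/orP: b => [|yz]; first by rewrite zy.
  by case/negP: yx; apply: tr yz zx.
have zy : e (z, y) = false.
  apply/negP => zy; case/orP: b => [|yz]; first by rewrite zy.
  by have := tr _ _ _ xy yz; rewrite xz.
have zx : e (z, x) = false by apply/negP => zx; have := tr _ _ _ zx xy; rewrite zy.
have yz : e (y, z) = false by apply/negP => yz; have := tr _ _ _ xy yz; rewrite xz.
apply: (@wr_forbid _ e lchain_point (nth x [:: x; y; z])) => //=.
by rewrite xx xy yy (negbTE yx) zz xz zx yz zy.
Qed.

Lemma wr_up_comparable (T : finType) (e : brel T) (x y z : T) :
  ppo e -> lw lV = 0 -> wr e != 0 -> e (x, y) -> e (x, z) -> e (y, z) || e (z, y).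
Proof.
move=> /ppoP [tr rf] n0 ne xy xz; have [xx yy] := rf _ _ xy; have [_ zz] := rf _ _ xz.
have [yx|yx] := boolP (e (y, x)); first by rewrite (tr _ _ _ yx xz).
have [zx|zx] := boolP (e (z, x)); first by rewrite (tr _ _ _ zx xy) orbT.
apply: contraNT ne; rewrite negb_or => /andP [/negbTE yz /negbTE zy].
apply/eqP/(@wr_forbid _ e lV (nth x [:: x; y; z])) => //=.
by rewrite xx xy yy (negbTE yx) zz xz (negbTE zx) yz zy.
Qed.

Lemma wr_down_comparable (T : finType) (e : brel T) (x y z : T) :
  ppo e -> lw llambda = 0 -> wr e != 0 -> e (y, x) -> e (z, x) -> e (y, z) || e (z, y).
Proof.
move=> /ppoP [tr rf] n0 ne yx zx; have [yy xx] := rf _ _ yx; have [zz _] := rf _ _ zx.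
have [xy|xy] := boolP (e (x, y)); first by rewrite (tr _ _ _ zx xy) orbT.
have [xz|xz] := boolP (e (x, z)); first by rewrite (tr _ _ _ yx xz).
apply: contraNT ne; rewrite negb_or => /andP [/negbTE yz /negbTE zy].
apply/eqP/(@wr_forbid _ e llambda (nth x [:: x; y; z])) => //=.
by rewrite xx (negbTE xy) yy yx zz (negbTE xz) zx yz zy.
Qed.

Definition diag (T : finType) (A : {set T}) : brel T :=
  [ffun uv => (uv.1 == uv.2) && (uv.1 \in A)].

Lemma ppo_diag (T : finType) (A : {set T}) : ppo (diag A).
Proof.
apply/ppoP; split=> [v u x|u v]; rewrite !ffunE /=.
  by case/andP=> /eqP -> _ /andP [/eqP -> ->]; rewrite eqxx.
by case/andP=> /eqP -> ->; rewrite eqxx.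
Qed.

Definition antichain_weight (n : nat) : k := wr (diag [set: 'I_n]).

Lemma wr_diag (T : finType) (A : {set T}) : wr (diag A) = antichain_weight #|A|.
Proof.
apply/esym/(wr_eq nu (g := @enum_val T (mem A))); try exact: ppo_diag.
- move=> u v _ _; rewrite !ffunE /= (inj_eq enum_val_inj) enum_valP inE.
  by rewrite andbT.
- move=> v; rewrite ffunE /= eqxx /= => vA; exists (enum_rank_in vA v).
  by rewrite !ffunE /= !inE !eqxx enum_rankK_in // eqxx vA.
Qed.

Lemma antichain_weight0 : antichain_weight 0 = 1.
Proof.
rewrite -(lw_nil nu); apply: (wr_eq nu (g := fun u : 'I_0 => ord0 : 'I_4)).
- exact: ppo_diag.
- by rewrite list_rel_ppo.
- by case.
- by move=> v; rewrite ffunE.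
Qed.

Lemma antichain_weight1 : antichain_weight 1 = t.
Proof.
apply: (wr_eq nu (g := fun u : 'I_1 => ord0 : 'I_4)).
- exact: ppo_diag.
- by rewrite list_rel_ppo.
- by move=> u v _ _; rewrite !ord1 !ffunE /= !inE.
- move=> v; rewrite ffunE inE /= xpair_eqE andbb => /eqP v0; exists ord0.
  by rewrite !ffunE !inE /= v0.
Qed.

Lemma antichain_weight2 : antichain_weight 2 = lw lantichain2.
Proof.
apply: (wr_eq nu (g := fun u : 'I_2 => inord u : 'I_4)).
- exact: ppo_diag.
- by rewrite list_rel_ppo.
- move=> u v _ _; rewrite !ffunE /= !inE andbT.
  by case: u v => [[|[|u]] //= ?] [[|[|v]] //= ?]; rewrite !inordK.
- move=> v; rewrite ffunE !inE /= !xpair_eqE !andbb => v01.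
  have v2 : (v < 2)%N by case/orP: v01 => /eqP ->.
  exists (Ordinal v2); rewrite /= inord_val.
  by rewrite !ffunE !inE /= !xpair_eqE !andbb v01 eqxx.
Qed.

Lemma antichain_weight_mono m n : (m <= n)%N -> antichain_weight m = 0 -> antichain_weight n = 0.
Proof.
move=> mn; apply: (wr_sub (g := widen_ord mn)); first exact: ppo_diag.
by move=> u v _ _; rewrite !ffunE /= !inE.
Qed.

(** An antichain with [m] elements and a disjoint chain with two elements. *)
Definition diag2 m : brel 'I_m.+2 :=
  [ffun uv => (uv.1 == uv.2) || (uv == (ord0, ord_max))].

Lemma ppo_diag2 m : ppo (diag2 m).
Proof.
apply/ppoP; split=> [v u z|u v]; rewrite !ffunE /= !xpair_eqE.
  case: (u =P v) => [->//|_] /= /andP [/eqP -> /eqP ->].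
  by rewrite orbF => /eqP <-; rewrite !eqxx orbT.
by rewrite !eqxx.
Qed.

(** Amalgamate two antichains with [m.+1] elements along [m] elements: the two
    new points coincide, or are comparable in one of two ways, or are not. *)
Lemma antichain_weight_rec m :
  antichain_weight m.+1 ^+ 2 = antichain_weight m * (antichain_weight m.+1 + 2 * wr (diag2 m) + antichain_weight m.+2).
Proof.
pose x : 'I_m.+2 := ord0; pose y : 'I_m.+2 := ord_max.
have nxy : x != y by [].
pose e1 := diag [set~ y]; pose e2 := diag [set~ x].
have d1 u v : e1 (u, v) = (u == v) && (u != y) by rewrite ffunE /= !inE.
have d2 u v : e2 (u, v) = (u == v) && (u != x) by rewrite ffunE /= !inE.
have W1 : wr e1 = antichain_weight m.+1 by rewrite wr_diag cardsC1 card_ord.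
have W2 : wr e2 = antichain_weight m.+1 by rewrite wr_diag cardsC1 card_ord.
have W12 : wr (meet e1 e2) = antichain_weight m.
  have -> : meet e1 e2 = diag ([set~ y] :\ x).
    apply/ffunP => -[u v]; rewrite ffunE d1 d2 ffunE /= !inE.
    by case: (u == v); case: (u == x); case: (u == y).
  rewrite wr_diag; congr antichain_weight; have := cardsD1 x [set~ y].
  by rewrite cardsC1 card_ord !inE nxy => -[].
rewrite expr2 -{1}W1 -{1}W2 (@wr_two_points k nu _ e1 e2 x y) ?d1 ?d2 ?eqxx ?nxy //=;
  try exact: ppo_diag; last 2 first.
- by move=> u ux uy; rewrite d1 d2 ux uy.
- by move=> u v ux uy vx vy; rewrite d1 d2 ux uy.
rewrite W12; congr (_ * _).
have JE a b u v : join2 e1 e2 x y a b (u, v) =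
    [|| u == v, a && ((u, v) == (x, y)) | b && ((u, v) == (y, x))].
  rewrite ffunE d1 d2 /=; case: (u =P v) => //= <-.
  by case: (u =P y) => //= ->; rewrite eq_sym nxy.
have J10 : join2 e1 e2 x y true false = diag2 m.
  by apply/ffunP => -[u v]; rewrite JE ffunE /= orbF.
have pd2 := ppo_diag2 m.
have -> : wr (join2 e1 e2 x y false true) = wr (diag2 m).
  have E u v : join2 e1 e2 x y false true (u, v) = diag2 m (rev_ord u, rev_ord v).
    rewrite JE ffunE /= (inj_eq rev_ord_inj) !xpair_eqE; congr (_ || _).
    by rewrite -!val_eqE /=; have := ltn_ord u; have := ltn_ord v; lia.
  apply/esym/(wr_eq nu (g := @rev_ord m.+2)) => //.
  - apply/ppoP; have /ppoP [tr rf] := pd2; split=> [v u z|u v]; rewrite !E.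
      exact: tr.
    exact: rf.
  - by move=> u v _ _; rewrite E !rev_ordK.
  - by move=> v _; exists (rev_ord v); rewrite rev_ordK !JE ffunE /= !eqxx.
have -> : join2 e1 e2 x y false false = diag [set: 'I_m.+2].
  by apply/ffunP => -[u v]; rewrite JE ffunE !inE /= orbF andbT.
have -> : wr (join2 e1 e2 x y true true) = wr e1.
  apply/esym/(wr_eq nu (g := id)); first exact: ppo_diag.
  - apply/ppoP; split=> [v u z|u v]; rewrite !JE !xpair_eqE /= ?eqxx //.
    case: (u =P v) => [->//|_] /= /orP [] /andP [/eqP -> /eqP ->];
      rewrite ?eqxx /= ?[y == x]eq_sym ?(negbTE nxy) ?orbF ?andbT /= => /orP [/eqP <-|/eqP ->];
      by rewrite ?eqxx ?orbT.
  - move=> u v; rewrite !d1 !eqxx /= => uy vy.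
    by rewrite JE uy !xpair_eqE (negbTE uy) (negbTE vy) !andbF /= !orbF andbT.
  - move=> v _; have [->|vy] := eqVneq v y.
      by exists x; rewrite d1 !JE !eqxx ?orbT nxy.
    by exists v; rewrite d1 JE !eqxx vy.
rewrite J10 -/(antichain_weight m.+2) W1; ring.
Qed.

(** The recursion of the antichain weights in multiplicative form: when no weight
    vanishes, the quotients of successive weights form an arithmetic
    progression. *)
Lemma lin_rec (a : nat -> k) (v d : k) :
  (forall m, a m = 0 -> a m.+1 = 0) -> a 1 = a 0 * v ->
  (forall m, a m.+1 ^+ 2 = a m * (a m.+2 - d * a m.+1)) ->
  forall m, a m.+1 = a m * (v + d *+ m).
Proof.
move=> a0 a1 ar; elim=> [|m IHm]; first by rewrite mulr0n addr0.
have [am|am] := eqVneq (a m) 0; first by rewrite (a0 _ (a0 _ am)) (a0 _ am) mul0r.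
apply: (mulfI am); apply/(addIr (- (a m * (d * a m.+1)))).
rewrite -mulrBr -ar expr2 {1}IHm mulrS; ring.
Qed.

Definition eval_t (h : {poly int}) : k := (map_poly intr h).[t].

(** The falling factorials for [eps = -1], the rising ones for [eps = 1]. *)
Definition rising (eps : int) (n : nat) : {poly int} :=
  \prod_(j < n) ('X + (eps *+ j)%:P).

Lemma eval_tM g h : eval_t (g * h) = eval_t g * eval_t h.
Proof. by rewrite /eval_t rmorphM hornerM. Qed.

Lemma eval_tN h : eval_t (- h) = - eval_t h.
Proof. by rewrite /eval_t rmorphN hornerN. Qed.

Lemma eval_t1 : eval_t 1 = 1.
Proof. by rewrite /eval_t rmorph1 hornerC. Qed.

Lemma risingS eps n : rising eps n.+1 = rising eps n * ('X + (eps *+ n)%:P).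
Proof. by rewrite /rising big_ord_recr. Qed.

Lemma eval_t_risingS eps n :
  eval_t (rising eps n.+1) = eval_t (rising eps n) * (t + eps%:~R *+ n).
Proof.
rewrite risingS eval_tM; congr (_ * _).
by rewrite /eval_t rmorphD /= map_polyX map_polyC /= hornerD hornerX hornerC rmorphMn.
Qed.

Lemma rising_dvd eps m n : (m <= n)%N -> exists g, rising eps n = rising eps m * g.
Proof.
move=> /subnKC <-; elim: (n - m)%N => [|d [g IH]].
  by exists 1; rewrite addn0 mulr1.
by rewrite addnS risingS IH -mulrA; eexists.
Qed.

Definition antichain (P : fposet) (A : {set P}) : Prop :=
  forall u v, u \in A -> v \in A -> (u <= v)%O -> u = v.

(** What the reduction modulo a prime [p] needs: an integer polynomial giving the
    weight, that vanishes modulo [p] on integers when [A] contains an antichain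
    with [p] elements. *)
Definition divisible (eps : int) (P : fposet) (A : {set P}) : Prop :=
  exists2 h, wr (sub_le A) = eval_t h &
    forall Y : {set P}, Y \subset A -> antichain Y -> exists g, h = rising eps #|Y| * g.

Section Subsets.
Variable P : fposet.
Implicit Types A B : {set P}.

Lemma divisible_zero eps A : wr (sub_le A) = 0 -> divisible eps A.
Proof.
move=> w0; exists 0; first by rewrite w0 /eval_t rmorph0 horner0.
by move=> Y _ _; exists 0; rewrite mulr0.
Qed.

Lemma divisible_antichain eps A c : antichain A -> antichain_weight #|A| = eval_t (rising eps #|A| * c) ->
  divisible eps A.
Proof.
move=> anA wA; exists (rising eps #|A| * c).
  rewrite -wA -wr_diag; congr wr; apply/ffunP => -[u v]; rewrite !ffunE /=.
  have [<-|nuv] := eqVneq u v; first by rewrite lexx andbT andbb.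
  apply/negP => /and3P [uA vA] /(anA _ _ uA vA) E.
  by rewrite E eqxx in nuv.
move=> Y YA _; have [g ->] := rising_dvd eps (subset_leq_card YA).
by exists (g * c); rewrite mulrA.
Qed.

Lemma antichain_dec A : antichain A \/ exists x y, [/\ x \in A, y \in A & (x < y)%O].
Proof.
have [/existsP [x /existsP [y /and3P [xA yA xy]]]|nx] :=
  boolP [exists x, exists y, [&& x \in A, y \in A & (x < y)%O]].
  by right; exists x, y.
left=> u v uA vA uv; apply/eqP; apply: contraNT nx => nuv.
apply/existsP; exists u; apply/existsP; exists v.
by rewrite uA vA lt_neqAle nuv uv.
Qed.

Lemma exists_minimal A x : x \in A ->
  exists2 b, b \in A & forall z, z \in A -> ~~ (z < b)%O.
Proof.
move=> xA; case: (arg_minnP (fun z : P => #|[set u in A | (u < z)%O]|) xA) => b bA bm.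
exists b => // z zA; apply/negP => zb.
have := bm z zA; rewrite leqNgt => /negP; apply; apply: proper_card.
apply/properP; split.
  by apply/subsetP => u; rewrite !inE => /andP [-> uz]; apply: lt_trans uz zb.
by exists z; rewrite !inE ?zA // ltxx andbF.
Qed.

Lemma exists_maximal A x : x \in A ->
  exists2 b, b \in A & forall z, z \in A -> ~~ (b < z)%O.
Proof.
move=> xA; case: (arg_minnP (fun z : P => #|[set u in A | (z < u)%O]|) xA) => b bA bm.
exists b => // z zA; apply/negP => zb.
have := bm z zA; rewrite leqNgt => /negP; apply; apply: proper_card.
apply/properP; split.
  by apply/subsetP => u; rewrite !inE => /andP [-> uz]; apply: lt_trans zb uz.
by exists z; rewrite !inE ?zA // ltxx andbF.
Qed.

Lemma wr_point (x : P) : wr (sub_le [set x]) = t.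
Proof.
apply/esym/(wr_eq nu (g := fun _ : 'I_4 => x)).
- by rewrite list_rel_ppo.
- exact: ppo_sub_le.
- move=> u v; rewrite !ffunE /= !inE eqxx lexx /= !xpair_eqE !andbb.
  by move=> /eqP -> /eqP ->.
- move=> v; rewrite sub_le_refl inE => /eqP ->; exists ord0.
  by rewrite !ffunE /= !inE !eqxx lexx.
Qed.

Lemma wr_pair (x y : P) : (x < y)%O -> wr (sub_le [set x; y]) = lw lchain2.
Proof.
move=> xy; have nxy : x != y by rewrite lt_eqF.
have yx : (y <= x)%O = false by rewrite lt_geF.
apply/esym/(wr_eq nu (g := fun u : 'I_4 => if u == ord0 then x else y)).
- by rewrite list_rel_ppo.
- exact: ppo_sub_le.
- move=> [[|[|u]] u4] [[|[|v]] v4]; rewrite !ffunE //= !inE //= => _ _;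
    by rewrite ?eqxx ?lexx ?orbT //= ?(ltW xy) ?yx.
- move=> v; rewrite sub_le_refl !inE => /orP [] /eqP ->.
    by exists ord0; rewrite !ffunE /= !inE !eqxx lexx.
  have h : (1 < 4)%N by [].
  by exists (Ordinal h); rewrite !ffunE /= !inE !eqxx lexx orbT.
Qed.

(** Chains have weight zero: the measure behaves like counting in a set with [t]
    elements. *)
Lemma divisible_sets A : lw lchain2 = 0 -> divisible (-1) A.
Proof.
move=> c0; have [anA|[x [y [xA yA xy]]]] := antichain_dec A; last first.
  apply: divisible_zero; apply: (wr_chain0 (x := x) (y := y)) => //.
  - exact: ppo_sub_le.
  - by rewrite ffunE /= xA yA ltW.
  - by rewrite ffunE /= xA yA lt_geF.
apply: (divisible_antichain (c := 1)) => //; rewrite mulr1.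
elim: #|A| => [|n IH]; first by rewrite antichain_weight0 /rising big_ord0 eval_t1.
rewrite eval_t_risingS -IH; apply: lin_rec => [m||m].
- exact: antichain_weight_mono.
- by rewrite antichain_weight0 mul1r antichain_weight1.
rewrite antichain_weight_rec (_ : wr (diag2 m) = 0); first by rewrite rmorphN1; ring.
apply: (wr_chain0 (x := ord0) (y := ord_max)) => //.
- exact: ppo_diag2.
- by rewrite ffunE /= ?eqxx ?orbT.
- by rewrite ffunE /= ?xpair_eqE.
Qed.

(** The posets of nonzero weight are weak orders.  The weight of a weak order is
    the product of the weights of its lowest block [B] and of the rest [R]: a
    relation [b < c] between one point of each determines all the others. *)
Lemma divisible_weak_orders A : t != 0 -> lw lchain_point = 0 -> lw lchain2 = t ^+ 2 ->
  lw lantichain2 = - t - t ^+ 2 -> divisible 1 A.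
Proof.
move=> t0 n0 c2 a2.
have [n] := ubnP #|A|; elim: n A => // n IHn A ltA.
have [anA|[x [y [xA yA xy]]]] := antichain_dec A.
  apply: (divisible_antichain (c := (if #|A| == 0%N then 1 else (-1) ^+ #|A|.-1))) => //.
  case: #|A| => [|m] /=; first by rewrite antichain_weight0 /rising big_ord0 mulr1 eval_t1.
  elim: m => [|m IH].
    by rewrite expr0 mulr1 antichain_weight1 eval_t_risingS /rising big_ord0 eval_t1 mul1r addr0.
  have -> : antichain_weight m.+2 = antichain_weight m.+1 * ((- t - 1) + (-1) *+ m).
    apply: (lin_rec (a := fun m => antichain_weight m.+1)) => {m IH} [m||m].
    - exact: antichain_weight_mono.
    - rewrite antichain_weight2 antichain_weight1 a2; ring.
    rewrite antichain_weight_rec (_ : wr (diag2 m.+1) = 0); first by ring.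
    apply/eqP; apply: contraTT isT => nz.
    have h1 : (1 < m.+3)%N by [].
    have := @wr_weak _ (diag2 m.+1) ord0 ord_max (Ordinal h1) (ppo_diag2 _) n0 nz.
    by rewrite !ffunE /= !xpair_eqE /= eqxx => /(_ isT isT isT).
  rewrite IH eval_tM eval_tM eval_t_risingS [eval_t (rising 1 m.+2)]eval_t_risingS eval_t_risingS.
  rewrite exprS mulN1r eval_tN rmorph1 -[_ *+ m.+1]mulr_natr mulrSr.
  rewrite -mulr_natr; ring.
have [wA|wA] := eqVneq (wr (sub_le A)) 0; first exact: divisible_zero.
have weak u v z : u \in A -> v \in A -> z \in A -> (u < v)%O -> (u < z)%O || (z < v)%O.
  move=> uA vA zA uv.
  have := @wr_weak _ (sub_le A) u v z (ppo_sub_le A) n0 wA.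
  rewrite !ffunE /= uA vA zA (ltW uv) lexx (lt_geF uv) /= => /(_ isT isT isT).
  by rewrite !lt_leAnge.
(* the lowest block *)
pose B := [set b in A | [forall z, (z \in A) ==> ~~ (z < b)%O]].
have Bmin b z : b \in B -> z \in A -> (z < b)%O = false.
  rewrite inE => /andP [_ /forallP /(_ z)] /implyP h zA.
  exact/negbTE/h.
have BA : B \subset A by apply/subsetP => u; rewrite inE => /andP [].
pose R := A :\: B.
have RA : R \subset A by apply: subsetDl.
have BR b z : b \in B -> z \in R -> (b < z)%O.
  move=> bB; rewrite !inE negb_and => /andP [+ zA]; rewrite zA /= negb_forall.
  case/existsP=> u; rewrite negb_imply negbK => /andP [uA uz].
  have := weak u z b uA zA (subsetP BA _ bB) uz.
  by rewrite (Bmin _ _ bB).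
have [b bA bm] := exists_minimal xA.
have bB : b \in B by rewrite inE bA /=; apply/forallP => z; apply/implyP => /bm.
have yR : y \in R.
  rewrite !inE yA andbT /=; apply/forallPn; exists x.
  by rewrite xA xy.
have [c cR cm] := exists_minimal yR.
have nbR : b \notin R by rewrite in_setD bB.
have disjBR u : u \in B -> u \in R = false by rewrite in_setD => ->.
have step1 : wr (sub_le B) * wr (sub_le (b |: R)) = t * wr (sub_le A).
  rewrite w_factor; last first.
    move=> e pe ne eB eR u v uB uR vR vB.
    have vR' : v \in R.
      by move: vR; rewrite in_setU1 => /orP [/eqP E|//]; rewrite E bB in vB.
    have bv := BR _ _ bB vR'.
    have uv := BR _ _ uB vR'.
    have ebv : e (b, v) by rewrite eR ?(ltW bv) // in_setU1 eqxx.
    have evb : ~~ e (v, b) by rewrite eR ?(lt_geF bv) // in_setU1 eqxx.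
    have euu : e (u, u) by rewrite eB.
    have := @wr_weak _ e b v u pe n0 ne ebv evb euu.
    have nbu : (b <= u)%O && ~~ (u <= b)%O = false.
      by rewrite -lt_leAnge (Bmin _ _ uB).
    rewrite (eB b u) // (eB u b) // nbu /=.
    by case/andP=> -> /negbTE ->; rewrite ltW // lt_geF.
  congr (_ * _).
    rewrite -(wr_point b); congr (wr (sub_le _)); apply/setP => u; rewrite in_setI in_setU1 in_set1.
    case: (u =P b) => [->|_]; first by rewrite bB.
    by apply/negP => /andP [/disjBR ->].
  congr (wr (sub_le _)); apply/setP => u; rewrite in_setU in_setU1 in_setD.
  case: (u =P b) => [->|_]; rewrite ?bB ?bA //=.
  by case uB: (u \in B); rewrite //= (subsetP BA _ uB).
have step2 : lw lchain2 * wr (sub_le R) = t * wr (sub_le (b |: R)).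
  have bc := BR _ _ bB cR.
  rewrite -(wr_pair bc) w_factor; last first.
    move=> e pe ne eB eR u v ubc uR vR vbc.
    have ub : u = b.
      by move: ubc; rewrite !in_set2 => /orP [/eqP //|/eqP E]; rewrite E cR in uR.
    subst u; have bv := BR _ _ bB vR.
    have ebc : e (b, c) by rewrite eB ?(ltW bc) // in_set2 eqxx ?orbT.
    have ecb : ~~ e (c, b) by rewrite eB ?(lt_geF bc) // in_set2 eqxx ?orbT.
    have evv : e (v, v) by rewrite eR.
    have := @wr_weak _ e b c v pe n0 ne ebc ecb evv.
    have nvc : (v <= c)%O && ~~ (c <= v)%O = false.
      by rewrite -lt_leAnge (negbTE (cm _ vR)).
    rewrite (eR v c) // (eR c v) // nvc orbF.
    by case/andP=> -> /negbTE ->; rewrite ltW // lt_geF.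
  congr (_ * _).
    rewrite -(wr_point c); congr (wr (sub_le _)); apply/setP => u; rewrite in_setI in_set2 in_set1.
    case: (u =P c) => [->|_]; first by rewrite orbT cR.
    by rewrite orbF; apply/negP => /andP [/eqP -> h]; rewrite h in nbR.
  congr (wr (sub_le _)); apply/setP => u; rewrite in_setU in_set2 in_setU1.
  by case: (u =P c) => [->|_]; rewrite ?cR ?orbT ?orbF.
have wABR : wr (sub_le A) = wr (sub_le B) * wr (sub_le R).
  apply: (mulfI t0); rewrite -step1.
  have -> : wr (sub_le (b |: R)) = t * wr (sub_le R).
    by apply: (mulfI t0); rewrite -step2 c2 expr2 mulrA.
  ring.
have cB : (#|B| < #|A|)%N.
  apply: proper_card; apply/properP; split=> //; exists y => //.
  by move: yR; rewrite in_setD => /andP [].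
have cRA : (#|R| < #|A|)%N.
  by apply: proper_card; apply/properP; split=> //; exists b.
have [hB wB aB] := IHn B (leq_trans cB ltA).
have [hR wR aR] := IHn R (leq_trans cRA ltA).
exists (hB * hR); first by rewrite eval_tM wABR wB wR.
move=> Y YA anY.
have [YR|/subsetPn [u uY uR]] := boolP (Y \subset R).
  by have [g ->] := aR Y YR anY; exists (hB * g); ring.
have uB : u \in B by move: uR; rewrite in_setD (subsetP YA _ uY) andbT negbK.
have YB : Y \subset B.
  apply/subsetP => v vY; apply: contraT => vB.
  have vR : v \in R by rewrite in_setD vB (subsetP YA).
  have uv := BR _ _ uB vR; have E := anY _ _ uY vY (ltW uv).
  by rewrite E ltxx in uv.
by have [g ->] := aB Y YB anY; exists (g * hR); ring.
Qed.

(** Glue a chain with two elements to an antichain along the bottom of the chain: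
    as comparability is an equivalence relation, the top of the chain is
    unrelated to the rest of the antichain. *)
Lemma wr_diag2_chains m : t != 0 -> lw lV = 0 -> lw llambda = 0 -> lw lchain2 = - t ->
  wr (diag2 m) = - antichain_weight m.+1.
Proof.
move=> t0 v0 l0 c2; pose x : 'I_m.+2 := ord0; pose y : 'I_m.+2 := ord_max.
have nxy : x != y by [].
pose e2 : brel 'I_m.+2 := [ffun uv => [|| uv == (x, x), uv == (y, y) | uv == (x, y)]].
have e2E u v : e2 (u, v) = [|| (u == x) && (v == x), (u == y) && (v == y) | (u == x) && (v == y)].
  by rewrite ffunE !xpair_eqE.
have p2 : ppo e2.
  apply/ppoP; split=> [v u z|u v]; rewrite !e2E.
    case/or3P=> /andP [/eqP -> /eqP ->]; rewrite ?eqxx ?(negbTE nxy) ?orbT //=;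
      rewrite ?[y == x]eq_sym ?(negbTE nxy) /= ?orbF => // /eqP ->; rewrite eqxx ?orbT //.
  by case/or3P=> /andP [/eqP -> /eqP ->]; rewrite !eqxx ?orbT.
have w2 : wr e2 = lw lchain2.
  apply/esym/(wr_eq nu (g := fun u : 'I_4 => if u == ord0 then x else y)) => //.
  - by rewrite list_rel_ppo.
  - move=> [[|[|u]] u4] [[|[|v]] v4]; rewrite !e2E !ffunE //= => _ _;
      by rewrite ?eqxx.
  - move=> v; rewrite e2E => /or3P [] /andP [/eqP -> _].
    + by exists ord0; rewrite !e2E !ffunE /= ?eqxx ?orbT.
    + have h : (1 < 4)%N by [].
      by exists (Ordinal h); rewrite !e2E !ffunE /= ?eqxx ?orbT.
    + by exists ord0; rewrite !e2E !ffunE /= ?eqxx ?orbT.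
pose e1 := diag [set~ y].
have d1 u v : e1 (u, v) = (u == v) && (u != y) by rewrite ffunE /= !inE.
have W1 : wr e1 = antichain_weight m.+1 by rewrite wr_diag cardsC1 card_ord.
have dd u v : diag2 m (u, v) = (u == v) || ((u == x) && (v == y)).
  by rewrite ffunE /= xpair_eqE.
have dxy u : (u == x) && (u == y) = false.
  by apply/negP => /andP [/eqP ->]; rewrite (negbTE nxy).
have mE : meet e1 e2 = diag [set x].
  apply/ffunP => -[u v]; rewrite ffunE d1 e2E ffunE /= in_set1.
  case: (u =P v) => //= <-; rewrite !andbb dxy orbF.
  by case: (u =P x) => [->|_]; rewrite ?nxy //; case: (u == y).
apply: (mulfI t0); rewrite mulrN -mulNr -c2 -w2 -W1 mulrC.
rewrite [RHS]mulrC (@wr_glue_uniq _ nu _ e1 e2 (diag2 m)) //.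
- by rewrite mE wr_diag cards1 antichain_weight1 mulrC.
- exact: ppo_diag.
- apply/glueP; split; first exact: ppo_diag2.
  + move=> u v; rewrite !d1 !eqxx /= => uy vy.
    by rewrite dd (negbTE vy) andbF orbF uy andbT.
  + move=> u v; rewrite !e2E dd !dxy !orbF !andbb => /orP [] /eqP -> /orP [] /eqP ->;
      by rewrite !eqxx /= ?orbT // [y == x]eq_sym (negbTE nxy) !andbF.
  + by move=> u _; rewrite d1 e2E eqxx /= !andbb dxy orbF; case: (u == y); rewrite ?orbT.
move=> e /glueP [pe g1 g2 g3] ne; have /ppoP [tr rf] := pe.
have exy : e (x, y) by rewrite g2 ?e2E ?eqxx ?orbT.
have exv v : v != x -> v != y -> e (x, v) = false.
  by move=> vx vy; rewrite g1 ?d1 ?eqxx // eq_sym (negbTE vx).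
have evx v : v != x -> v != y -> e (v, x) = false.
  by move=> vx vy; rewrite g1 ?d1 ?eqxx // (negbTE vx).
have evy v : v != x -> v != y -> e (v, y) = false.
  move=> vx vy; apply/negP => vey.
  have := @wr_down_comparable _ e y v x pe l0 ne vey exy.
  by rewrite exv // evx.
have eyv v : v != x -> v != y -> e (y, v) = false.
  by move=> vx vy; apply/negP => /(tr _ _ _ exy); rewrite exv.
apply/ffunP => -[u v]; rewrite dd.
have [->|uy] := eqVneq u y.
  rewrite [y == x]eq_sym (negbTE nxy) /= orbF.
  have [->|vx] := eqVneq v x; first by rewrite g2 ?e2E ?eqxx ?[y == x]eq_sym ?(negbTE nxy) ?orbT.
  have [->|vy] := eqVneq v y; first by rewrite g2 ?e2E ?eqxx ?orbT.
  by rewrite eyv.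
have [->|vy] := eqVneq v y.
  rewrite (negbTE uy) andbT /=; have [->|ux] := eqVneq u x; first by rewrite exy.
  by rewrite evy.
by rewrite andbF orbF g1 ?d1 ?eqxx // uy andbT.
Qed.

(** The posets of nonzero weight are disjoint unions of chains.  Deleting the top
    [y] of a chain with at least two elements changes only the sign of the weight,
    since the position of [y] is determined by the element [x] just below it. *)
Lemma divisible_chains A : t != 0 -> lw lV = 0 -> lw llambda = 0 -> lw lchain2 = - t -> divisible 1 A.
Proof.
move=> t0 v0 l0 c2.
have [n] := ubnP #|A|; elim: n A => // n IHn A ltA.
have [anA|[x0 [y0 [xA yA xy]]]] := antichain_dec A.
  apply: (divisible_antichain (c := 1)) => //; rewrite mulr1.
  elim: #|A| => [|m IH]; first by rewrite antichain_weight0 /rising big_ord0 eval_t1.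
  rewrite eval_t_risingS -IH; apply: lin_rec => {m IH} [m||m].
  - exact: antichain_weight_mono.
  - by rewrite antichain_weight0 mul1r antichain_weight1.
  rewrite antichain_weight_rec (_ : wr (diag2 m) = - antichain_weight m.+1); first by rewrite rmorph1; ring.
  exact: wr_diag2_chains.
have [wA|wA] := eqVneq (wr (sub_le A)) 0; first exact: divisible_zero.
have pA := ppo_sub_le A.
have up u v z : u \in A -> v \in A -> z \in A -> (u <= v)%O -> (u <= z)%O ->
    (v <= z)%O || (z <= v)%O.
  move=> uA vA zA uv uz.
  have := @wr_up_comparable _ (sub_le A) u v z pA v0 wA.
  by rewrite !ffunE /= uA vA zA uv uz => /(_ isT isT).
have dn u v z : u \in A -> v \in A -> z \in A -> (v <= u)%O -> (z <= u)%O ->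
    (v <= z)%O || (z <= v)%O.
  move=> uA vA zA uv uz.
  have := @wr_down_comparable _ (sub_le A) u v z pA l0 wA.
  by rewrite !ffunE /= uA vA zA uv uz => /(_ isT isT).
(* y is maximal among the elements that are not minimal, x is maximal below y *)
pose A1 := [set z in A | [exists u, (u \in A) && (u < z)%O]].
have y1 : y0 \in A1 by rewrite inE yA; apply/existsP; exists x0; rewrite xA.
have [y yA1 ym1] := exists_maximal y1.
have {}yA : y \in A by move: yA1; rewrite inE => /andP [].
have ym z : z \in A -> (y < z)%O = false.
  move=> zA; apply/negP => yz; have := ym1 z; rewrite inE zA yz => /(_ _)/negP.
  by apply=> //; apply/existsP; exists y; rewrite yA.
have [x1 x1y] : exists x, x \in [set z in A | (z < y)%O].
  move: yA1; rewrite inE => /andP [_ /existsP [u /andP [uA uy]]].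
  by exists u; rewrite inE uA.
have [x xy1 xm1] := exists_maximal x1y.
have {}xA : x \in A by move: xy1; rewrite inE => /andP [].
have {}xy : (x < y)%O by move: xy1; rewrite inE => /andP [].
have xm z : z \in A -> (x < z)%O -> (z < y)%O = false.
  by move=> zA xz; apply/negP => zy; have := xm1 z; rewrite inE zA zy xz => /(_ isT).
have nxz z : z \in A -> z != y -> (x < z)%O = false.
  move=> zA zy; apply/negP => xz.
  have := up x y z xA yA zA (ltW xy) (ltW xz).
  rewrite [(y <= z)%O]le_eqVlt (ym _ zA) orbF eq_sym (negbTE zy) /=.
  by rewrite le_eqVlt (negbTE zy) (xm _ zA xz).
have step : lw lchain2 * wr (sub_le (A :\ y)) = t * wr (sub_le A).
  rewrite -(wr_pair xy) w_factor; last first.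
    move=> e pe ne e1 e2 u v uxy uAy vAy vxy.
    have uy : u = y.
      move: uxy; rewrite in_set2 => /orP [/eqP E|/eqP //].
      by move: uAy; rewrite E in_setD1 xA lt_eqF.
    subst u; move: (vAy); rewrite in_setD1 => /andP [vy vA].
    have vx : v != x by apply: contraNneq vxy => ->; rewrite in_set2 eqxx.
    have xAy : x \in A :\ y by rewrite in_setD1 xA lt_eqF.
    have /ppoP [tr _] := pe.
    have exy : e (x, y) by rewrite e1 ?in_set2 ?eqxx ?orbT // ltW.
    have yv : (y <= v)%O = false by rewrite le_eqVlt eq_sym (negbTE vy) ym.
    have nexv : e (x, v) = false.
      by rewrite e2 // le_eqVlt eq_sym (negbTE vx) nxz.
    split; first by rewrite yv; apply/negP => /(tr _ _ _ exy); rewrite nexv.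
    apply/idP/idP => [evy|vley].
      have := @wr_down_comparable _ e y v x pe l0 ne evy exy.
      by rewrite nexv orbF e2 // => vlex; apply: le_trans vlex (ltW xy).
    have := dn y v x yA vA xA vley (ltW xy).
    rewrite [(x <= v)%O]le_eqVlt eq_sym (negbTE vx) nxz // !orbF => vlex.
    by apply: (tr x v y _ exy); rewrite e2.
  congr (_ * _).
    rewrite -(wr_point x); congr (wr (sub_le _)); apply/setP => u.
    rewrite in_setI in_set2 in_setD1 in_set1.
    case: (u =P x) => [->|_]; first by rewrite xA lt_eqF.
    by case: (u =P y).
  congr (wr (sub_le _)); apply/setP => u; rewrite in_setU in_set2 in_setD1.
  case: (u =P x) => [->|_]; first by rewrite xA.
  by case: (u =P y) => [->|].
have wAy : wr (sub_le A) = - wr (sub_le (A :\ y)).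
  by apply: (mulfI t0); rewrite -step c2 mulNr mulrN.
have cA : (#|A :\ y| < n)%N.
  by move: ltA; rewrite (cardsD1 y) yA.
have [h wh ah] := IHn _ cA.
exists (- h); first by rewrite eval_tN wAy wh.
move=> Y YA anY.
have [yY|yY] := boolP (y \in Y); last first.
  have [|g ->] := ah Y _ anY; last by exists (- g); rewrite mulrN.
  by apply/subsetP => u uY; rewrite in_setD1 (subsetP YA) // andbT; apply: contraNneq yY => <-.
have xY : x \notin Y.
  by apply/negP => xY; have E := anY _ _ xY yY (ltW xy); rewrite E ltxx in xy.
have [||g ->] := ah (x |: (Y :\ y)).
- apply/subsetP => u; rewrite in_setU1 !in_setD1 => /orP [/eqP ->|/andP [-> /(subsetP YA) ->]] //.
  by rewrite xA lt_eqF.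
- have key u : u \in Y -> u != y -> ~~ (x <= u)%O && ~~ (u <= x)%O.
    move=> uY uy; have uA := subsetP YA _ uY.
    rewrite le_eqVlt nxz // orbF; apply/andP; split.
      by apply: contraNneq xY => ->.
    apply/negP => ux; have E := anY _ _ uY yY (le_trans ux (ltW xy)).
    by rewrite E eqxx in uy.
  move=> u v; rewrite !in_setU1 !in_setD1.
  case/orP=> [/eqP ->|/andP [uy uY]] /orP [/eqP ->|/andP [vy vY]] //.
  + by have /andP [/negbTE ->] := key _ vY vy.
  + by have /andP [_ /negbTE ->] := key _ uY uy.
  + exact: anY.
- exists (- g); rewrite mulrN; congr (- (rising _ _ * _)).
  by rewrite cardsU1 in_setD1 (negbTE xY) andbF (cardsD1 y Y) yY.
Qed.

End Subsets.

Lemma weight_poly : exists eps : int, (eps = 1 \/ eps = -1) /\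
  forall (P : fposet), exists2 h, w P = eval_t h &
    forall Y : {set P}, antichain Y -> exists g, h = rising eps #|Y| * g.
Proof.
suff [eps [e1 h]] : exists eps : int, (eps = 1 \/ eps = -1) /\
    forall (P : fposet) (A : {set P}), divisible eps A.
  exists eps; split=> // P; have [g wg ag] := h P [set: P].
  by exists g; [rewrite -wg wr_full | move=> Y; apply: ag; apply: subsetT].
have [t0|t0] := eqVneq t 0.
  exists 1; split; first by left.
  move=> P A; have [->|[x xA]] := set_0Vmem A.
    apply: (divisible_antichain (c := 1)); first by move=> u v; rewrite inE.
    by rewrite cards0 antichain_weight0 mulr1 /rising big_ord0 eval_t1.
  by apply: divisible_zero; apply: (wr_t0 (x := x)); rewrite ?ppo_sub_le ?sub_le_refl.
have [c0|[n0 c2 a2]|[v0 l0 c2 _]] := trichotomy t0.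
- by exists (-1); split=> [|P A]; [right | apply: divisible_sets].
- by exists 1; split=> [|P A]; [left | apply: divisible_weak_orders].
- by exists 1; split=> [|P A]; [left | apply: divisible_chains].
Qed.
End WeightPolynomials.

(** * Specialization to positive characteristic *)

Section Extension.

(** The subring generated by a ring and one more element is handled as the image
    of a polynomial ring, so that homomorphisms out of it need no explicit
    presentation: they are the homomorphisms out of the polynomial ring that
    satisfy [factors]. *)
Definition eval_at (R F : comNzRingType) (eps : {rmorphism R -> F}) (y : F) :
  {rmorphism {poly R} -> F} := (horner_eval y \o map_poly eps : {rmorphism _ -> _}).

Lemma eval_atE (R F : comNzRingType) (eps : {rmorphism R -> F}) y P :
  eval_at eps y P = (map_poly eps P).[y].
Proof. by []. Qed.

Lemma eval_atC (R F : comNzRingType) (eps : {rmorphism R -> F}) y c :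
  eval_at eps y c%:P = eps c.
Proof. by rewrite eval_atE map_polyC hornerC. Qed.

Lemma eval_atX (R F : comNzRingType) (eps : {rmorphism R -> F}) y :
  eval_at eps y 'X = y.
Proof. by rewrite eval_atE map_polyX hornerX. Qed.

Definition factors (R F K : comNzRingType) (eps : {rmorphism R -> F})
    (psi : {rmorphism R -> K}) : Prop :=
  forall r, eps r = 0 -> psi r = 0.

Lemma factors_map (R F K : comNzRingType) (eps : {rmorphism R -> F})
    (psi : {rmorphism R -> K}) P :
  factors eps psi -> map_poly eps P = 0 -> map_poly psi P = 0.
Proof.
move=> ep /polyP P0; apply/polyP => i; rewrite coef_map coef0.
by apply: ep; have := P0 i; rewrite coef_map coef0.
Qed.

Lemma min_measure (T : Type) (S : T -> Prop) (m : T -> nat) :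
  (exists h, S h) -> exists2 h, S h & forall g, S g -> (m h <= m g)%N.
Proof.
move=> [h]; have [n] := ubnP (m h); elim: n h => // n IH h mh Sh.
have [[g [Sg lt]]|no] := classic (exists g, S g /\ (m g < m h)%N).
  by apply: IH Sg; apply: leq_trans lt _.
exists h => // g Sg; rewrite leqNgt; apply/negP => lt; apply: no.
by exists g.
Qed.

(** Removes the leading coefficients that are killed by [eps]. *)
Lemma trim (R : comNzRingType) (F : comNzRingType) (eps : {rmorphism R -> F}) (P : {poly R}) :
  exists2 Q : {poly R}, map_poly eps Q = map_poly eps P & size Q = size (map_poly eps P).
Proof.
pose n := size (map_poly eps P).
exists (\poly_(i < n) P`_i).
  apply/polyP => i; rewrite !coef_map coef_poly; case: ifP => // ni.
  by rewrite raddf0 -coef_map nth_default // leqNgt -/n ni.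
have [n0|n0] := posnP n.
  rewrite -/n n0; apply/eqP; rewrite -leqn0.
  exact: size_poly.
apply: size_poly_eq; apply: contraTneq isT => P0.
have : lead_coef (map_poly eps P) != 0.
  by rewrite lead_coef_eq0 -size_poly_eq0 -/n -lt0n.
by rewrite lead_coefE -/n coef_map /= P0 raddf0 eqxx.
Qed.

Section Step.
Variables (k : fieldType) (R : comNzRingType) (eps : {rmorphism R -> k}) (y : k).
Variable a : {poly R}.
Hypothesis a0 : eval_at eps y a != 0.
Notation "P ^e" := (map_poly eps P) (at level 2, format "P ^e").

Lemma lead_trim (P : {poly R}) : P^e != 0 -> size P = size P^e -> eps (lead_coef P) != 0.
Proof.
move=> P0 sP; have : lead_coef P^e != 0 by rewrite lead_coef_eq0.
by rewrite !lead_coefE -sP coef_map.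
Qed.

Lemma pseudo_div (P Q : {poly R}) :
  exists n (U V : {poly R}), lead_coef Q ^+ n *: P = U * Q + V
    /\ (Q != 0 -> (size V < size Q)%N).
Proof.
exists (Pdiv.Ring.rscalp P Q), (Pdiv.Ring.rdivp P Q), (Pdiv.Ring.rmodp P Q).
by rewrite Pdiv.ComRing.rdivp_eq Pdiv.Ring.ltn_rmodp.
Qed.

(** Extending a specialization [psi] to one more element [y] without killing the
    element [a].  If [y] is transcendental ([H = 0]), every image of [y] that is not
    a root of the image of [a] will do.  If [y] is algebraic, let [H] be an
    equation of minimal degree; every root of its image will do, provided that
    [psi] does not kill [d], the product of the leading coefficient of [H] and of
    a nonzero constant in the ideal generated by [H] and [a]. *)
Lemma extension_step :
  exists (d : R) (H : {poly R}), [/\ eps d != 0, H = 0 \/ (1 < size H)%N &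
    forall (K : fieldType) (psi : {rmorphism R -> K}),
      factors eps psi -> psi d != 0 ->
      [/\ H = 0 -> map_poly psi a != 0,
          size (map_poly psi H) = size H,
          forall y', root (map_poly psi H) y' ->
            factors (eval_at eps y) (eval_at psi y')
        & H != 0 -> forall y', root (map_poly psi H) y' -> eval_at psi y' a != 0]].
Proof.
have [[h0 [h0n h0y]]|no] := classic (exists h, h^e != 0 /\ h^e.[y] = 0); last first.
  have tr P : P^e.[y] = 0 -> P^e = 0.
    by move=> Py; apply/eqP/negP => /negP Pn; apply: no; exists P.
  have : a^e != 0 by apply: contraNneq a0 => ae; rewrite eval_atE ae horner0.
  rewrite -lead_coef_eq0 lead_coefE coef_map; set i := _.-1 => ai.
  exists a`_i, 0; split; [exact: ai | by left | move=> K psi ep pa; split].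
  - move=> _; apply: contraNneq pa => pa0.
    have := congr1 (fun P : {poly K} => P`_i) pa0; rewrite coef_map coef0 /=.
    by move=> ->.
  - by rewrite rmorph0 !size_poly0.
  - move=> y' _ P; rewrite !eval_atE => /tr /(factors_map ep) ->.
    by rewrite horner0.
  - by rewrite eqxx.
have [h1 [h1n h1y] hmin] := @min_measure _ (fun h => h^e != 0 /\ h^e.[y] = 0)
  (fun h => size h^e) (ex_intro _ h0 (conj h0n h0y)).
have [h he hs] := trim eps h1.
(* minimality is that of the degree over k, after removing coefficients that
   vanish in k; so every polynomial of smaller degree that kills y is zero in k *)
have {}hmin P : P^e != 0 -> P^e.[y] = 0 -> (size h <= size P^e)%N.
  by move=> Pn Py; rewrite hs; apply: hmin.
have hn : h^e != 0 by rewrite he.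
have hy : h^e.[y] = 0 by rewrite he.
have {}hs : size h = size h^e by rewrite he.
have lh := lead_trim hn hs.
pose S2 (g : {poly R}) := g^e != 0 /\ exists u v, g^e = (u * h + v * a)^e.
have a2 : S2 a.
  split; last by exists 0, 1; rewrite mul0r add0r mul1r.
  by apply: contraNneq a0 => ae; rewrite eval_atE ae horner0.
(* the element of minimal degree of the ideal generated by h and a, up to
   coefficients that vanish in k *)
have [g1 [g1n [u [v g1e]]] gmin] := @min_measure _ S2 (fun g => size g^e) (ex_intro _ a a2).
have [g ge gs] := trim eps g1.
have {}gmin P : S2 P -> (size g <= size P^e)%N by rewrite gs; apply: gmin.
have gn : g^e != 0 by rewrite ge.
have {}g1e : g^e = (u * h + v * a)^e by rewrite ge.
have {}gs : size g = size g^e by rewrite ge.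
have lg := lead_trim gn gs.
have g0 : g != 0 by apply: contraNneq gn => ->; rewrite rmorph0.
have h0' : h != 0 by apply: contraNneq hn => ->; rewrite rmorph0.
have gdiv P u1 v1 : P^e = (u1 * h + v1 * a)^e ->
    exists n (Q : {poly R}), eps (lead_coef g) ^+ n *: P^e = Q^e * g^e.
  move=> PE; have [n [Q [V [E sV]]]] := pseudo_div P g.
  have Ee : eps (lead_coef g) ^+ n *: P^e = Q^e * g^e + V^e.
    by rewrite -rmorphXn -map_polyZ E rmorphD rmorphM.
  exists n, Q; rewrite Ee [V^e](_ : _ = 0) ?addr0 //.
  apply/eqP; apply: contraT => Vn.
  have : (size g <= size V^e)%N.
    apply: gmin; split=> //.
    exists (lead_coef g ^+ n *: u1 - Q * u), (lead_coef g ^+ n *: v1 - Q * v).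
    have -> : V^e = eps (lead_coef g) ^+ n *: P^e - Q^e * g^e by rewrite Ee addrC addKr.
    rewrite PE g1e -rmorphXn -map_polyZ -rmorphM -rmorphB; congr map_poly.
    by rewrite -!mul_polyC; ring.
  move=> le; have := leq_trans (sV g0) le.
  by rewrite ltnNge size_poly.
have lgX n : eps (lead_coef g) ^+ n != 0 by rewrite expf_neq0.
have gy : g^e.[y] != 0.
  have [|n [Q E]] := gdiv a 0 1; first by rewrite mul0r add0r mul1r.
  apply: contraNneq a0 => gy; rewrite eval_atE.
  have := congr1 (horner^~ y) E; rewrite hornerZ hornerM gy mulr0 => /eqP.
  by rewrite mulf_eq0 (negbTE (lgX _)).
have sg : (size g <= 1)%N.
  have [|n [Q E]] := gdiv h 1 0; first by rewrite mul0r addr0 mul1r.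
  have Qn : Q^e != 0.
    apply: contraNneq hn => Q0; move: E; rewrite Q0 mul0r => /eqP.
    by rewrite scaler_eq0 (negbTE (lgX _)).
  have Qy : Q^e.[y] = 0.
    have := congr1 (horner^~ y) E; rewrite hornerZ hornerM hy mulr0 => /esym/eqP.
    by rewrite mulf_eq0 (negbTE gy) orbF => /eqP.
  have := congr1 (fun P : {poly k} => size P) E.
  rewrite size_scale // size_mul // -hs -gs => sE; have := hmin _ Qn Qy.
  rewrite sE; case: (size g) => [|[|m]] //.
  by rewrite addnS /= -[X in (_ <= X)%N]addn0 leq_add2l.
have gc := size1_polyC sg.
exists (lead_coef h * g`_0), h; split.
- by rewrite rmorphM mulf_neq0 //; apply: contraNneq gn => g00; rewrite gc map_polyC /= g00.
- by right; rewrite hs; apply: root_size_gt1 hn _; apply/eqP; exact: hy.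
move=> K psi ep; rewrite rmorphM mulf_eq0 negb_or => /andP [ph pg].
have ker P : P^e.[y] = 0 -> forall y', root (map_poly psi h) y' -> (map_poly psi P).[y'] = 0.
  move=> Py y' /eqP hy'; have [n [Q [V [E sV]]]] := pseudo_div P h.
  have Ve : V^e = 0.
    apply/eqP; apply: contraT => Vn.
    have : (size h <= size V^e)%N.
      apply: hmin => //.
      have -> : V^e = eps (lead_coef h) ^+ n *: P^e - Q^e * h^e.
        by rewrite -rmorphXn -map_polyZ E rmorphD rmorphM addrC addKr.
      by rewrite hornerD hornerN hornerM hornerZ Py hy !mulr0 subr0.
    move=> le; have := leq_trans (sV h0') le.
    by rewrite ltnNge size_poly.
  have := congr1 (fun P => (map_poly psi P).[y']) E.
  rewrite map_polyZ rmorphD rmorphM /= (factors_map ep Ve) addr0 hornerZ hornerM hy' mulr0.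
  by rewrite rmorphXn => /eqP; rewrite mulf_eq0 expf_eq0 (negbTE ph) andbF => /eqP.
split.
- by move=> h00; rewrite h00 eqxx in h0'.
- by rewrite size_map_poly_id0.
- by move=> y' ry P; rewrite !eval_atE => Py; apply: ker.
move=> _ y' ry; apply: contraNneq pg => ay.
have E0 : (u * h + v * a - g)^e = 0 by rewrite rmorphB /= -g1e subrr.
have := congr1 (horner^~ y') (factors_map ep E0).
rewrite rmorphB rmorphD !rmorphM /= hornerD hornerN hornerD !hornerM.
have ay' : (map_poly psi a).[y'] = 0 by exact: ay.
rewrite (eqP ry) ay' !mulr0 add0r horner0 gc map_polyC /= hornerC.
by move=> /eqP; rewrite sub0r oppr_eq0 coefC.
Qed.

End Step.

Section Generated.
Variable k : fieldType.

Fixpoint gen (R : comNzRingType) (eps : {rmorphism R -> k}) (xs : seq k) : k -> Prop :=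
  if xs is x :: xs' then gen (eval_at eps x) xs' else fun z => exists r, z = eps r.

Lemma gen_base R eps xs r : @gen R eps xs (eps r).
Proof.
elim: xs R eps r => [|x xs IH] R eps r /=; first by exists r.
by rewrite -(eval_atC eps x r).
Qed.

Lemma gen_mem R eps xs x : x \in xs -> @gen R eps xs x.
Proof.
elim: xs R eps => [|y xs IH] R eps //=; rewrite inE => /orP [/eqP ->|/IH //].
by rewrite -{2}(eval_atX eps y); apply: gen_base.
Qed.

Lemma gen_add R eps xs z z' : @gen R eps xs z -> gen eps xs z' -> gen eps xs (z + z').
Proof.
elim: xs R eps => [|y xs IH] R eps /=; last exact: IH.
by move=> [r ->] [r' ->]; exists (r + r'); rewrite rmorphD.
Qed.

Lemma gen_mul R eps xs z z' : @gen R eps xs z -> gen eps xs z' -> gen eps xs (z * z').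
Proof.
elim: xs R eps => [|y xs IH] R eps /=; last exact: IH.
by move=> [r ->] [r' ->]; exists (r * r'); rewrite rmorphM.
Qed.

(** A nonzero element [a] of a finitely generated domain survives in some
    homomorphism to a given algebraically closed field that extends a given
    homomorphism [psi] of the base ring, as long as [psi] does not kill a certain
    nonzero [d]. *)
Lemma specialize xs (R : comNzRingType) (eps : {rmorphism R -> k}) a :
  gen eps xs a -> a != 0 ->
  exists2 d, eps d != 0 & forall (K : closedFieldType) (psi : {rmorphism R -> K}),
    factors eps psi -> psi d != 0 ->
    exists phi : k -> K, [/\ forall r, phi (eps r) = psi r,
      forall z z', gen eps xs z -> gen eps xs z' -> phi (z + z') = phi z + phi z',
      forall z z', gen eps xs z -> gen eps xs z' -> phi (z * z') = phi z * phi z'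
      & phi a != 0].
Proof.
elim: xs R eps => [|x xs IH] R eps /= ga a0.
  have [r ar] := ga; exists r; first by rewrite -ar.
  move=> K psi ep pr.
  have [phi phiP] : exists phi : k -> K, forall r, phi (eps r) = psi r.
    exists (fun z => match excluded_middle_informative (exists r, z = eps r) with
      | left h => psi (proj1_sig (constructive_indefinite_description _ h))
      | right _ => 0 end) => s.
    case: excluded_middle_informative => [h|[]]; last by exists s.
    case: constructive_indefinite_description => s' /= E.
    apply/eqP; rewrite -subr_eq0 -rmorphB; apply/eqP/ep.
    by rewrite rmorphB E subrr.
  exists phi; split=> //.
  - by move=> z z' [s ->] [s' ->]; rewrite -rmorphD !phiP rmorphD.
  - by move=> z z' [s ->] [s' ->]; rewrite -rmorphM !phiP rmorphM.
  - by rewrite ar phiP.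
have [d1 d1n h1] := IH _ _ ga a0.
have [d [H [dn Hs h]]] := extension_step d1n.
exists d => // K psi ep pd; have [h0 hsz hf hn] := h K psi ep pd.
have [y' [fy dy]] : exists y', factors (eval_at eps x) (eval_at psi y') /\ eval_at psi y' d1 != 0.
  have [HE|Hn] := eqVneq H 0.
    have /closed_nonrootP [y' ny] := h0 HE.
    by exists y'; split; [apply: hf; rewrite HE rmorph0 root0 | exact: ny].
  have /closed_rootP [y' ry] : size (map_poly psi H) != 1.
    by rewrite hsz; case: Hs => [H0|]; [rewrite H0 eqxx in Hn | case: (size H) => [|[]]].
  by exists y'; split; [apply: hf | apply: hn].
have [phi [p1 p2 p3 p4]] := h1 K (eval_at psi y') fy dy.
exists phi; split=> // r.
by rewrite -(eval_atC eps x) p1 eval_atC.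
Qed.

End Generated.
End Extension.

Lemma int_nonroot (q : {poly int}) (g : nat -> int) :
  q != 0 -> injective g -> exists n, q.[g n] != 0.
Proof.
move=> q0 gI; have [/allP h|/allPn [n _ ?]] := boolP (all (fun n => root q (g n)) (iota 0 (size q))).
  have := @max_poly_roots _ q (map g (iota 0 (size q))) q0.
  rewrite map_inj_uniq ?iota_uniq // size_map size_iota ltnn => h'.
  by suff: false by []; apply: h' => //; apply/allP => _ /mapP [n ni ->]; apply: h.
by exists n.
Qed.

(** Euclid's argument: if [c] is the constant coefficient, [H] takes at the
    multiples of [c * N`!] values [c * u] with [u] congruent to one modulo [N`!],
    and [u] is a unit only finitely often. *)
Lemma schur (H : {poly int}) (N : nat) : (1 < size H)%N ->
  exists p n, [/\ prime p, (N < p)%N & (p%:Z %| H.[n])%Z].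
Proof.
move=> sH; pose c := H`_0.
have [c0|c0] := eqVneq c 0.
  have [p pN pp] := prime_above N; exists p, 0; split=> //.
  by rewrite horner_coef0 -/c c0 dvdz0.
pose M := (N`!)%:Z; have M0 : M != 0 by rewrite /M; have := fact_gt0 N; lia.
have HE x : exists s, H.[x] = c + x * s.
  have /factor_theorem [s' E] : root (H - c%:P) 0.
    by rewrite /root !hornerE horner_coef0 subrr.
  by exists s'.[x]; rewrite -[H](subrK c%:P) E !hornerE; ring.
have q0 : (H - c%:P) * (H + c%:P) != 0.
  have nz b : H + b%:P != 0.
    apply: contraTneq sH => /eqP; rewrite addr_eq0 => /eqP ->.
    by rewrite -leqNgt size_polyN size_polyC; case: eqP.
  by rewrite -polyCN mulf_neq0.
have [|j hj] := @int_nonroot _ (fun j => c * M * j%:Z) q0.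
  by move=> i j /mulfI; rewrite mulf_neq0 // => /(_ isT) [].
have [s sE] := HE (c * M * j%:Z).
have E : H.[c * M * j%:Z] = c * (1 + M * (j%:Z * s)) by rewrite sE; ring.
set u := 1 + _ in E.
have u1 : (`|u| != 1)%N.
  apply: contraNneq hj => u1; rewrite !hornerE E.
  have [->|->] : u = 1 \/ u = -1 by lia.
    by rewrite mulr1 subrr mul0r.
  by rewrite mulrN1 addNr mulr0.
have [u0|u0] := eqVneq u 0.
  have [p pN pp] := prime_above N; exists p, (c * M * j%:Z); split=> //.
  by rewrite E u0 mulr0 dvdz0.
have [|p pp pu] := @pdivP `|u|%N; first by lia.
exists p, (c * M * j%:Z); split=> //; last by rewrite E dvdz_mull // dvdzE.
rewrite ltnNge; apply/negP => pN.
have pM : (p%:Z %| M)%Z by rewrite dvdzE /M /= dvdn_fact // prime_gt0.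
have : (p%:Z %| u - M * (j%:Z * s))%Z.
  by apply: rpredB; [rewrite dvdzE | apply: dvdz_mulr].
by rewrite /u addrK dvdzE /= dvdn1 => /eqP p1; rewrite p1 in pp.
Qed.

Section ResidueField.
Variables (k : fieldType) (hk : [pchar k] =i pred0).

Lemma int_inj_pchar0 (n : int) : n%:~R = 0 :> k -> n = 0.
Proof.
have nat0 m : m%:R = 0 :> k -> m = 0%N.
  by move/eqP; rewrite ((pcharf0P k).1 hk) => /eqP.
case: n => m; first by move=> /nat0 ->.
by rewrite NegzE rmorphN => /eqP; rewrite oppr_eq0 => /eqP /nat0.
Qed.

(** Modulo arbitrarily large primes, [t] can be replaced by an integer [n] without
    violating the integer polynomial relations of [t] and without killing [d]: any
    [n] that is not a root of [d] if [t] is transcendental, and a root of the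
    minimal equation of [t] otherwise. *)
Lemma residue_point (t : k) (d : {poly int}) (N : nat) :
  (map_poly intr d).[t] != 0 ->
  exists p n, [/\ prime p, (N < p)%N, ~~ (p%:Z %| d.[n])%Z &
    forall P : {poly int}, (map_poly intr P).[t] = 0 -> (p%:Z %| P.[n])%Z].
Proof.
move=> dt; pose eps : {rmorphism int -> k} := intr.
have dt' : eval_at eps t d != 0 by [].
have [d0 [H [d0n Hs h]]] := extension_step dt'.
have big (m : int) p : m != 0 -> (`|m| < p)%N -> ~~ (p%:Z %| m)%Z.
  move=> m0 mp; rewrite dvdzE /=; apply/negP => /dvdn_leq.
  by rewrite absz_gt0 m0 => /(_ isT); rewrite leqNgt mp.
have [H0|Hn] := eqVneq H 0.
  have dn : d != 0 by apply: contraNneq dt => ->; rewrite rmorph0 horner0.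
  have [n nd] := @int_nonroot d (fun n => n%:Z) dn (fun i j => @congr1 _ _ absz i j).
  have [p] := prime_above (maxn N `|d.[n%:Z]|); rewrite gtn_max => /andP [pN pd] pp.
  exists p, n%:Z; split=> //; first exact: big.
  move=> P Pt; have [_ _ hf _] := h k eps (fun r => id) d0n.
  have := hf n%:~R; rewrite H0 rmorph0 root0 => /(_ isT P Pt).
  rewrite eval_atE horner_map => /int_inj_pchar0 ->.
  exact: dvdz0.
have sH : (1 < size H)%N by case: Hs => // H0; rewrite H0 eqxx in Hn.
have [p [n [pp]]] := schur (maxn N `|d0|) sH; rewrite gtn_max => /andP [pN pd] pH.
pose psi : {rmorphism int -> 'F_p} := intr.
have dvdE (z : int) : (psi z == 0) = (p%:Z %| z)%Z.
  by rewrite (dvdz_pcharf (pchar_Fp pp)).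
have ep : factors eps psi by move=> r /int_inj_pchar0 ->; rewrite rmorph0.
have d0' : d0 != 0 by apply: contraNneq d0n => ->; rewrite rmorph0.
have pd0 : psi d0 != 0 by rewrite dvdE big.
have [_ _ hf hn] := h _ psi ep pd0.
have ry : root (map_poly psi H) (psi n) by rewrite /root horner_map dvdE.
exists p, n; split=> //.
  by have := hn Hn _ ry; rewrite eval_atE horner_map dvdE.
by move=> P Pt; have /eqP := hf _ ry P Pt; rewrite eval_atE horner_map dvdE.
Qed.

End ResidueField.

(** * Cyclic symmetry *)

Section FixedPoints.
Variables (Om : finType) (K : nzRingType) (p : nat) (rho : {perm Om}) (F : Om -> K).
Hypotheses (pp : prime p) (chK : p \in [pchar K]) (rp : (rho ^+ p = 1)%g).

(** The other orbits have [p] elements with equal values. *)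
Lemma sum_fixed (S : {set Om}) : (forall x, x \in S -> rho x \in S) ->
  (forall x, x \in S -> F (rho x) = F x) ->
  \sum_(x in S) F x = \sum_(x in S | rho x == x) F x.
Proof.
have [n] := ubnP #|S|; elim: n S => // n IH S leS stS Finv.
have [/existsP [x /andP [xS nx]]|nx] := boolP [exists x, (x \in S) && (rho x != x)]; last first.
  apply: eq_bigl => x; case xS: (x \in S) => //=.
  by apply/esym; apply: contraNT nx => nx; apply/existsP; exists x; rewrite xS.
pose O := porbit rho x.
have xO : x \in O by apply: porbit_id.
have itS m y : y \in S -> (rho ^+ m)%g y \in S.
  by move=> yS; rewrite permX; elim: m => //= m /stS.
have itF m y : y \in S -> F ((rho ^+ m)%g y) = F y.
  move=> yS; elim: m => [|m IHm]; first by rewrite expg0 perm1.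
  by rewrite expgSr permM Finv ?IHm // itS.
have OS : O \subset S.
  by apply/subsetP => y /porbitP [i ->]; apply: itS.
have FO y : y \in O -> F y = F x by move=> /porbitP [i ->]; rewrite itF.
have cO : #|O| = p.
  have : (#|O| %| p)%N.
    apply: (dvdn_trans (n := #|<[rho]>|%g)); first by rewrite /O porbitE dvdn_orbit.
    by rewrite -orderE order_dvdn rp.
  case/primeP: pp => _ h /h /orP [/eqP O1|/eqP //].
  have : rho x \in O by rewrite -[rho]expg1 mem_porbit.
  have [y Oy] : exists y, O = [set y] by apply/cards1P/eqP.
  by move: xO; rewrite Oy !inE => /eqP xy /eqP E; move: nx; rewrite E xy eqxx.
have sO : \sum_(y in O) F y = 0.
  rewrite (eq_bigr (fun=> F x)) => [|y /FO //].
  by rewrite sumr_const cO -mulr_natr (pcharf0 chK) mulr0.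
have fO y : y \in O -> rho y != y.
  move=> /porbitP [i ->]; rewrite -permM -expgSr expgS permM.
  by rewrite (inj_eq perm_inj).
have stD y : y \in S :\: O -> rho y \in S :\: O.
  rewrite !inE => /andP [yO yS]; rewrite stS // andbT; apply: contra yO => h.
  by rewrite -eq_porbit_mem -(porbit_perm rho 1 y) expg1 eq_porbit_mem.
rewrite (big_setID O) /= (setIidPr OS) sO add0r IH //; first last.
- by move=> y; rewrite in_setD => /andP [_]; apply: Finv.
- have := cardsID O S; rewrite (setIidPr OS) cO => E.
  by move: leS; rewrite -E ltnS; apply: leq_trans; rewrite -addn1 addnC leq_add2r prime_gt0.
apply: eq_bigl => y; rewrite in_setD; case yO: (y \in O) => //=.
by rewrite (negbTE (fO _ yO)) andbF.
Qed.
End FixedPoints.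

Section CyclicShift.
Variable p : nat.
Hypothesis pp : prime p.
Notation J := 'I_p.

Lemma val_iter_ordS m (s : J) : val (iter m (@ordS p) s) = ((s + m) %% p)%N.
Proof.
elim: m => [|m IH] /=; first by rewrite addn0 modn_small.
by rewrite IH -addn1 modnDml addn1 addnS.
Qed.

(** A shift-invariant transitive relation on a cycle of prime length that relates
    two distinct positions relates all of them, since a nonzero shift generates
    the whole cyclic group. *)
Lemma shift_invariant (r : rel J) : transitive r ->
  (forall s s', r (ordS s) (ordS s') = r s s') ->
  (exists s s', s != s' /\ r s s') -> forall s s', r s s'.
Proof.
move=> tr sh [s [s' [ns rs]]].
have shm m x y : r (iter m (@ordS p) x) (iter m (@ordS p) y) = r x y.
  by elim: m => //= m <-; rewrite sh.
have reach (x y : J) : exists m, iter m (@ordS p) x = y.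
  exists (y + (p - x))%N; apply: val_inj; rewrite val_iter_ordS /=.
  by rewrite addnCA subnKC ?(ltnW (ltn_ord x)) // modnDr modn_small.
have [d dE] := reach s s'.
have cd : coprime d p.
  rewrite coprime_sym prime_coprime //; apply: contra ns => /dvdnP [q dq].
  by rewrite -val_eqE -dE val_iter_ordS dq addnC modnMDl modn_small.
have step x : r x (iter d (@ordS p) x).
  have [m <-] := reach s x; rewrite -iterD addnC iterD dE.
  by rewrite shm.
have steps q x : (0 < q)%N -> r x (iter (q * d) (@ordS p) x).
  elim: q => // -[|q] IH _; first by rewrite mul1n.
  rewrite mulSn iterD; apply: tr (IH isT) _; exact: step.
move=> x y; have [m mE] := reach x y.
have d0 : (0 < d)%N by case: (d) cd => // /eqP; rewrite gcd0n => p1; move: pp; rewrite p1.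
have [u v uv _] := egcdnP p d0; rewrite (eqnP cd) in uv.
have u0 : (0 < u)%N by case: (u) uv => //; rewrite mul0n addn1.
have := steps (u * (m + p))%N x.
rewrite muln_gt0 u0 addn_gt0 (prime_gt0 pp) orbT => /(_ isT).
suff -> : iter (u * (m + p) * d) (@ordS p) x = y by [].
apply: val_inj; rewrite -mE !val_iter_ordS mulnAC uv.
rewrite (_ : x + (v * p + 1) * (m + p) = (v * (m + p) + 1) * p + (x + m))%N.
  exact: modnMDl.
ring.
Qed.

End CyclicShift.

Section Rotation.
Variables (k : fieldType) (nu : measure k) (X : perm_obj) (N : nat).
Notation w := (mu_poset nu).
Notation wr := (weight nu).
Notation I := ('I_(num_summands X)).
Notation p := N.+2.
Notation J := 'I_p.
Notation T := (J * point X)%type.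
Notation t := (list_weight nu lpoint).
Hypothesis pp : prime p.
Implicit Types (om : config X J).

Definition shift (x : T) : T := (ordS x.1, x.2).

Definition rotate om : config X J :=
  ([ffun s => om.1 (ordS s)], [ffun xy => om.2 (shift xy.1, shift xy.2)]).

Lemma iter_rotate m om : iter m rotate om =
  ([ffun s => om.1 (iter m (@ordS p) s)],
   [ffun xy => om.2 ((iter m (@ordS p) xy.1.1, xy.1.2), (iter m (@ordS p) xy.2.1, xy.2.2))]).
Proof.
elim: m => [|m IH] /=.
  case: om => q e; congr (_, _); apply/ffunP => z; rewrite ffunE //=.
  by case: z => [[s u] [s' v]].
rewrite IH; congr (_, _); apply/ffunP => z; rewrite !ffunE //=.
  by rewrite -iterSr.
by rewrite -!iterSr.
Qed.

Lemma iter_ordS_id s : iter p (@ordS p) s = s.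
Proof. by apply: val_inj; rewrite val_iter_ordS modnDr modn_small. Qed.

Lemma iter_rotate_id om : iter p rotate om = om.
Proof.
rewrite iter_rotate; case: om => q e; congr (_, _); apply/ffunP => z; rewrite !ffunE.
  by rewrite iter_ordS_id.
by case: z => [[s u] [s' v]]; rewrite !iter_ordS_id.
Qed.

Lemma rotate_inj : injective rotate.
Proof.
move=> om om' E; rewrite -[om]iter_rotate_id -[om']iter_rotate_id.
by rewrite !iterSr E.
Qed.

Definition rotate_perm : {perm config X J} := perm rotate_inj.

Lemma rotate_perm_order : (rotate_perm ^+ p = 1)%g.
Proof.
apply/permP => om; rewrite permX perm1 -[RHS]iter_rotate_id.
by apply: eq_iter => om'; rewrite permE.
Qed.

Lemma conf_rotate om : confon [set: J] om -> confon [set: J] (rotate om).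
Proof.
case/andP=> /confP [/ppoP [tr rf] dm fb] /eqP so; apply/andP; split; last first.
  apply/eqP/setP => s; rewrite !inE ffunE.
  by have /setP/(_ (ordS s)) := so; rewrite !inE.
apply/confP; split => /=.
- apply/ppoP; split=> [v u x|u v]; rewrite !ffunE /=; first exact: tr.
  exact: rf.
- by move=> x; rewrite !ffunE dm.
- by move=> s u v; rewrite !ffunE; apply: fb.
Qed.

Lemma coef_rotate (f : perm_hom k X X) om s s' :
  coef f (rotate om) s s' = coef f om (ordS s) (ordS s').
Proof.
rewrite /coef /= !ffunE; case: (om.1 (ordS s)) => [i|] //; case: (om.1 (ordS s')) => [j|] //.
congr (coef_at _ _); apply/ffunP => -[x y]; rewrite !ffunE /=.
by case: x => ?; case: y => ?.
Qed.

Lemma wr_rotate om : conf om -> wr (rotate om).2 = wr om.2.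
Proof.
case/confP=> po dm fb; have /ppoP [tr rf] := po.
apply: (wr_eq nu (g := shift)) => //.
- apply/ppoP; split=> [v u x|u v]; rewrite !ffunE /=; first exact: tr.
  exact: rf.
- by move=> u v _ _; rewrite ffunE.
- move=> [s u] vv; exists (ord_pred s, u).
  by rewrite /shift ffunE /= /shift /= ord_predK.
Qed.

(** In the constant configuration all positions carry the same copy of the
    summand [i]: the position of a label is forgotten. *)
Definition const_lab (i : I) (x : T) : option (summand i) := [pick q | x.2 == mkpoint q].
Definition const_conf (i : I) : config X J := ([ffun => Some i], pull (const_lab i)).

Lemma const_labE i s (q : summand i) : const_lab i (s, mkpoint q) = Some q.
Proof.
rewrite /const_lab; case: pickP => [q' /eqP /mkpoint_inj -> //|/(_ q)].
by rewrite eqxx.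
Qed.

Lemma const_lab_tag i x : const_lab i x = (tag x.2 == i) :> bool.
Proof.
case: x => s [j q] /=; case: eqP => [ij|nij]; first by subst j; rewrite (const_labE s q).
by rewrite /const_lab; case: pickP => // q' /eqP /(congr1 tag).
Qed.

Lemma pull_const_lab i s s' u v : tag u = i -> tag v = i ->
  pull (const_lab i) ((s, u), (s', v)) = le_point u v.
Proof.
case: u => j q /= ji; subst j; case: v => j q' /= ji; subst j.
by rewrite (pullE (const_labE s q) (const_labE s' q')) (le_pointE q q').
Qed.

Lemma conf_const i : confon [set: J] (const_conf i).
Proof.
apply/andP; split; last by apply/eqP/setP => s; rewrite !inE ffunE.
apply/confP; split => /=.
- exact: ppo_pull.
- by move=> x; rewrite pull_refl const_lab_tag ffunE eq_sym.
- by move=> s u v; rewrite ffunE => -[iu] [iv]; rewrite pull_const_lab.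
Qed.

Lemma coef_const (f : perm_hom k X X) i s s' :
  coef f (const_conf i) s s' = f i i (class_of_amalg (id_amalg (summand i))).
Proof.
rewrite /coef /= !ffunE -coef_atE; congr (coef_at _ _).
apply/ffunP => -[x y]; rewrite [LHS]ffunE [RHS]ffunE.
have key z : const_lab i (place2 s s' z) = Some (am_map (id_amalg (summand i)) z).
  by case: z => q; rewrite /= const_labE mk_embeddingE.
by rewrite (pullE (key _) (key _)).
Qed.

Lemma wr_const i : wr (const_conf i).2 = w (summand i).
Proof. by apply: wr_pull => q; exists (ord0, mkpoint q); rewrite const_labE. Qed.

Lemma rotate_const i : rotate (const_conf i) = const_conf i.
Proof.
congr (_, _); apply/ffunP => z; first by rewrite !ffunE.
by rewrite [LHS]ffunE [LHS]ffunE [RHS]ffunE.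
Qed.

(** In a configuration that is invariant under rotation all positions carry the
    same summand, and for each point [u] of that summand the [p] copies of [u]
    either coincide or form an antichain. *)
Lemma rotate_fixed om : confon [set: J] om -> rotate om = om ->
  (exists i, om = const_conf i) \/
  (exists u, forall s s', om.2 ((s, u), (s', u)) = (s == s')).
Proof.
case/andP=> /confP [/ppoP [tr rf] dm fb] /eqP so ro.
have shq s : om.1 (ordS s) = om.1 s by rewrite -{2}ro ffunE.
have she s s' u v : om.2 ((ordS s, u), (ordS s', v)) = om.2 ((s, u), (s', v)).
  by rewrite -{2}ro ffunE.
have [i oi] : exists i, om.1 ord0 = Some i.
  by have /setP/(_ ord0) := so; rewrite !inE; case: (om.1 ord0) => // i _; exists i.
have {}oi s : om.1 s = Some i.
  rewrite -oi; have -> : s = iter s (@ordS p) ord0.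
    by apply: val_inj; rewrite val_iter_ordS add0n modn_small.
  by elim: (val s) => //= m IH; rewrite shq.
have dmi s u : om.2 ((s, u), (s, u)) = (tag u == i).
  by rewrite dm oi /= eq_sym.
have [/existsP [u /andP [/eqP ui nu']]|all_eq] :=
  boolP [exists u : point X, (tag u == i) && ~~ [forall s, forall s', om.2 ((s, u), (s', u))]].
  right; exists u => s s'; case: eqP => [<-|/eqP ns]; first by rewrite dmi ui eqxx.
  apply/negP => rs; case/negP: nu'; apply/forallP => x; apply/forallP => y.
  apply: (shift_invariant pp (r := fun s s' => om.2 ((s, u), (s', u)))).
  - by move=> b a c; apply: tr.
  - by move=> a b; apply: she.
  - by exists s, s'.
left; exists i.
have E u s s' : tag u = i -> om.2 ((s, u), (s', u)).
  move=> ui; have := all_eq; rewrite negb_exists => /forallP /(_ u).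
  by rewrite ui eqxx negbK /= => /forallP /(_ s) /forallP /(_ s').
rewrite [om]surjective_pairing; congr (_, _); first by apply/ffunP => s; rewrite ffunE oi.
apply/ffunP => -[[s u] [s' v]].
have [ui|ui] := eqVneq (tag u) i; have [vi|vi] := eqVneq (tag v) i.
- rewrite pull_const_lab // -(fb s) ?oi ?ui ?vi //.
  apply/idP/idP => h; first exact: tr h (E v s' s vi).
  exact: tr h (E v s s' vi).
- rewrite [RHS]ffunE /=; have := const_lab_tag i (s', v); rewrite /= (negbTE vi).
  case: (const_lab i (s', v)) => // _; case: (const_lab _ _) => [_|];
    by apply/negP => /rf [_]; rewrite dmi (negbTE vi).
- rewrite [RHS]ffunE /=; have := const_lab_tag i (s, u); rewrite /= (negbTE ui).
  case: (const_lab i (s, u)) => // _.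
  by apply/negP => /rf []; rewrite dmi (negbTE ui).
- rewrite [RHS]ffunE /=; have := const_lab_tag i (s, u); rewrite /= (negbTE ui).
  case: (const_lab i (s, u)) => // _.
  by apply/negP => /rf []; rewrite dmi (negbTE ui).
Qed.

Lemma wr_antichain eps om u : ppo om.2 ->
  (forall P : fposet, exists2 h, w P = eval_t nu h &
     forall Y : {set P}, antichain Y -> exists g, h = rising eps #|Y| * g) ->
  (forall s s', om.2 ((s, u), (s', u)) = (s == s')) ->
  exists g, wr om.2 = eval_t nu (rising eps p * g).
Proof.
move=> po wp au; have [h wh ah] := wp (quot om.2).
have lu s : exists a, lab om.2 (s, u) = Some a.
  by have [|a ? _] := @labP _ om.2 (s, u); [rewrite au | exists a].
have [l lE] := fin_all_exists lu.
have lle s s' : (l s <= l s')%O = (s == s').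
  by rewrite -(pullE (lE s) (lE s')) pull_lab // au.
have linj : injective l by move=> s s' E; apply/eqP; rewrite -lle E.
have an : antichain [set l s | s : J].
  by move=> _ _ /imsetP [s _ ->] /imsetP [s' _ ->]; rewrite lle => /eqP ->.
have [g hg] := ah _ an.
by exists g; rewrite /weight po wh hg card_imset // card_ord.
Qed.

End Rotation.

(** Among [p] consecutive integers one is divisible by [p]. *)
Lemma intr_factor (K : fieldType) (p : nat) (eps n : int) : prime p -> p \in [pchar K] ->
  (eps = 1 \/ eps = -1) -> (rising eps p).[n]%:~R = 0 :> K.
Proof.
move=> pp chK eps1.
have nat0 m : (p %| m)%N -> m%:R = 0 :> K by move=> pm; apply/eqP; rewrite -(dvdn_pcharf chK).
have [j jE] : exists j : 'I_p, (n + eps *+ j)%:~R = 0 :> K.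
  have [m nm] : exists m : nat, (n * eps)%:~R = m%:R :> K.
    exists `|(n * eps %% p)%Z|%N.
    rewrite {1}(divz_eq (n * eps) p) rmorphD rmorphM /= [p%:~R]nat0 // mulr0 add0r.
    have : (0 <= (n * eps %% p)%Z)%R by rewrite modz_ge0 // -lt0n prime_gt0.
    by case: (n * eps %% p)%Z.
  have jp : ((p - m %% p) %% p < p)%N by rewrite ltn_mod prime_gt0.
  exists (Ordinal jp) => /=.
  have ee : eps * eps = 1 by case: eps1 => ->; rewrite ?mulrNN mulr1.
  have -> : n + eps *+ ((p - m %% p) %% p) = eps * (n * eps + ((p - m %% p) %% p)%:Z).
    by rewrite mulrDr mulrCA ee mulr1 -mulr_natr natz.
  rewrite rmorphM rmorphD /= nm -natrD nat0 ?mulr0 //.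
  rewrite /dvdn modnDmr -modnDml subnKC ?modnn //.
  by rewrite ltnW // ltn_mod prime_gt0.
rewrite /rising horner_prod rmorph_prod /= (bigD1 j) //= !hornerE jE mul0r //.
Qed.

Section Main.
Variables (k : fieldType) (hk : [pchar k] =i pred0) (nu : measure k) (X : perm_obj).
Variable f : perm_hom k X X.
Notation w := (mu_poset nu).
Notation wr := (weight nu).
Notation I := ('I_(num_summands X)).
Notation t := (list_weight nu lpoint).

Lemma exp_stable n m : (forall i j, perm_exp nu f n i j = 0) -> (n <= m)%N ->
  forall i j, perm_exp nu f m i j = 0.
Proof.
move=> h; elim: m => [|m IH]; first by rewrite leqn0 => /eqP <-.
rewrite leq_eqVlt => /orP [/eqP <- //|nm] i j /=.
rewrite /perm_comp big1 // => l _; rewrite (IH nm) /hom_comp big1 // => S _.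
by rewrite big1 // => R _; rewrite ffunE mulr0 scale0r.
Qed.

Definition coefs : seq k :=
  flatten [seq [seq f ij.1 ij.2 c | c <- enum {: amalg_class0 (summand ij.2) (summand ij.1)}]
          | ij <- enum {: I * I}].

Lemma mem_coefs i j c : f i j c \in coefs.
Proof.
apply/flatten_mapP; exists (i, j); first by rewrite mem_enum.
by apply/mapP; exists c; rewrite ?mem_enum.
Qed.

Theorem nilpotent_trace : (exists n, forall i j, perm_exp nu f n i j = 0) ->
  perm_trace nu f = 0.
Proof.
move=> [n0 fn]; apply/eqP; apply: contraT => tau0.
have [e [e1 wpoly]] := weight_poly nu.
pose eps : {rmorphism {poly int} -> k} := eval_at intr t.
have eval_tE h : eval_t nu h = eps h by [].
pose G := gen eps coefs.
have G0 : G 0 by rewrite -(rmorph0 eps); apply: gen_base.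
have G1 : G 1 by rewrite -(rmorph1 eps); apply: gen_base.
have Gw P : G (w P) by have [h -> _] := wpoly P; apply: gen_base.
have Gwr (T : finType) (r : brel T) : G (wr r) by rewrite /weight; case: ifP.
have Gf i j c : G (f i j c) by apply: gen_mem; apply: mem_coefs.
have Gsum (T : finType) (Q : pred T) (F : T -> k) :
    (forall x, G (F x)) -> G (\sum_(x | Q x) F x).
  move=> GF; elim/big_ind: _ => [//|x y|x _]; [exact: gen_add | exact: GF].
have Gprod (T : finType) (F : T -> k) : (forall x, G (F x)) -> G (\prod_x F x).
  move=> GF; elim/big_ind: _ => [//|x y|x _]; [exact: gen_mul | exact: GF].
have Gtau : G (perm_trace nu f) by apply: Gsum => i; exact: gen_mul (Gf _ _ _) (Gw _).
have [d dn spec] := specialize Gtau tau0.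
have [p [n [pp pN pd pP]]] := residue_point hk n0.+2 dn.
have [K0 [toK _]] := countable_algebraic_closure 'F_p.
pose K : closedFieldType := K0.
have chK : p \in [pchar K] by apply: (rmorph_pchar toK); apply: pchar_Fp.
pose psi0 : {rmorphism int -> K} := intr.
pose psi : {rmorphism {poly int} -> K} := eval_at psi0 (psi0 n).
have psiE P : psi P = (P.[n])%:~R by rewrite /psi eval_atE horner_map.
have psi_eq0 P : (psi P == 0) = (p%:Z %| P.[n])%Z by rewrite psiE (dvdz_pcharf chK).
have [||phi [phiE phiD phiM phi_tau]] := spec K psi.
- by move=> P /pP h; apply/eqP; rewrite psi_eq0.
- by rewrite psi_eq0.
have phi0 : phi 0 = 0 by rewrite -(rmorph0 eps) phiE rmorph0.
have phi1 : phi 1 = 1 by rewrite -(rmorph1 eps) phiE rmorph1.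
have phi_sum (T : finType) (Q : pred T) (F : T -> k) : (forall x, G (F x)) ->
    phi (\sum_(x | Q x) F x) = \sum_(x | Q x) phi (F x).
  move=> GF; suff [] : G (\sum_(x | Q x) F x) /\ phi (\sum_(x | Q x) F x) = \sum_(x | Q x) phi (F x) by [].
  apply: (big_ind2 (fun a b => G a /\ phi a = b)) => [//|x _ y _ [Gx <-] [Gy <-]|x _ //].
  by split; [apply: gen_add | rewrite phiD].
have phi_prod (T : finType) (F : T -> k) : (forall x, G (F x)) ->
    phi (\prod_x F x) = \prod_x phi (F x).
  move=> GF; suff [] : G (\prod_x F x) /\ phi (\prod_x F x) = \prod_x phi (F x) by [].
  apply: (big_ind2 (fun a b => G a /\ phi a = b)) => [//|x _ y _ [Gx <-] [Gy <-]|x _ //].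
  by split; [apply: gen_mul | rewrite phiM].
have phi_w P : phi (w P) ^+ p = phi (w P).
  have [h -> _] := wpoly P; rewrite eval_tE phiE psiE -(pFrobenius_autE chK).
  by rewrite rmorph_int.
(* the trace formula is for cycles with at least two positions *)
have [q pq] : exists q, p = q.+2 by case: (p) (pp) => [|[|q]] // _; exists q.
clear spec Gtau; move: pN pp pd pP chK psi_eq0 phi_w; rewrite pq.
move=> pN pp _ _ chK _ phi_w.
have Gcoef om s s' : G (coef f (om : config X 'I_q.+2) s s').
  rewrite /coef; case: (om.1 s) => // i; case: (om.1 s') => // j.
  by rewrite /coef_at; case: insub.
pose F (om : config X 'I_q.+2) := phi ((\prod_s coef f om s (ordS s)) * wr om.2).
have F1 om : F om = (\prod_s phi (coef f om s (ordS s))) * phi (wr om.2).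
  by rewrite /F phiM; [rewrite phi_prod | apply: Gprod | apply: Gwr].
have := trace_power nu f q.
have -> : perm_trace nu (perm_comp nu f (perm_exp nu f q)) = 0.
  rewrite /perm_trace big1 // => i _.
  rewrite (_ : perm_comp nu f (perm_exp nu f q) = perm_exp nu f q.+1) //.
  by rewrite (exp_stable fn) ?ffunE ?mul0r //; move: pN; lia.
move=> /(congr1 phi); rewrite phi0 phi_sum; last by move=> om; apply: gen_mul; [apply: Gprod | apply: Gwr].
pose S := [set om : config X 'I_q.+2 | confon [set: 'I_q.+2] om].
have -> : \sum_(om | confon [set: 'I_q.+2] om) phi ((\prod_s coef f om s (ordS s)) * wr om.2)
    = \sum_(om in S) F om by apply: eq_bigl => om; rewrite inE.
pose rho := rotate_perm X q.
have FS om : om \in S -> F (rho om) = F om.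
  rewrite inE => /andP [co _]; rewrite !F1 permE wr_rotate //; congr (_ * _).
  rewrite [RHS](reindex_inj (@ordS_inj _)) /=.
  by apply: eq_bigr => s _; rewrite coef_rotate.
have SS om : om \in S -> rho om \in S by rewrite !inE permE => /conf_rotate.
(* what remains are the constant configurations and those that contain an
   antichain with one element per position *)
rewrite (sum_fixed pp chK (rotate_perm_order X q) SS FS).
rewrite (bigID (fun om => om \in [set const_conf q i | i : I])) /=.
rewrite [X in _ + X]big1 ?addr0 => [|om]; last first.
  case/andP=> /andP [oS /eqP ro] ni; rewrite F1.
  have {}ro : rotate om = om by rewrite -{2}ro permE.
  have co : confon [set: 'I_q.+2] om by move: oS; rewrite inE.
  have [[i oi]|[u au]] := rotate_fixed pp co ro.
    by case/imsetP: ni; exists i.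
  have po : ppo om.2 by case/andP: co => /confP [].
  have [g ->] := wr_antichain po wpoly au.
  rewrite eval_tM [phi (_ * _)]phiM; [|exact: gen_base..].
  by rewrite [eval_t nu (rising _ _)]eval_tE phiE psiE (intr_factor n pp chK e1) mul0r mulr0.
have cinj : injective (const_conf q : I -> config X 'I_q.+2).
  by move=> i j /(congr1 (fun om : config X 'I_q.+2 => om.1 ord0)); rewrite !ffunE => -[].
rewrite (eq_bigl (fun om => om \in [set const_conf q i | i : I])) => [|om]; last first.
  rewrite andb_idl // => /imsetP [i _ ->].
  by rewrite inE conf_const permE rotate_const eqxx.
rewrite big_imset /=; last by move=> i j _ _; apply: cinj.
move=> E; case/negP: phi_tau.
have : phi (perm_trace nu f) ^+ q.+2 == 0.
  rewrite phi_sum; last by move=> i; apply: gen_mul (Gf _ _ _) (Gw _).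
  rewrite -(pFrobenius_autE chK) rmorph_sum /=; apply/eqP; rewrite [RHS]E.
  apply: eq_bigr => i _.
  rewrite F1 wr_const (phiM _ _ (Gf _ _ _) (Gw _)) pFrobenius_autE exprMn phi_w; congr (_ * _).
  rewrite (eq_bigr (fun _ => phi (f i i (class_of_amalg (id_amalg (summand i)))))).
    by rewrite prodr_const card_ord.
  by move=> s _; rewrite coef_const.
by rewrite expf_eq0.
Qed.

End Main.
Theorem corollary8p3 (k : fieldType) (hk : [pchar k] =i pred0)
    (nu : measure k) (X : perm_obj) (f : perm_hom k X X)
    (hf : perm_nilpotent nu f) :
  perm_trace nu f = 0.
Proof. exact: (nilpotent_trace hk hf). Qed.
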